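(* Let $k\geq 3$ be a fixed integer. For every $\varepsilon>0$ there is a constant $C=C(k,\varepsilon)>0$ such that for all real $N\geq 1$ and all real $H$ with $1\leq H\leq N$, $$\Big|\sum_{1\leq h\leq H}\Delta_k(N;h)\Big|\leq C\,N^{\varepsilon}\big(H^2+N^{1+\beta_k}\big),$$ where the sum is over integers $h$, and $\Delta_k(N;h)$ and $\beta_k$ are as defined in the context.
   Context: For $k\in\mathbb N$, $d_k(n)$ denotes the number of ways of writing $n$ as an ordered product of $k$ positive integers, so that $\sum_{n\ge1}d_k(n)n^{-s}=\zeta(s)^k$ for $\Re s>1$. Let $\Delta_k(x):=\sum_{n\le x}d_k(n)-\operatorname{Res}_{s=1}\big(\zeta(s)^k x^s/s\big)$ (the error term in the general divisor problem), and define $$\beta_k:=\inf\Big\{b:\ \int_1^X|\Delta_k(x)|^2\,dx\ll X^{1+2b}\ \text{for all } X\ge1\Big\}.$$ Let $\mu$ be the Möbius function, $\varphi$ Euler's totient function, $\nu_p(m)$ the $p$-adic valuation of $m$, and $c_q(h):=\sum_{d\mid (h,q)}d\,\mu(q/d)$ the Ramanujan sum. For positive integers $d,e,q$ set $$\Psi_{d,e}(s,q,k):=\frac{d\,\mu(d)\mu(e)}{\varphi(d)\,e}\prod_{p\mid (eq/d)}\Big\{\Big(1-\frac1{p^s}\Big)^k\sum_{\nu=0}^\infty\frac{d_k\big(p^{\nu+\nu_p(eq/d)}\big)}{p^{\nu s}}\Big\},$$ and define $$Q_k(x,q):=\operatorname{Res}_{s=1}\Big\{\zeta(s)^k\sum_{d\mid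 q}\sum_{e\mid d}\Psi_{d,e}(s,q,k)\Big(\frac{ex}{dq}\Big)^{s-1}\Big\},\qquad \mathfrak S_k(x,h):=\sum_{q=1}^\infty\frac{c_q(h)}{q^2}Q_k(x,q)^2.$$ Finally, for a positive integer $h$, $$\Delta_k(N;h):=\sum_{N<n\le 2N}d_k(n)d_k(n+h)-\int_N^{2N}\mathfrak S_k(x,h)\,dx.$$ *)

(* Defs.v *)
From HB Require Import structures.
From mathcomp Require Import all_boot all_order all_algebra.
From mathcomp Require Import complex.
From mathcomp Require Import all_classical all_reals all_analysis.

Set Implicit Arguments.
Unset Strict Implicit.
Unset Printing Implicit Defensive.

Import Order.TTheory GRing.Theory Num.Theory.
Import numFieldNormedType.Exports.

Local Open Scope classical_set_scope.
Local Open Scope ring_scope.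
Local Open Scope complex_scope.

Section Arithmetic.

Local Open Scope nat_scope.

(* For n > 0 a factor of n is at most n, so bounding the factors by n loses
   nothing, and they are automatically positive. *)
Definition divk (k n : nat) : nat :=
  #|[set t : {ffun 'I_k -> 'I_n.+1} | \prod_(i < k) (t i : nat) == n]|.

Definition mobius (n : nat) : int :=
  (if all (fun p => logn p n == 1%N) (primes n)
   then (-1) ^+ size (primes n) else 0)%R.

Definition ramanujan_sum (q h : nat) : int :=
  (\sum_(d <- divisors (gcdn h q)) (d%:Z * mobius (q %/ d)))%R.

End Arithmetic.

(* Seen as a numClosedFieldType, R[i] gets the topology and the normed module
   structure over itself that numFieldNormedType gives to a numFieldType; in
   particular, derivable f z 1 means complex differentiability at z. *)
Definition Cx (R : realType) : numClosedFieldType := R[i].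

Lemma limn_subr0 (K : numFieldType) (u v : nat -> K) :
  v @ \oo --> (0 : K) -> limn (fun n : nat => u n - v n) = limn u.
Proof.
move=> v0; congr (get _); apply/funext => l /=; apply/propext; split=> h.
- rewrite -[l]addr0 (_ : u = fun n => (u n - v n) + v n); first exact: cvgD.
  by apply/funext => n; rewrite subrK.
- by rewrite -[l]subr0; exact: cvgB.
Qed.

Section ComplexAnalysis.

Variable R : realType.
Local Notation C := (Cx R).

Definition cexp (z : C) : C :=
  (expR (complex.Re z))%:C
  * (cos (complex.Im z) +i* sin (complex.Im z)).

(* Meant for x > 0 only. *)
Definition cpow (x : R) (s : C) : C := cexp (s * (ln x)%:C).

(* The Riemann zeta function on Re s > 0, s <> 1. For Re s > 1 the subtracted
   term tends to 0 and this is the Dirichlet series (see zeta_dirichlet); the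
   limit exists and is holomorphic on all of Re s > 0, s <> 1. *)
Definition zeta (s : C) : C :=
  limn (fun n : nat =>
    \sum_(1 <= m < n.+1) cpow m%:R (- s) - cpow n%:R (1 - s) / (1 - s)).

Lemma normr_cexp (z : C) : `|cexp z| = (expR (complex.Re z))%:C.
Proof.
rewrite /cexp normrM.
have -> : `|cos (complex.Im z) +i* sin (complex.Im z) : R[i]| = 1.
  by rewrite normc_def /= cos2Dsin2 sqrtr1.
by rewrite mulr1 normc_def /= expr0n addr0 sqrtr_sqr ger0_norm ?expR_ge0.
Qed.

Lemma zeta_dirichlet (s : C) : 1 < complex.Re s ->
  zeta s = limn (fun n : nat => \sum_(1 <= m < n.+1) cpow m%:R (- s)).
Proof.
move=> s1; pose v (n : nat) : C := cpow n%:R (1 - s) / (1 - s).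
pose u (n : nat) : C := \sum_(1 <= m < n.+1) cpow m%:R (- s).
have v0 : v @ \oo --> (0 : C).
  apply/cvgr0Pnorm_lt => -[e e'] /= /[!ltcE] /= /andP[/eqP e'0 e0].
  have s_neq1 : 1 - s != 0.
    by rewrite subr_eq0; apply: contraTneq s1 => <-; rewrite ltxx.
  have [d dE] : exists d : R, `|1 - s| = d%:C.
    by exists (Num.sqrt (complex.Re (1 - s) ^+ 2 + complex.Im (1 - s) ^+ 2));
      case: (1 - s).
  have d0 : 0 < d by rewrite -ltcR -dE normr_gt0.
  have s1' : 1 - complex.Re s < 0 by rewrite subr_lt0.
  pose M := ln (e * d) / (1 - complex.Re s).
  near=> n.
  have Mn : expR M < n%:R by near: n; exact: nbhs_infty_gtr.
  have n0 : 0 < n%:R :> R by apply: lt_trans Mn; exact: expR_gt0.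
  rewrite /v normrM normfV dE ltr_pdivrMr ?ltcR// /cpow normr_cexp.
  have -> : complex.Re ((1 - s) * (ln (n%:R : R))%:C)
         = (1 - complex.Re s) * ln n%:R.
    by case: (s) => a b /=; rewrite mulr0 subr0.
  rewrite e'0 -[e +i* 0]/(e%:C) -rmorphM ltcR -[ltRHS]lnK ?posrE ?mulr_gt0//.
  rewrite ltr_expR -[ltRHS](divfK (ltr0_neq0 s1')) mulrC ltr_nM2r//.
  by rewrite -ltr_expR lnK ?posrE.
exact: (limn_subr0 u v0).
Unshelve. all: by end_near. Qed.

(* c is the coefficient of (z - a)^-1 in the Laurent expansion at a of a
   function f that is meromorphic at a: f minus a principal part extends
   holomorphically to a neighbourhood of a. *)
Definition is_residue (f : C -> C) (a c : C) : Prop :=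
  exists (m : nat) (b : nat -> C) (g : C -> C),
    [/\ b 0%N = c,
        (\forall z \near a, derivable g z 1) &
        (\forall z \near a^',
           f z = g z + \sum_(j < m.+1) b j / (z - a) ^+ j.+1)].

Definition Res (f : C -> C) (a : C) : C :=
  xget 0 [set c | is_residue f a c].

End ComplexAnalysis.

Section DivisorProblem.

Variable R : realType.
Local Notation C := (Cx R).

(* The functions whose residue is taken below are real on the real axis, hence
   so are the residues; complex.Re only changes the type. *)

Definition Delta (k : nat) (x : R) : R :=
  \sum_(1 <= n < (Num.truncn x).+1) (divk k n)%:R
  - complex.Re (Res (fun s : C => zeta s ^+ k * cpow x s / s) 1).

Definition beta (k : nat) : R :=
  inf [set b : R | exists K : R, forall X : R, 1 <= X ->
    (\int[lebesgue_measure]_(x in `[1%R, X]) (`|Delta k x| ^+ 2)%:E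
       <= (K * X `^ (1 + 2 * b))%:E)%E].

Definition Psi (d e : nat) (s : C) (q k : nat) : C :=
  d%:R * (mobius d)%:~R * (mobius e)%:~R / ((totient d)%:R * e%:R)
  * \prod_(p <- primes (e * q %/ d))
      ((1 - cpow p%:R (- s)) ^+ k
       * limn (fun n : nat => \sum_(0 <= v < n)
           (divk k (p ^ (v + logn p (e * q %/ d))))%:R
           / cpow p%:R (v%:R * s))).

Definition Qk (k : nat) (x : R) (q : nat) : R :=
  complex.Re (Res (fun s : C =>
    zeta s ^+ k
    * \sum_(d <- divisors q) \sum_(e <- divisors d)
        Psi d e s q k * cpow (e%:R * x / (d%:R * q%:R)) (s - 1)) 1).

Definition singular_series (k : nat) (x : R) (h : nat) : R :=
  limn (fun n : nat => \sum_(1 <= q < n.+1)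
    (ramanujan_sum q h)%:~R / q%:R ^+ 2 * Qk k x q ^+ 2).

Definition Delta_shift (k : nat) (N : R) (h : nat) : R :=
  \sum_(1 <= n < (Num.truncn (2 * N)).+1 | N < n%:R)
     (divk k n)%:R * (divk k (n + h))%:R
  - \int[lebesgue_measure]_(x in `[N, 2 * N]) singular_series k x h.

End DivisorProblem.

(* Main.v *)
(* Since zeta has a simple pole at 1 with a convergent Laurent expansion, all
   residues can be computed with power series: Q_k(x,q) is a polynomial in log x
   with Q_k(x,q) << (qx)^eps, and the main term M(x) of the divisor problem is x
   times such a polynomial, with M'(x) = Q_k(x,1).  Write D(x) = M(x) + Delta_k(x)
   for the summatory function of d_k.  Summing over h first gives
     sum_{h<=H} d_k(n) d_k(n+h) = d_k(n) (D(n+H) - D(n)),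
   and D(n+H) - D(n) = H Q_k(n,1) + O(H^2 n^(eps-1)) + Delta_k(n+H) - Delta_k(n).
   The Delta_k contributions cost N^eps times the first moment of Delta_k, which
   is O(N^(1+beta_k+eps)) by Cauchy-Schwarz; partial summation replaces the
   remaining d_k(n) by Q_k(n,1), its boundary terms H Delta_k(N) being compared
   with the sum of Delta_k over [N, N+H].  On the other side sum_{h<=H} c_q(h) is
   bounded independently of H for q >= 2, so only q = 1 survives in the singular
   series.  The remaining errors N^(1+eps) are admissible because beta_k >= 0,
   which follows from the jumps of D at the integers. *)
From HB Require Import structures.
Require Import Defs.
From mathcomp Require Import all_boot all_order all_algebra.
From mathcomp Require Import complex.
From mathcomp Require Import all_classical all_reals all_analysis.
From mathcomp Require Import measurable_realfun ring lra zify.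

Set Implicit Arguments.
Unset Strict Implicit.
Unset Printing Implicit Defensive.

Import Order.TTheory GRing.Theory Num.Theory.
Import numFieldNormedType.Exports.

Local Open Scope classical_set_scope.
Local Open Scope ring_scope.
Local Open Scope complex_scope.

(** The predicate [pser r M f a] carries, with the expansion of [f], a bound [M] for $\sum|a_j|r^j$,
    which is additive and submultiplicative. A residue becomes a coefficient, at most $M/r^k$, and a
    radius $r$ small against $\varepsilon$ turns factors $e^{r|\log y|}$ into small powers. This is
    the source of bounds for $Q_k(x,q)$ that are uniform in $q$.

    The bound for $\sum_{h\le H}c_q(h)$ that is free of $H$ is about $q^{1+\varepsilon}$, so the
    terms of the singular series come out as $q^{-1+O(\varepsilon)}$, which is not summable.
    Interpolation with the trivial bound $H^3$, free of $q$, gains a small power of $q$ at the cost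
    of $x^{O(\varepsilon)}$.

    The definition of $\beta_k$ controls an integral, whereas the argument needs sums over integers.
    The passage rests on $\Delta_k$ varying slowly between consecutive integers. The same fact,
    together with jumps of height at least 1, keeps $|\Delta_k|$ away from 0 on one side of every
    integer, and this is what excludes negative exponents. *)

(** * Real-valued modulus and convergence of complex sequences *)

Section ComplexModulus.
Variable R : realType.
Local Notation C := (Cx R).
Implicit Types (z w : C) (u v : nat -> C).

(** The norm of [Cx R] takes values in [Cx R] itself; its real part is an element of [R], where
    [lra] and the real order lemmas apply. *)
Definition cmod z : R := complex.Re `|z|.

Lemma normr_cmod z : `|z| = (cmod z)%:C :> C.
Proof. by rewrite /cmod normc_def. Qed.

Lemma cmod_ge0 z : 0 <= cmod z.
Proof. by rewrite -lecR -normr_cmod normr_ge0. Qed.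

Lemma cmodM z w : cmod (z * w) = cmod z * cmod w.
Proof. by apply: complexI; rewrite rmorphM /= -!normr_cmod normrM. Qed.

Lemma cmodX z n : cmod (z ^+ n) = cmod z ^+ n.
Proof. by apply: complexI; rewrite rmorphXn /= -!normr_cmod normrX. Qed.

Lemma cmodV z : cmod z^-1 = (cmod z)^-1.
Proof. by apply: complexI; rewrite fmorphV /= -!normr_cmod normfV. Qed.

Lemma cmodN z : cmod (- z) = cmod z.
Proof. by rewrite /cmod normrN. Qed.

Lemma cmodB z w : cmod (z - w) = cmod (w - z).
Proof. by rewrite -cmodN opprB. Qed.

Lemma cmodD z w : cmod (z + w) <= cmod z + cmod w.
Proof. by rewrite -lecR rmorphD /= -!normr_cmod ler_normD. Qed.

Lemma cmod_triangle z w t : cmod (z - t) <= cmod (z - w) + cmod (w - t).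
Proof. by apply: le_trans (cmodD _ _); rewrite addrA subrK. Qed.

Lemma cmod_real (r : R) : cmod (r%:C) = `|r|.
Proof. by rewrite /cmod normc_def /= expr0n addr0 sqrtr_sqr. Qed.

Lemma cmod0 : cmod 0 = 0.
Proof. by rewrite /cmod normr0. Qed.

Lemma cmod1 : cmod 1 = 1.
Proof. by rewrite /cmod normr1. Qed.

Lemma cmod_nat n : cmod n%:R = n%:R.
Proof. by rewrite /cmod normr_nat -(rmorph_nat (real_complex R)). Qed.

Lemma cmod_eq0 z : (cmod z == 0) = (z == 0).
Proof.
by rewrite -(inj_eq (@complexI _)) -normr_cmod -[0%:C]/(0 : C) normr_eq0.
Qed.

Lemma cmod_gt0 z : (0 < cmod z) = (z != 0).
Proof. by rewrite lt_def cmod_ge0 andbT cmod_eq0. Qed.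

Lemma cmod_sum (I : Type) (s : seq I) (P : pred I) (F : I -> C) :
  cmod (\sum_(i <- s | P i) F i) <= \sum_(i <- s | P i) cmod (F i).
Proof.
elim/big_rec2: _ => [|i y x _ ih]; first by rewrite cmod0.
by apply: le_trans (cmodD _ _) _; rewrite lerD2l.
Qed.

Lemma ler_Re_cmod z : `|complex.Re z| <= cmod z.
Proof. by rewrite -lecR -normr_cmod normc_ge_Re. Qed.

Lemma ler_Im_cmod z : `|complex.Im z| <= cmod z.
Proof.
case: z => a b; rewrite /cmod normc_def /= -sqrtr_sqr ler_sqrt.
  by rewrite lerDr sqr_ge0.
by rewrite addr_ge0 ?sqr_ge0.
Qed.

Lemma cmod_le_ReIm z : cmod z <= `|complex.Re z| + `|complex.Im z|.
Proof.
case: z => a b; rewrite /cmod normc_def /=.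
rewrite -[leRHS]ger0_norm ?addr_ge0// -sqrtr_sqr ler_sqrt ?sqr_ge0//.
rewrite sqrrD !real_normK ?num_real//; have := mulr_ge0 (normr_ge0 a) (normr_ge0 b); lra.
Qed.

(** Convergence with real thresholds: the topology of [Cx R] measures smallness by positive elements
    of [Cx R]. The way back to [limn] is [cto_lim]. *)
Definition cto u z := forall e : R, 0 < e ->
  exists n0, forall n, (n0 <= n)%N -> cmod (u n - z) < e.

Lemma cto_cvg u z : cto u z -> u @ \oo --> z.
Proof.
move=> h; apply/cvgrPdist_lt => -[e e'] /= /[!ltcE] /= /andP[/eqP e'0 e0].
have [n0 hn0] := h _ e0; exists n0 => // n /= /hn0.
by rewrite normr_cmod cmodB e'0 -ltcR.
Qed.

Lemma cto_lim u z : cto u z -> limn u = z.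
Proof. by move/cto_cvg/cvg_lim; apply. Qed.

Lemma cto_cst z : cto (fun=> z) z.
Proof. by move=> e e0; exists 0%N => n _; rewrite subrr cmod0. Qed.

Lemma ctoD u v z w : cto u z -> cto v w -> cto (fun n => u n + v n) (z + w).
Proof.
move=> hu hv e e0; have e20 : 0 < e / 2 by rewrite divr_gt0.
have [n1 h1] := hu _ e20; have [n2 h2] := hv _ e20.
exists (maxn n1 n2) => n; rewrite geq_max => /andP[/h1 a /h2 b].
rewrite opprD addrACA; apply: le_lt_trans (cmodD _ _) _; lra.
Qed.

Lemma ctoMl c u z : cto u z -> cto (fun n => c * u n) (c * z).
Proof.
move=> hu e e0; have c1 : 0 < cmod c + 1 by rewrite ltr_pwDr ?cmod_ge0.
have [n0 h] := hu _ (divr_gt0 e0 c1); exists n0 => n /h.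
rewrite -mulrBr cmodM ltr_pdivlMr// mulrDr mulr1.
by apply: le_lt_trans; rewrite mulrC lerDl cmod_ge0.
Qed.

Lemma cto_sum (I : Type) (s : seq I) (F : I -> nat -> C) (l : I -> C) :
  (forall i, cto (F i) (l i)) ->
  cto (fun n => \sum_(i <- s) F i n) (\sum_(i <- s) l i).
Proof.
move=> h; elim: s => [|i s ih].
  rewrite big_nil; under [fun _ => _]eq_fun do rewrite big_nil.
  exact: cto_cst.
by rewrite big_cons; under [fun _ => _]eq_fun do rewrite big_cons; apply: ctoD.
Qed.

Lemma ctoB u v z w : cto u z -> cto v w -> cto (fun n => u n - v n) (z - w).
Proof.
move=> hu hv; apply: ctoD => //.
rewrite -mulN1r; under [fun _ => _]eq_fun do rewrite -mulN1r.
exact: ctoMl.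
Qed.

Lemma cto_le u z (B : R) n0 : cto u z ->
  (forall n, (n0 <= n)%N -> cmod (u n) <= B) -> cmod z <= B.
Proof.
move=> hu hB; apply/ler_addgt0Pr => e e0; have [n1 h1] := hu _ e0.
have := h1 (maxn n0 n1) (leq_maxr _ _); have := hB (maxn n0 n1) (leq_maxl _ _).
have := cmod_triangle z (u (maxn n0 n1)) 0; rewrite !subr0 cmodB; lra.
Qed.

Lemma cto_unique u z w : cto u z -> cto u w -> z = w.
Proof.
move=> hz hw; apply/eqP; rewrite -subr_eq0 -cmod_eq0 eq_le cmod_ge0 andbT.
apply: (cto_le (n0 := 0%N) (ctoB hz hw)) => n _; by rewrite subrr cmod0.
Qed.

Lemma cto_ext u v z n0 : (forall n, (n0 <= n)%N -> u n = v n) -> cto u z -> cto v z.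
Proof.
move=> uv hu e /hu[n1 h1]; exists (maxn n0 n1) => n.
by rewrite geq_max => /andP[/uv <- /h1].
Qed.

Lemma cto_geom u z (K t : R) : t < 1 -> 0 <= t ->
  (forall n, cmod (z - u n) <= K * t ^+ n) -> cto u z.
Proof.
move=> t1 t0 h e e0.
have K0 : 0 <= K by have := h 0%N; rewrite expr0 mulr1; apply: le_trans; exact: cmod_ge0.
have K1 : 0 < K + 1 by rewrite ltr_wpDl.
have t1' : `|t| < 1 by rewrite ger0_norm.
have /cvgrPdist_lt/(_ _ (divr_gt0 e0 K1))[n0 _ h'] := cvg_expr t1'.
exists n0 => n /h' /=; rewrite sub0r normrN ger0_norm ?exprn_ge0//.
rewrite ltr_pdivlMr// => hh; rewrite cmodB; apply: le_lt_trans (h n) _.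
by apply: le_lt_trans hh; rewrite mulrC ler_wpM2l ?exprn_ge0// lerDl.
Qed.

(** Real and imaginary parts are bounded by [cmod], so each of them gives an absolutely convergent
    real series. *)
Lemma abs_cto u (M : R) : (forall n, \sum_(0 <= i < n) cmod (u i) <= M) ->
  exists z, cto (fun n => \sum_(0 <= i < n) u i) z.
Proof.
move=> hM.
have key (f : C -> R) : (forall z, `|f z| <= cmod z) -> cvgn (series (f \o u)).
  move=> fle; apply: normed_cvg.
  apply: nondecreasing_is_cvgn.
    move=> m n mn; rewrite -subr_ge0 sub_series_geq// sumr_ge0// => i _.
    by rewrite /= normr_ge0.
  exists M => _ [n _ <-]; apply: le_trans (hM n).
  by rewrite /series /=; apply: ler_sum => i _; exact: fle.
have /cvg_ex[/= a ha] := key (@complex.Re R) ler_Re_cmod.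
have /cvg_ex[/= b hb] := key (@complex.Im R) ler_Im_cmod.
exists (a +i* b) => e e0; have e20 : 0 < e / 2 by rewrite divr_gt0.
have /cvgrPdist_lt/(_ _ e20)[n1 _ h1] := ha.
have /cvgrPdist_lt/(_ _ e20)[n2 _ h2] := hb.
exists (maxn n1 n2) => n; rewrite geq_max => /andP[/h1 /= c1 /h2 /= c2].
apply: le_lt_trans (cmod_le_ReIm _) _.
rewrite raddfB raddf_sum (raddfB (@complex.Im R)) (raddf_sum (@complex.Im R)) /=.
rewrite distrC in c1; rewrite distrC in c2.
by rewrite [e]splitr; apply: ltrD.
Qed.

End ComplexModulus.

(** * Power series with a quantitative norm *)

Section PowerSeries.
Variable R : realType.
Local Notation C := (Cx R).
Implicit Types (r M : R) (f g : C -> C) (a b : nat -> C).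

Definition psum a n (w : C) : C := \sum_(0 <= j < n) a j * w ^+ j.

Definition nrm_le r a M := forall n, \sum_(0 <= j < n) cmod (a j) * r ^+ j <= M.

(** One constant [M] bounds both the weighted $\ell^1$ norm of the coefficients and all remainders,
    so that bounds uniform in parameters come with every construction. The cases $n=0,1,2$ of the
    last clause give a sup bound, the value at 0 and differentiability at 0. *)
Definition pser r M f a := [/\ 0 < r, nrm_le r a M &
  forall w n, cmod w < r -> cmod (f w - psum a n w) <= M * (cmod w / r) ^+ n].

Lemma pser_le r M M' f a : M <= M' -> pser r M f a -> pser r M' f a.
Proof.
move=> MM [r0 h1 h2]; split=> // [n|w n wr]; first exact: le_trans (h1 n) MM.
apply: le_trans (h2 w n wr) _; apply: ler_wpM2r => //.
by rewrite exprn_ge0// divr_ge0 ?cmod_ge0// ltW.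
Qed.

Lemma pser_ge0 r M f a : pser r M f a -> 0 <= M.
Proof. by case=> _ /(_ 0%N); rewrite big_geq. Qed.

Lemma pser_radius r r' M f a : 0 < r' -> r' <= r -> pser r M f a -> pser r' M f a.
Proof.
move=> r'0 rr p; have M0 := pser_ge0 p; case: p => r0 h1 h2.
split=> // [n|w n wr].
  apply: le_trans (h1 n); apply: ler_sum => j _; apply: ler_wpM2l (cmod_ge0 _) _ _ _.
  by rewrite lerXn2r// nnegrE ?(ltW r0) ?(ltW r'0).
apply: le_trans (h2 w n (lt_le_trans wr rr)) _; apply: ler_wpM2l => //.
rewrite lerXn2r ?nnegrE ?divr_ge0 ?cmod_ge0 ?(ltW r0) ?(ltW r'0)//.
by rewrite ler_wpM2l ?cmod_ge0// lef_pV2.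
Qed.

Lemma pser_ext r M f g a : (forall w, cmod w < r -> f w = g w) ->
  pser r M f a -> pser r M g a.
Proof. by move=> fg [r0 h1 h2]; split=> // w n wr; rewrite -fg//; exact: h2. Qed.

Lemma pser_to r M f a w : cmod w < r -> pser r M f a -> cto (psum a ^~ w) (f w).
Proof.
move=> wr p; have M0 := pser_ge0 p; case: p => r0 h1 h2.
have t0 : 0 <= cmod w / r by rewrite divr_ge0 ?cmod_ge0 ?(ltW r0).
have t1 : cmod w / r < 1 by rewrite ltr_pdivrMr// mul1r.
by apply: (cto_geom t1 t0 (K := M)) => n; exact: h2.
Qed.

(** Convergence suffices for the geometric remainder: for $j\ge n$ one has $|w|^j\le r^j(|w|/r)^n$,
    and the norm bound controls the rest. *)
Lemma to_pser r M f a : 0 < r -> nrm_le r a M ->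
  (forall w, cmod w < r -> cto (psum a ^~ w) (f w)) -> pser r M f a.
Proof.
move=> r0 h1 h2; split=> // w n wr.
have t1 : cmod w / r <= 1 by rewrite ler_pdivrMr// mul1r (ltW wr).
apply: (cto_le (n0 := n) (ctoB (h2 w wr) (cto_cst (psum a n w)))) => m nm.
rewrite /psum (big_cat_nat (leq0n n) nm)//= addrAC subrr add0r.
apply: le_trans (cmod_sum _ _ _) _.
apply: (@le_trans _ _ (\sum_(n <= j < m) cmod (a j) * r ^+ j * (cmod w / r) ^+ n)).
  rewrite [leLHS]big_nat_cond [leRHS]big_nat_cond; apply: ler_sum => j /andP[/andP[nj _] _].
  rewrite cmodM cmodX -mulrA ler_wpM2l ?cmod_ge0//.
  rewrite -{1}(subnK nj) -{2}(subnK nj) !exprD exprMn exprVn -mulrA.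
  rewrite [r ^+ n * _]mulrC divfK ?expf_neq0 ?gt_eqF// ler_wpM2r ?exprn_ge0 ?cmod_ge0//.
  by rewrite lerXn2r ?nnegrE ?cmod_ge0 ?(ltW r0) ?(ltW wr).
rewrite -mulr_suml ler_wpM2r ?exprn_ge0 ?divr_ge0 ?cmod_ge0 ?(ltW r0)//.
apply: le_trans (h1 m); rewrite (big_cat_nat (leq0n n) nm)//= lerDr.
by apply: sumr_ge0 => j _; rewrite mulr_ge0 ?cmod_ge0 ?exprn_ge0 ?(ltW r0).
Qed.

Lemma pserD r M1 M2 f g a b : pser r M1 f a -> pser r M2 g b ->
  pser r (M1 + M2) (fun w => f w + g w) (fun j => a j + b j).
Proof.
move=> [r0 f1 f2] [_ g1 g2]; split=> // [n|w n wr].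
  apply: le_trans (lerD (f1 n) (g1 n)); rewrite -big_split; apply: ler_sum => j _ /=.
  by rewrite -mulrDl ler_wpM2r ?cmodD// exprn_ge0// ltW.
have -> : psum (fun j => a j + b j) n w = psum a n w + psum b n w.
  by rewrite /psum -big_split; apply: eq_bigr => j _ /=; rewrite mulrDl.
rewrite opprD addrACA mulrDl; apply: le_trans (cmodD _ _) _.
by apply: lerD; [exact: f2|exact: g2].
Qed.

Lemma pserZ r M c f a : pser r M f a ->
  pser r (cmod c * M) (fun w => c * f w) (fun j => c * a j).
Proof.
move=> [r0 h1 h2]; split=> // [n|w n wr].
  apply: le_trans (ler_wpM2l (cmod_ge0 c) (h1 n)); rewrite mulr_sumr.
  by apply: ler_sum => j _; rewrite cmodM mulrA.
have -> : psum (fun j => c * a j) n w = c * psum a n w.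
  by rewrite /psum mulr_sumr; apply: eq_bigr => j _; rewrite mulrA.
by rewrite -mulrBr cmodM -mulrA ler_wpM2l ?cmod_ge0//; exact: h2.
Qed.

Lemma pser_mono r m c : 0 < r ->
  pser r (cmod c * r ^+ m) (fun w => c * w ^+ m) (fun j => if j == m then c else 0).
Proof.
move=> r0; split=> // [n|w n wr].
  rewrite (eq_bigr (fun j => if j == m then cmod c * r ^+ m else 0)); last first.
    by move=> j _; case: eqP => [->//|_]; rewrite cmod0 mul0r.
  rewrite -big_mkcond /= big_nat1_eq /=; case: ifP => // _.
  by rewrite mulr_ge0 ?cmod_ge0 ?exprn_ge0 ?(ltW r0).
have -> : psum (fun j => if j == m then c else 0) n w = if (m < n)%N then c * w ^+ m else 0.
  rewrite /psum (eq_bigr (fun j => if j == m then c * w ^+ m else 0)); last first.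
    by move=> j _; case: eqP => [->//|_]; rewrite mul0r.
  by rewrite -big_mkcond /= big_nat1_eq.
have t0 : 0 <= cmod w / r by rewrite divr_ge0 ?cmod_ge0 ?(ltW r0).
case: ltnP => nm; rewrite ?subrr ?cmod0 ?subr0.
  by rewrite !mulr_ge0 ?exprn_ge0 ?cmod_ge0 ?(ltW r0).
rewrite cmodM cmodX -mulrA ler_wpM2l ?cmod_ge0//.
rewrite -{1}(divfK (lt0r_neq0 r0) (cmod w)) exprMn mulrC ler_wpM2l ?exprn_ge0 ?(ltW r0)//.
by apply: ler_wiXn2l => //; rewrite ler_pdivrMr// mul1r (ltW wr).
Qed.

Lemma pser_cst r c : 0 < r ->
  pser r (cmod c) (fun=> c) (fun j => if j == 0%N then c else 0).
Proof.
move=> r0; have := pser_mono 0 c r0; rewrite expr0 mulr1.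
by apply: pser_ext => w _; rewrite expr0 mulr1.
Qed.

Lemma pser_var r : 0 < r -> pser r r id (fun j => if j == 1%N then 1 else 0).
Proof.
move=> r0; have := pser_mono 1 1 r0; rewrite cmod1 mul1r expr1.
by apply: pser_ext => w _; rewrite mul1r expr1.
Qed.

Definition conv a b n : C := \sum_(0 <= i < n.+1) a i * b (n - i)%N.

Lemma sum_triangle (V : nmodType) (F : nat -> nat -> V) N :
  \sum_(0 <= n < N) \sum_(0 <= i < n.+1) F i (n - i)%N
  = \sum_(0 <= i < N) \sum_(0 <= j < N - i) F i j.
Proof.
elim: N => [|N ih]; first by rewrite !big_geq.
rewrite big_nat_recr//= ih [RHS]big_nat_recr//= subSnn big_nat1.
rewrite [in LHS]big_nat_recr//= subnn addrA -big_split /=; congr (_ + _).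
rewrite big_nat_cond [RHS]big_nat_cond; apply: eq_bigr => i /andP[/andP[_ iN] _].
by rewrite subSn ?(ltnW iN)// big_nat_recr.
Qed.

(** Cauchy product: the triangle $i+j<n$ lies in a square of side $n$, hence the norm of the product
    is at most the product of the norms. *)
Lemma pserM r M1 M2 f g a b : pser r M1 f a -> pser r M2 g b ->
  pser r (M1 * M2) (fun w => f w * g w) (conv a b).
Proof.
move=> pf pg; have M10 := pser_ge0 pf; have M20 := pser_ge0 pg.
have [r0 f1 f2] := pf; have [_ g1 g2] := pg.
have rn n : 0 <= r ^+ n by rewrite exprn_ge0 ?(ltW r0).
have nrm : nrm_le r (conv a b) (M1 * M2).
  move=> n; pose F i j := (cmod (a i) * r ^+ i) * (cmod (b j) * r ^+ j).
  have F0 i j : 0 <= F i j by rewrite !mulr_ge0 ?cmod_ge0.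
  apply: (@le_trans _ _ (\sum_(0 <= m < n) \sum_(0 <= i < m.+1) F i (m - i)%N)).
    apply: ler_sum => m _; apply: le_trans (ler_wpM2r (rn m) (cmod_sum _ _ _)) _.
    rewrite mulr_suml [leLHS]big_nat_cond [leRHS]big_nat_cond.
    apply: ler_sum => i /andP[/andP[_ im] _].
    by rewrite cmodM /F mulrACA -exprD subnKC.
  rewrite sum_triangle; apply: le_trans (ler_pM _ _ (f1 n) (g1 n)).
  - rewrite mulr_suml; apply: ler_sum => i _.
    rewrite /F -mulr_sumr ler_wpM2l ?mulr_ge0 ?cmod_ge0//.
    rewrite [leRHS](big_cat_nat (leq0n _) (leq_subr i n))//= lerDl sumr_ge0// => j _.
    by rewrite mulr_ge0 ?cmod_ge0.
  - by apply: sumr_ge0 => j _; rewrite mulr_ge0 ?cmod_ge0.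
  - by apply: sumr_ge0 => j _; rewrite mulr_ge0 ?cmod_ge0.
apply: to_pser => // w wr.
have t0 : 0 <= cmod w / r by rewrite divr_ge0 ?cmod_ge0 ?(ltW r0).
have tn n : 0 <= (cmod w / r) ^+ n by rewrite exprn_ge0.
(* The constant here is twice the final one. It only serves to prove convergence; [to_pser] recovers
   $M_1M_2$ from [nrm]. *)
have bound n : cmod (f w * g w - psum (conv a b) n w)
    <= (M1 * M2 + M1 * M2) * (cmod w / r) ^+ n.
  have -> : psum (conv a b) n w = \sum_(0 <= i < n) (a i * w ^+ i) * psum b (n - i) w.
    rewrite /psum; under [RHS]eq_bigr do rewrite mulr_sumr.
    rewrite -(sum_triangle (fun i j => a i * w ^+ i * (b j * w ^+ j))).
    apply: eq_bigr => m _; rewrite /conv mulr_suml [LHS]big_nat_cond [RHS]big_nat_cond.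
    apply: eq_bigr => i /andP[/andP[_ im] _].
    by rewrite mulrACA -exprD subnKC.
  (* Each partial sum of $g$ has its own length $n-i$: its remainder supplies $(|w|/r)^{n-i}$ and
     $w^i$ the missing power. *)
  have -> : f w * g w - \sum_(0 <= i < n) (a i * w ^+ i) * psum b (n - i) w =
     (f w - psum a n w) * g w + \sum_(0 <= i < n) (a i * w ^+ i) * (g w - psum b (n - i) w).
    under [X in _ = _ + X]eq_bigr do rewrite mulrBr.
    rewrite sumrB -mulr_suml -/(psum a n w) mulrBl; ring.
  apply: le_trans (cmodD _ _) _; rewrite [leRHS]mulrDl; apply: lerD.
    rewrite cmodM mulrAC; apply: ler_pM; rewrite ?cmod_ge0//; first exact: f2.
    by have := g2 w 0%N wr; rewrite /psum big_geq// subr0 expr0 mulr1.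
  apply: le_trans (cmod_sum _ _ _) _.
  rewrite -mulrA; apply: le_trans (ler_wpM2r (mulr_ge0 M20 (tn n)) (f1 n)).
  rewrite mulr_suml [leLHS]big_nat_cond [leRHS]big_nat_cond.
  apply: ler_sum => i /andP[/andP[_ im] _].
  rewrite cmodM; apply: le_trans (ler_wpM2l (cmod_ge0 _) (g2 w (n - i)%N wr)) _.
  rewrite cmodM cmodX -!mulrA ler_wpM2l ?cmod_ge0//.
  rewrite -{1}(divfK (lt0r_neq0 r0) (cmod w)) exprMn [X in X * _ <= _]mulrC -mulrA.
  by rewrite ler_wpM2l// mulrCA -exprD subnKC ?(ltnW im).
have t1 : cmod w / r < 1 by rewrite ltr_pdivrMr// mul1r.
exact: cto_geom t1 t0 bound.
Qed.


Lemma pserX r M f a m : pser r M f a ->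
  exists b, pser r (M ^+ m) (fun w => f w ^+ m) b.
Proof.
move=> pf; have [r0 _ _] := pf; elim: m => [|m [b pb]].
  exists (fun j => if j == 0%N then 1 else 0); rewrite expr0 -cmod1.
  by apply: pser_ext (pser_cst 1 r0) => w _; rewrite expr0.
exists (conv a b); rewrite exprS.
by apply: pser_ext (pserM pf pb) => w _; rewrite exprS.
Qed.

(** Weierstrass double series theorem in this norm: summability of the norms lets the coefficients
    be summed one by one, and the total again bounds the norm of the limit. *)
Lemma pser_series r (M : nat -> R) (M' : R) (f : nat -> C -> C) (a : nat -> nat -> C) :
  0 < r -> (forall m, pser r (M m) (f m) (a m)) ->
  (forall n, \sum_(0 <= m < n) M m <= M') ->
  exists g b, pser r M' g b /\
    forall w, cmod w < r -> cto (fun n => \sum_(0 <= m < n) f m w) (g w).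
Proof.
move=> r0 pf hM.
have ca j : exists z, cto (fun n => \sum_(0 <= m < n) a m j) z.
  apply: (@abs_cto _ _ (M' / r ^+ j)) => n; rewrite ler_pdivlMr ?exprn_gt0//.
  apply: le_trans (hM n); rewrite mulr_suml; apply: ler_sum => m _.
  have [_ h _] := pf m; apply: le_trans (h j.+1).
  rewrite big_nat_recr//= lerDr sumr_ge0// => i _.
  by rewrite mulr_ge0 ?cmod_ge0 ?exprn_ge0 ?(ltW r0).
have cf w : exists z, cmod w < r -> cto (fun n => \sum_(0 <= m < n) f m w) z.
  have [wr|] := ltP (cmod w) r; last by exists 0.
  have [|z hz] := @abs_cto _ (fun m => f m w) M'; last by exists z.
  move=> n; apply: le_trans (hM n); apply: ler_sum => m _.
  by have [_ _ /(_ w 0%N wr)] := pf m; rewrite /psum big_geq// subr0 expr0 mulr1.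
have [b hb] := choice ca; have [g hg] := choice cf.
exists g, b; split=> //; split=> // [n|w n wr].
  have hb' j : cto (fun m => (r ^+ j)%:C * \sum_(0 <= i < m) a i j) ((r ^+ j)%:C * b j).
    exact: ctoMl.
  (* The first $n$ coefficients are approximated at one common index $m$, each within $e/(n+1)$
     after weighting by $r^j$, so the total loss stays below $e$. *)
  apply/ler_addgt0Pr => e e0.
  have n10 : 0 < n.+1%:R :> R by [].
  have /choice[m0 hm0] j := hb' j _ (divr_gt0 e0 n10).
  pose m := \max_(j < n) m0 j.
  apply: (@le_trans _ _ (\sum_(0 <= j < n) (\sum_(0 <= i < m) cmod (a i j) * r ^+ j + e / n.+1%:R))).
    rewrite !big_mkord; apply: ler_sum => j _.
    have jm : (m0 j <= m)%N by rewrite /m (leq_bigmax j).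
    have /ltW := hm0 j m jm; rewrite -mulrBr cmodM cmod_real (ger0_norm (exprn_ge0 _ (ltW r0))).
    rewrite mulrC cmodB; rewrite -lerBlDl; apply: le_trans.
    rewrite -mulr_suml -mulrBl ler_wpM2r ?exprn_ge0 ?(ltW r0)//.
    rewrite lerBlDr; apply: le_trans (lerD (lexx _) (cmod_sum _ _ _)).
    by apply: le_trans (cmodD _ _); rewrite subrK.
  rewrite big_split /= exchange_big /= sumr_const_nat subn0; apply: lerD.
    apply: le_trans (hM m); apply: ler_sum => i _; by have [_ h _] := pf i.
  rewrite -[leLHS]mulr_natr -mulrA ger_pMr// mulrC ler_pdivrMr// mul1r ler_nat.
  exact: leqnSn.
have hp : cto (fun m => \sum_(0 <= i < m) psum (a i) n w) (psum b n w).
  have : cto (fun m => \sum_(0 <= j < n) (w ^+ j * \sum_(0 <= i < m) a i j))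
             (\sum_(0 <= j < n) (w ^+ j * b j)).
    by apply: cto_sum => j; exact: ctoMl.
  rewrite /psum; under eq_bigr do rewrite mulrC.
  apply: (@cto_ext _ _ _ _ 0%N) => m _; rewrite exchange_big /=.
  by apply: eq_bigr => j _; rewrite mulrC mulr_suml.
apply: (cto_le (n0 := 0%N) (ctoB (hg w wr) hp)) => m _.
rewrite -sumrB; apply: le_trans (cmod_sum _ _ _) _.
apply: le_trans (ler_wpM2r _ (hM m)); last by rewrite exprn_ge0// divr_ge0 ?cmod_ge0 ?(ltW r0).
by rewrite mulr_suml; apply: ler_sum => i _; have [_ _] := pf i; apply.
Qed.

Lemma pser_exists r M a : 0 < r -> nrm_le r a M -> exists f, pser r M f a.
Proof.
move=> r0 h.
have cf w : exists z, cmod w < r -> cto (psum a ^~ w) z.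
  have [wr|] := ltP (cmod w) r; last by exists 0.
  have [|z hz] := @abs_cto _ (fun j => a j * w ^+ j) M; last by exists z.
  move=> n; apply: le_trans (h n); apply: ler_sum => j _.
  rewrite cmodM cmodX ler_wpM2l ?cmod_ge0//.
  by rewrite lerXn2r ?nnegrE ?cmod_ge0// ltW.
by have [f hf] := choice cf; exists f; apply: to_pser.
Qed.

(** On the disc of radius $r-|w_0|$ the function $w_0+h$ has norm $|w_0|+(r-|w_0|)=r$, so
    $a_m(w_0+h)^m$ has norm at most $|a_m|r^m$ and [pser_series] applies with the same [M]. *)
Lemma pser_translate r M f a w0 : pser r M f a -> cmod w0 < r ->
  exists b, pser (r - cmod w0) M (fun h => f (w0 + h)) b.
Proof.
move=> pf w0r; have [r0 hn _] := pf; pose p := r - cmod w0.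
have p0 : 0 < p by rewrite subr_gt0.
have px : pser p r (fun h => w0 + h)
   (fun j => (if j == 0%N then w0 else 0) + (if j == 1%N then 1 else 0)).
  have := pserD (pser_cst w0 p0) (pser_var p0).
  by rewrite /p [_ + (r - _)]addrC subrK.
have /choice[A hA] m : exists b, pser p (cmod (a m) * r ^+ m) (fun h => a m * (w0 + h) ^+ m) b.
  by have [b pb] := pserX m px; exists (fun j => a m * b j); exact: pserZ.
have [g [b [pg cg]]] := pser_series p0 hA hn.
exists b; apply: pser_ext pg => h hp; apply: cto_unique (cg h hp) _.
apply: (pser_to _ pf); apply: le_lt_trans (cmodD _ _) _.
by rewrite -ltrBrDl.
Qed.

(** After recentring at $w_0$ the derivative is the coefficient $b_1$: the remainder of order 2 is
    at most $M(|h|/p)^2$, which is $o(|h|)$. *)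
Lemma pser_derivable r M f a w0 : pser r M f a -> cmod w0 < r -> derivable f w0 1.
Proof.
move=> pf w0r; have [b [p0 _ hb]] := pser_translate pf w0r.
have b0 : f w0 = b 0%N.
  have := hb 0 1%N; rewrite cmod0 mul0r expr0n /= mulr0 /psum big_nat1 expr0 mulr1 addr0.
  by move=> /(_ p0) h; apply/eqP; rewrite -subr_eq0 -cmod_eq0 eq_le h cmod_ge0.
have M0 := pser_ge0 pf; set p := r - cmod w0 in p0 hb.
apply/cvg_ex; exists (b 1%N).
apply/cvgrPdist_lt => -[e e'] /= /[!ltcE] /= /andP[/eqP -> e0].
have K0 : 0 < M / p ^+ 2 + 1 by rewrite ltr_wpDl// divr_ge0 ?exprn_ge0 ?(ltW p0).
pose d := Num.min p (e / (M / p ^+ 2 + 1)).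
have d0 : 0 < d by rewrite lt_min p0 divr_gt0.
apply/nbhs_ballP; exists (d%:C); first by rewrite /= -[0]/(0%:C) ltcR.
move=> h; rewrite /ball /= sub0r normrN normr_cmod ltcR lt_min => /andP[hp he] hn0.
rewrite normr_cmod (_ : e +i* 0 = e%:C)// ltcR.
rewrite [h%:A]mulr1 [h + w0]addrC.
have -> : b 1%N - h^-1 *: (f (w0 + h) - f w0) = - (h^-1 * (f (w0 + h) - psum b 2 h)).
  have fld (x y z t : C) : t != 0 -> y - t^-1 * (x - z) = - (t^-1 * (x - (z + y * t))).
    by move=> t0; field.
  by rewrite /psum !big_nat_recr ?big_geq//= -b0 add0r expr0 mulr1 expr1; exact: fld.
rewrite cmodN cmodM cmodV mulrC ltr_pdivrMr ?cmod_gt0//.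
apply: le_lt_trans (hb h 2%N hp) _.
move: he; rewrite ltr_pdivlMr// => he.
have h0 : 0 < cmod h by rewrite cmod_gt0.
rewrite (_ : M * _ = cmod h * (M / p ^+ 2) * cmod h); last by field; rewrite gt_eqF.
rewrite ltr_pM2r//; apply: le_lt_trans he; rewrite mulrDr mulr1 lerDl ltW//.
Qed.

End PowerSeries.

(** * Uniqueness and evaluation of residues *)

Section Residues.
Variable R : realType.
Local Notation C := (Cx R).
Implicit Types (r M : R) (f g : C -> C) (a b : nat -> C).

(** Dropping $k$ terms and dividing by $w^k$ costs a factor $r^{-k}$. The value at 0 is set by hand,
    since division by 0 returns 0. *)
Lemma pser_tail r M f a k : pser r M f a ->
  pser r (M / r ^+ k)
    (fun w => if w == 0 then a k else (f w - psum a k w) / w ^+ k)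
    (fun j => a (k + j)%N).
Proof.
move=> pf; have M0 := pser_ge0 pf; have [r0 h1 h2] := pf.
have rk : 0 < r ^+ k by rewrite exprn_gt0.
have nrm : nrm_le r (fun j => a (k + j)%N) (M / r ^+ k).
  move=> n; rewrite ler_pdivlMr// mulr_suml; apply: le_trans (h1 (k + n)%N).
  rewrite [leRHS](big_cat_nat (leq0n k) (leq_addr n k))//=.
  rewrite (_ : \sum_(k <= j < k + n) _ = \sum_(0 <= i < n) cmod (a (k + i)%N) * r ^+ i * r ^+ k).
    by rewrite lerDr sumr_ge0// => j _; rewrite mulr_ge0 ?cmod_ge0 ?exprn_ge0 ?(ltW r0).
  rewrite -{1}[k]add0n big_addn addnC addnK; apply: eq_bigr => i _.
  by rewrite exprD mulrA addnC.
split=> // w n wr.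
case: eqP => [->|/eqP w0].
  case: n => [|n]; last first.
    rewrite /psum big_nat_recl//= expr0 mulr1 addn0 opprD addrA subrr add0r cmodN.
    rewrite big1 ?cmod0; last by move=> i _; rewrite exprS mul0r mulr0.
    by rewrite mul0r exprS mul0r mulr0.
  rewrite /psum big_geq// subr0 expr0 mulr1; have := nrm 1%N.
  by rewrite big_nat1 expr0 mulr1 addn0.
have wk : 0 < cmod w ^+ k by rewrite exprn_gt0// cmod_gt0.
have -> : (f w - psum a k w) / w ^+ k - psum (fun j => a (k + j)%N) n w
   = (f w - psum a (k + n) w) / w ^+ k.
  have -> : psum a (k + n) w = psum a k w + psum (fun j => a (k + j)%N) n w * w ^+ k.
    rewrite /psum (big_cat_nat (leq0n k) (leq_addr _ _))//=; congr (_ + _).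
    rewrite -{1}[k]add0n big_addn addnC addnK mulr_suml; apply: eq_bigr => i _.
    by rewrite exprD mulrA addnC.
  by rewrite opprD addrA [in RHS]mulrBl mulfK// expf_neq0.
rewrite cmodM cmodV cmodX ler_pdivrMr//; apply: le_trans (h2 w (k + n)%N wr) _.
rewrite exprD -!mulrA ler_wpM2l// expr_div_n.
rewrite le_eqVlt; apply/orP; left; apply/eqP; field.
by rewrite ?expf_neq0 ?gt_eqF.
Qed.

Lemma near_cmod (z0 : C) r (P : C -> Prop) : 0 < r ->
  (forall z, cmod (z - z0) < r -> P z) -> \forall z \near z0, P z.
Proof.
move=> r0 h; apply/nbhs_ballP; exists (r%:C); first by rewrite /= -[0]/(0%:C) ltcR.
by move=> z; rewrite /ball /= normr_cmod cmodB ltcR; exact: h.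
Qed.

Lemma near_cmodP (z0 : C) (P : C -> Prop) : (\forall z \near z0, P z) ->
  exists2 r : R, 0 < r & forall z, cmod (z - z0) < r -> P z.
Proof.
move=> /nbhs_ballP[[e e'] /=]; rewrite /= ltcE /= => /andP[/eqP -> e0] h.
exists e => // z ze; apply: h; rewrite /ball /= normr_cmod cmodB.
by rewrite (_ : e +i* 0 = e%:C)// ltcR.
Qed.

(** Multiplying by a power of $w$ and letting $w=t$ tend to 0 along the positive reals bounds the
    top coefficient by $tK$, so it vanishes; induction on the length removes the others. *)
Lemma polar_part_eq0 (c : nat -> C) m (B r : R) : 0 < r ->
  (forall w, 0 < cmod w < r -> cmod (\sum_(0 <= j < m) c j / w ^+ j.+1) <= B) ->
  forall j, (j < m)%N -> c j = 0.
Proof.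
move=> r0; elim: m => // m ih h.
suff cm0 : c m = 0.
  move=> j; rewrite ltnS leq_eqVlt => /orP[/eqP -> //|]; apply: ih => w wr.
  by have := h w wr; rewrite big_nat_recr//= cm0 mul0r addr0.
pose K := B + \sum_(0 <= j < m) cmod (c j).
have hK (t : R) : 0 < t -> t < r -> t <= 1 -> cmod (c m) <= t * K.
  move=> t0 tr t1; pose w : C := t%:C.
  have cw : cmod w = t by rewrite cmod_real gtr0_norm.
  have w0 : w != 0 by rewrite -cmod_gt0 cw.
  have /h : 0 < cmod w < r by rewrite cw t0 tr.
  rewrite big_nat_recr//= => hB.
  have -> : c m = w ^+ m.+1 * (\sum_(0 <= j < m) c j / w ^+ j.+1 + c m / w ^+ m.+1)
                  - \sum_(0 <= j < m) w * (c j * w ^+ (m - j.+1)).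
    rewrite mulrDr mulrCA divff ?expf_neq0// mulr1 mulr_sumr.
    rewrite (eq_big_nat _ _ (F2 := fun j => w * (c j * w ^+ (m - j.+1)))).
      by rewrite addrAC subrr add0r.
    move=> j /andP[_ jm]; have nz : w ^+ j.+1 != 0 by rewrite expf_neq0.
    by rewrite -{1}(subnK jm) exprS exprD; set y := w ^+ j.+1; field.
  rewrite [leRHS]mulrDr; apply: le_trans (cmodD _ _) _; apply: lerD.
    rewrite cmodM cmodX cw exprS -mulrA ler_wpM2l ?(ltW t0)//.
    apply: le_trans hB; rewrite ler_piMl ?cmod_ge0// exprn_ile1 ?(ltW t0)//.
  rewrite cmodN; apply: le_trans (cmod_sum _ _ _) _; rewrite mulr_sumr.
  apply: ler_sum => j _; rewrite !cmodM cmodX cw ler_wpM2l ?(ltW t0)//.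
  by rewrite ler_piMr ?cmod_ge0// exprn_ile1 ?(ltW t0).
apply/eqP; rewrite -cmod_eq0 eq_le cmod_ge0 andbT leNgt; apply/negP => c0.
have K1 : 0 < `|K| + 1 by rewrite ltr_wpDl.
pose t := Num.min (r / 2) (Num.min 1 (cmod (c m) / (`|K| + 1) / 2)).
have t0 : 0 < t by rewrite !lt_min divr_gt0// ltr01 !divr_gt0.
have tr : t < r by rewrite !gt_min ltr_pdivrMr// ltr_pMr// ltr1n.
have t1 : t <= 1 by rewrite !ge_min lexx orbT.
have t2 : t <= cmod (c m) / (`|K| + 1) / 2 by rewrite !ge_min lexx !orbT.
have := hK t t0 tr t1; apply/negP; rewrite -ltNge.
have : t * K <= t * (`|K| + 1) by rewrite ler_wpM2l ?(ltW t0)// (le_trans (ler_norm K))// lerDl.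
move=> /le_lt_trans; apply; move: t2; rewrite -mulrA -invfM ler_pdivlMr ?mulr_gt0//.
have := mulr_gt0 t0 K1; lra.
Qed.

(** [Res] picks a value by choice and can be evaluated only after uniqueness. The difference of two
    principal parts, padded with zeros to the common length [m], equals a difference of functions
    continuous at the point, hence it is bounded near it. *)
Lemma is_residue_unique f (z0 c1 c2 : C) :
  is_residue f z0 c1 -> is_residue f z0 c2 -> c1 = c2.
Proof.
move=> [m1 [b1 [g1 [<- d1 e1]]]] [m2 [b2 [g2 [<- d2 e2]]]].
pose b (bb : nat -> C) m j := if (j < m.+1)%N then bb j else 0.
pose m := maxn m1.+1 m2.+1.
have ext (bb : nat -> C) m' w : (m'.+1 <= m)%N ->
    \sum_(j < m'.+1) bb j / w ^+ j.+1 = \sum_(0 <= j < m) b bb m' j / w ^+ j.+1.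
  move=> mm; rewrite -(big_mkord xpredT (fun j => bb j / w ^+ j.+1)).
  rewrite [RHS](big_cat_nat (leq0n _) mm)//= [X in _ = _ + X]big1_seq ?addr0.
    by apply: eq_big_nat => j /andP[_ jm]; rewrite /b jm.
  move=> j /andP[_]; rewrite mem_index_iota => /andP[mj _].
  by rewrite /b ltnNge mj mul0r.
have cont g : (\forall z \near z0, derivable g z 1) ->
    exists2 r : R, 0 < r & forall z, cmod (z - z0) < r -> cmod (g z) <= cmod (g z0) + 1.
  move=> /nbhs_singleton /derivable1_diffP/differentiable_continuous /cvgrPdist_lt.
  move=> /(_ 1 ltr01)/near_cmodP[r r0 h]; exists r => // z /h.
  rewrite normr_cmod -[1]/(1%:C) ltcR cmodB => h'.
  by rewrite -[g z](subrK (g z0)) addrC (le_trans (cmodD _ _))// lerD2l ltW.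
have [r1 r10 h1] := cont _ d1; have [r2 r20 h2] := cont _ d2.
have [r3 r30 h3] := near_cmodP e1; have [r4 r40 h4] := near_cmodP e2.
pose r := Num.min (Num.min r1 r2) (Num.min r3 r4).
have r0 : 0 < r by rewrite !lt_min r10 r20 r30 r40.
have := @polar_part_eq0 (fun j => b b1 m1 j - b b2 m2 j) m
  (cmod (g1 z0) + 1 + (cmod (g2 z0) + 1)) r r0.
have m0 : (0 < m)%N by rewrite /m leq_max.
move=> /(_ _ 0%N m0); rewrite /b /= => H; apply/eqP; rewrite -subr_eq0; apply/eqP.
apply: H => w /andP[w0]; rewrite !lt_min => /andP[/andP[w1 w2] /andP[w3 w4]].
have E (x : R) : cmod w < x -> cmod (w + z0 - z0) < x by rewrite addrK.
have ne : w + z0 != z0 by rewrite -subr_eq0 addrK -cmod_gt0.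
have := h3 _ (E _ w3) ne; have := h4 _ (E _ w4) ne; rewrite addrK.
rewrite (ext _ m2 w) ?leq_maxr// (ext _ m1 w) ?leq_maxl// => -> E2.
under eq_bigr do rewrite mulrBl.
rewrite sumrB (_ : _ - _ = g2 (w + z0) - g1 (w + z0)).
  rewrite addrC; apply: le_trans (cmodD _ _) _; rewrite cmodN.
  by apply: lerD; [apply: h1; exact: E|apply: h2; exact: E].
have fl (x y u v : C) : x + u = y + v -> v - u = x - y.
  by move=> e; apply/eqP; rewrite -subr_eq0 -(subrr (x + u)) {1}e; apply/eqP; ring.
exact: fl.
Qed.

(** The principal part consists of the first $k+1$ terms read backwards, and the regular part is the
    tail given by [pser_tail]. *)
Lemma Res_pser r M f a k (F : C -> C) : pser r M f a ->
  (forall z, 0 < cmod (z - 1) < r -> F z = f (z - 1) / (z - 1) ^+ k.+1) ->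
  Res F 1 = a k.
Proof.
move=> pf hF; have [r0 _ _] := pf.
suff res : is_residue F 1 (a k).
  apply: (is_residue_unique _ res).
  exact: (@xgetPex _ 0 [set c | is_residue F 1 c] (ex_intro _ _ res)).
pose t w := if w == 0 then a k.+1 else (f w - psum a k.+1 w) / w ^+ k.+1.
have pt : pser r (M / r ^+ k.+1) t (fun j => a (k.+1 + j)%N) by exact: pser_tail.
exists k, (fun j => a (k - j)%N), (fun z => t (z - 1)); split.
- by rewrite subn0.
- apply: (near_cmod r0) => z /(pser_derivable pt); rewrite /derivable.
  set u := (X in cvg (X @ _) -> _); set v := (X in _ -> cvg (X @ _)).
  by rewrite (_ : u = v)//; apply/funext => h; rewrite /u /v /= addrA.
apply: (near_cmod r0) => z zr zn1.
have w0 : z - 1 != 0 by rewrite subr_eq0.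
rewrite hF ?cmod_gt0 ?w0// /t (negbTE w0).
have -> : \sum_(j < k.+1) a (k - j)%N / (z - 1) ^+ j.+1 = psum a k.+1 (z - 1) / (z - 1) ^+ k.+1.
  rewrite /psum big_mkord mulr_suml (reindex_inj rev_ord_inj) /=.
  apply: eq_bigr => j _; have jk : (j <= k)%N by rewrite -ltnS.
  rewrite subSS subKn// -mulrA; congr (_ * _); rewrite -subSn//.
  have jk' : (j <= k.+1)%N by exact: leqW.
  have := exprD (z - 1) (k.+1 - j) j; rewrite (subnK jk') => ->.
  by rewrite invfM mulrCA divff ?mulr1// expf_neq0.
by rewrite -mulrDl subrK.
Qed.

End Residues.

(** * The exponential series *)

Section ComplexExponential.
Variable R : realType.
Local Notation C := (Cx R).

Lemma nrm_le_exp (z : C) (r : R) : 0 < r ->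
  nrm_le r (fun j => z ^+ j / j`!%:R) (expR (cmod z * r)).
Proof.
move=> r0 n; rewrite [leLHS](_ : _ = series (exp_coeff (cmod z * r)) n).
  apply: nondecreasing_cvgn_le; last exact: is_cvg_series_exp_coeff.
  apply: nondecreasing_series => i _ _; rewrite /exp_coeff /=.
  by rewrite divr_ge0// exprn_ge0// mulr_ge0 ?cmod_ge0// ltW.
apply: eq_bigr => j _; rewrite /exp_coeff /= cmodM cmodX cmodV cmod_nat exprMn.
by rewrite mulrAC.
Qed.

(** The exponential series is multiplicative by the Cauchy product and the binomial theorem. So it
    has to be compared with [cexp] only on the real axis and on the imaginary axis, where it splits
    into the cosine and sine series. *)
Lemma cexp_to (z : C) : cto (fun n => \sum_(0 <= j < n) z ^+ j / j`!%:R) (cexp z).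
Proof.
(* The series is viewed as a power series in an auxiliary variable evaluated at 1, a point of the
   disc of radius 2, so that [pserM] can be used. *)
have r20 : (0 : R) < 2 by [].
have /choice[E hE] (z' : C) := pser_exists r20 (nrm_le_exp z' r20).
have E1 z' : cto (fun n => \sum_(0 <= j < n) z' ^+ j / j`!%:R) (E z' 1).
  have c1 : cmod (1 : C) < 2 by rewrite cmod1 ltr1n.
  have := pser_to c1 (hE z'); rewrite /psum.
  by apply: (@cto_ext _ _ _ _ 0%N) => n _; apply: eq_bigr => j _; rewrite expr1n mulr1.
have ED z1 z2 : E (z1 + z2) 1 = E z1 1 * E z2 1.
  apply: (cto_unique (E1 _)).
  have c1 : cmod (1 : C) < 2 by rewrite cmod1 ltr1n.
  have := pser_to c1 (pserM (hE z1) (hE z2)); rewrite /psum.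
  apply: (@cto_ext _ _ _ _ 0%N) => n _; apply: eq_bigr => j _; rewrite expr1n mulr1.
  rewrite /conv exprDn big_mkord mulr_suml (reindex_inj rev_ord_inj) /=; apply: eq_bigr => i _.
  have ij : (i <= j)%N by rewrite -ltnS.
  rewrite subSS subKn//.
  have := bin_fact ij => bf.
  rewrite -mulr_natr -bf !natrM.
  have nz (m : nat) : m`!%:R != 0 :> C by rewrite pnatr_eq0 -lt0n fact_gt0.
  have nb : ('C(j, i))%:R != 0 :> C by rewrite pnatr_eq0 -lt0n bin_gt0.
  by field; rewrite !nz nb.
suff -> : cexp z = E z 1 by exact: E1.
case: z => x y.
have -> : x +i* y = x%:C + (0 +i* y) :> R[i].
  by apply/eqP; rewrite eq_complex /= addr0 add0r !eqxx.
rewrite ED {1}/cexp /=; congr (_ * _).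
  apply: (cto_unique _ (E1 _)) => e e0.
  have /cvgrPdist_lt/(_ _ e0)[n0 _ h] := is_cvg_series_exp_coeff x.
  exists n0 => n /h /=; rewrite -cmod_real cmodB rmorphB /=; congr (cmod (_ - _) < _).
    by rewrite addr0.
  rewrite /series /= rmorph_sum /=; apply: eq_bigr => j _.
  by rewrite /exp_coeff /= rmorphM rmorphXn fmorphV rmorph_nat.
apply: (cto_unique _ (E1 _)) => e e0; have e20 : 0 < e / 2 by rewrite divr_gt0.
have /cvgrPdist_lt/(_ _ e20)[n1 _ h1] := @is_cvg_series_cos_coeff _ y.
have /cvgrPdist_lt/(_ _ e20)[n2 _ h2] := @is_cvg_series_sin_coeff _ y.
exists (maxn n1 n2) => n; rewrite geq_max => /andP[/h1 /= c1 /h2 /= c2].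
have Ei j : (0 +i* y) ^+ j / j`!%:R = cos_coeff y j +i* sin_coeff y j :> R[i].
  have -> : (0 +i* y) ^+ j = ((~~ odd j)%:R * (-1) ^+ j./2 * y ^+ j)
      +i* ((odd j)%:R * (-1) ^+ j.-1./2 * y ^+ j) :> R[i].
    elim: j => [|j ih].
      by rewrite !expr0 /= !mul0r !mulr1.
    rewrite exprSr ih; apply/eqP; rewrite eq_complex /=; apply/andP.
    have := odd_double_half j; case: (odd j) => /= jE.
      rewrite -jE add1n /= doubleK -doubleS uphalf_double.
      split; apply/eqP; rewrite !exprS; ring.
    rewrite -jE add0n /= doubleK uphalf_double.
    by split; apply/eqP; rewrite !exprS; ring.
  rewrite -(rmorph_nat (real_complex R)) -fmorphV; apply/eqP; rewrite eq_complex /=.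
  rewrite !mulr0 !subr0 add0r.
  by rewrite /cos_coeff /sin_coeff /= mulrC mulrC eqxx mulrC !eqxx.
apply: le_lt_trans (cmod_le_ReIm _) _.
rewrite raddfB raddf_sum (raddfB (@complex.Im R)) (raddf_sum (@complex.Im R)) /=.
under eq_bigr do rewrite Ei /=.
under [X in _ + `|X - _|]eq_bigr do rewrite Ei /=.
rewrite add0r cos.unlock sin.unlock.
rewrite distrC in c1; rewrite distrC in c2.
by rewrite [e]splitr; apply: ltrD.
Qed.

Lemma cexpD (z w : C) : cexp (z + w) = cexp z * cexp w.
Proof.
case: z w => [a b] [c d]; rewrite /cexp /= expRD cosD sinD.
by apply/eqP; rewrite eq_complex /=; apply/andP; split; apply/eqP; ring.
Qed.

End ComplexExponential.

(** * Comparison of sums with integrals of powers of the logarithm *)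

Section RealInequalities.
Variable R : realType.
Implicit Types a b x : R.

Lemma ln_le_subr1 x : 0 < x -> ln x <= x - 1.
Proof. by move=> x0; have := expR_ge1Dx (ln x); rewrite lnK ?posrE//; lra. Qed.

Lemma subrXX_le a b n : 0 <= b -> b <= a -> a ^+ n - b ^+ n <= n%:R * a ^+ n.-1 * (a - b).
Proof.
move=> b0 ba; have a0 := le_trans b0 ba.
rewrite subrXX mulrC ler_wpM2r ?subr_ge0//.
rewrite (@le_trans _ _ (\sum_(i < n) a ^+ n.-1))//; last first.
  by rewrite sumr_const card_ord mulr_natl.
apply: ler_sum => i _.
have -> : a ^+ n.-1 = a ^+ (n.-1 - i) * a ^+ i.
  by rewrite -exprD subnK//; have := ltn_ord i; case: (n) i.
by rewrite ler_wpM2l ?exprn_ge0// lerXn2r.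
Qed.

Lemma subrXX_ge a b n : 0 <= b -> b <= a -> n%:R * b ^+ n.-1 * (a - b) <= a ^+ n - b ^+ n.
Proof.
move=> b0 ba; have a0 := le_trans b0 ba.
rewrite subrXX [leRHS]mulrC ler_wpM2r ?subr_ge0//.
rewrite (@le_trans _ _ (\sum_(i < n) b ^+ n.-1))//.
  by rewrite sumr_const card_ord mulr_natl.
apply: ler_sum => i _.
have -> : b ^+ n.-1 = b ^+ (n.-1 - i) * b ^+ i.
  by rewrite -exprD subnK//; have := ltn_ord i; case: (n) i.
by rewrite ler_wpM2r ?exprn_ge0// lerXn2r.
Qed.

Lemma ln_succ_ge (m : nat) : m.+2%:R^-1 <= ln m.+2%:R - ln m.+1%:R :> R.
Proof.
have := @ln_le_subr1 (m.+1%:R / m.+2%:R) _; rewrite divr_gt0// ln_div ?posrE// => /(_ isT).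
have -> : m.+1%:R / m.+2%:R - 1 = - m.+2%:R^-1 :> R.
  have x0 : 0 < m.+1%:R :> R by [].
  rewrite -[m.+2%:R]natr1; move: m.+1%:R x0 => x x0; field.
  by rewrite !lt0r_neq0//; lra.
by move=> h; rewrite -lerN2 opprB.
Qed.

Lemma ln_succ_le (m : nat) : ln m.+2%:R - ln m.+1%:R <= m.+1%:R^-1 :> R.
Proof.
have := @ln_le_subr1 (m.+2%:R / m.+1%:R) _; rewrite divr_gt0// ln_div ?posrE// => /(_ isT).
have -> : m.+2%:R / m.+1%:R - 1 = m.+1%:R^-1 :> R.
  have x0 : 0 < m.+1%:R :> R by [].
  rewrite -[m.+2%:R]natr1; move: m.+1%:R x0 => x x0; field.
  by rewrite !lt0r_neq0//; lra.
by [].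
Qed.

(** The value of $\log^jx/x$ at $x=m+2$ is compared with its integral over $[m+1,m+2]$, which is the
    second term because $\log^{j+1}x/(j+1)$ is an antiderivative. Up to sign and $1/j!$ these
    differences are the Taylor coefficients of the summands of $\zeta(1+w)-1/w-1$. *)
Lemma euler_maclaurin_coef (m j : nat) (a := ln m.+2%:R : R) (b := ln m.+1%:R : R) :
  `|a ^+ j / m.+2%:R - (a ^+ j.+1 - b ^+ j.+1) / j.+1%:R|
  <= (j%:R * a ^+ j.-1 + a ^+ j) * (m.+2%:R * m.+1%:R)^-1.
Proof.
have b0 : 0 <= b by rewrite ln_ge0// ler1n.
have h1 : m.+2%:R^-1 <= a - b by exact: ln_succ_ge.
have h2 : a - b <= m.+1%:R^-1 by exact: ln_succ_le.
have c0 : 0 < m.+2%:R^-1 :> R by rewrite invr_gt0.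
have c'0 : 0 < m.+1%:R^-1 :> R by rewrite invr_gt0.
have cc : m.+1%:R^-1 - m.+2%:R^-1 = m.+2%:R^-1 * m.+1%:R^-1 :> R.
  clear h1 h2 c0 c'0 b0.
  have x0 : 0 < m.+1%:R :> R by [].
  rewrite -[m.+2%:R]natr1; move: m.+1%:R x0 => x x0; field.
  by rewrite !lt0r_neq0//; lra.
have ba : b <= a by rewrite -subr_ge0; exact: le_trans (ltW c0) h1.
have a0 : 0 <= a := le_trans b0 ba.
have j10 : 0 < j.+1%:R :> R by [].
have l1 := subrXX_le j.+1 b0 ba; have l2 := subrXX_ge j.+1 b0 ba.
have l3 := subrXX_le j b0 ba; rewrite /= in l1 l2.
set A := (a ^+ j.+1 - b ^+ j.+1) / j.+1%:R.
have A1 : A <= a ^+ j * (a - b) by rewrite /A ler_pdivrMr// mulrC mulrA.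
have A2 : b ^+ j * (a - b) <= A by rewrite /A ler_pdivlMr// mulrC mulrA.
have aj : 0 <= a ^+ j by rewrite exprn_ge0.
have bj : 0 <= b ^+ j by rewrite exprn_ge0.
have aj1 : 0 <= j%:R * a ^+ j.-1 by rewrite mulr_ge0 ?exprn_ge0.
rewrite invfM mulrDl -cc.
clearbody a b A; move: m.+2%:R^-1 m.+1%:R^-1 h1 h2 c0 c'0 cc => c c' h1 h2 c0 c'0 cc.
rewrite ler_norml; apply/andP; split.
- have : a ^+ j * (a - b) <= a ^+ j * c' by rewrite ler_wpM2l.
  have : 0 <= j%:R * a ^+ j.-1 * (c' - c) by rewrite mulr_ge0// cc mulr_ge0 ?(ltW c0) ?(ltW c'0).
  lra.
- have : b ^+ j * c <= b ^+ j * (a - b) by rewrite ler_wpM2l.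
  have : (a ^+ j - b ^+ j) * c <= j%:R * a ^+ j.-1 * c' * c.
    rewrite ler_wpM2r ?(ltW c0)//; apply: (le_trans l3); by rewrite ler_wpM2l.
  have : 0 <= a ^+ j * (c' - c) by rewrite mulr_ge0// cc mulr_ge0 ?(ltW c0) ?(ltW c'0).
  rewrite cc -mulrA [c' * c]mulrC; lra.
Qed.

(** The square root is $e^{\log(m+2)/2}$, coming from the radius $1/2$ for zeta. The sum telescopes
    against $4/\sqrt{n+1}$. *)
Lemma sum_inv_sqrt_bound n :
  \sum_(0 <= m < n) Num.sqrt m.+2%:R * (m.+2%:R * m.+1%:R)^-1 <= 4 :> R.
Proof.
suff : \sum_(0 <= m < n) Num.sqrt m.+2%:R * (m.+2%:R * m.+1%:R)^-1
     <= 4 * (1 - (Num.sqrt n.+1%:R)^-1) :> R.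
  move=> /le_trans; apply; rewrite ler_piMr// lerBlDr lerDl invr_ge0 sqrtr_ge0//.
elim: n => [|n ih]; first by rewrite big_geq// sqrtr1 invr1 subrr mulr0.
rewrite big_nat_recr//=; apply: le_trans (lerD ih (lexx _)) _.
set a := Num.sqrt n.+2%:R; set b := Num.sqrt n.+1%:R.
have a0 : 0 < a by rewrite sqrtr_gt0.
have b0 : 0 < b by rewrite sqrtr_gt0.
have aE : n.+2%:R = a ^+ 2 by rewrite sqr_sqrtr.
have bE : n.+1%:R = b ^+ 2 by rewrite sqr_sqrtr.
have ab : a ^+ 2 = b ^+ 2 + 1 by rewrite -aE -bE -[n.+2]addn1 natrD.
rewrite aE bE.
have b1 : 1 <= b ^+ 2 by rewrite -bE ler1n.
have ba : b <= a by rewrite -(@ler_pXn2r _ 2)// ?nnegrE ?(ltW a0) ?(ltW b0)// ab lerDl.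
have a2b : a <= 2 * b.
  rewrite -(@ler_pXn2r _ 2)// ?nnegrE ?mulr_ge0 ?(ltW a0) ?(ltW b0)// exprMn ab; lra.
suff : a / (a ^+ 2 * b ^+ 2) <= 4 * (b^-1 - a^-1) by lra.
rewrite (_ : a / _ = (a * b ^+ 2)^-1); last by field; rewrite !gt_eqF.
have -> : b^-1 - a^-1 = ((a ^+ 2 - b ^+ 2) / (a + b)) / (a * b).
  by field; rewrite !gt_eqF// addr_gt0.
rewrite ab addrAC subrr add0r mul1r -invfM.
rewrite -[4]invrK -invfM lef_pV2 ?posrE ?mulr_gt0 ?addr_gt0 ?invr_gt0// ?exprn_gt0//.
rewrite mulrA (_ : a * b ^+ 2 = b * (a * b)); last by ring.
rewrite ler_wpM2r ?mulr_ge0 ?(ltW a0) ?(ltW b0)//; lra.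
Qed.

End RealInequalities.

(** * Laurent expansion of zeta at 1 *)

Section ZetaNearOne.
Variable R : realType.
Local Notation C := (Cx R).

(** The norm of a difference can be far below the sum of the norms. Once the expansion is known with
    some crude [M], a direct estimate of the coefficients replaces it. *)
Lemma pser_norm r M M' (f : C -> C) a : pser r M f a -> nrm_le r a M' -> pser r M' f a.
Proof.
move=> pf n; have [r0 _ _] := pf.
by apply: to_pser => // w wr; exact: pser_to pf.
Qed.

Lemma pser_cexp (L r : R) : 0 < r ->
  pser r (expR (`|L| * r)) (fun w : C => cexp (w * L%:C))
    (fun j => L%:C ^+ j / j`!%:R).
Proof.
move=> r0; have := nrm_le_exp (L%:C) r0; rewrite cmod_real => n.
apply: to_pser => // w wr; have := cexp_to (w * L%:C).
apply: (@cto_ext _ _ _ _ 0%N) => m _; apply: eq_bigr => j _.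
by rewrite exprMn [w ^+ j * _]mulrC mulrAC.
Qed.

Lemma cpow_neq0 (x : R) (s : C) : cpow x s != 0.
Proof. by rewrite -cmod_gt0 -ltcR -normr_cmod normr_cexp ltcR expR_gt0. Qed.

Lemma cpowD (x : R) (s t : C) : cpow x (s + t) = cpow x s * cpow x t.
Proof. by rewrite /cpow mulrDl cexpD. Qed.

Lemma cpow_real (x y : R) : 0 < x -> cpow x y%:C = (x `^ y)%:C.
Proof.
move=> x0; rewrite /cpow -rmorphM /cexp /= cos0 sin0.
rewrite /powR gt_eqF// -[X in _ * X]/(1%:C) mulr1//.
Qed.

Lemma cpow0 (x : R) : cpow x (0 : C) = 1.
Proof. by rewrite /cpow mul0r /cexp /= expR0 cos0 sin0 mulr1. Qed.

Lemma cpowN (x : R) (s : C) : cpow x (- s) = (cpow x s)^-1.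
Proof.
by apply: (mulfI (cpow_neq0 x s)); rewrite -cpowD subrr cpow0 divff ?cpow_neq0.
Qed.

Lemma cpowN1w (x : R) (w : C) : 0 < x ->
  cpow x (- (1 + w)) = (x^-1)%:C * cexp (w * (- ln x)%:C).
Proof.
move=> x0; rewrite opprD cpowD; congr (_ * _).
  by rewrite -[1]/(1%:C) -rmorphN cpow_real// powR_inv1// ltW.
by rewrite /cpow rmorphN /= mulrN mulNr.
Qed.

(** With $s=1+w$, passing from $n=m+1$ to $m+2$ in the definition of [zeta] adds
    $f_m(w)=(m+2)^{-1-w}-\int_{m+1}^{m+2}x^{-1-w}dx$, and $n=1$ gives $1+1/w$. The cancellation in
    $f_m$ makes the norms at radius $1/2$ of size $m^{-3/2}$, hence summable. *)
Lemma zeta_pser : exists (M : R) (Z : C -> C) (a : nat -> C),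
  pser (2^-1) M Z a /\
  forall w, 0 < cmod w < 2^-1 -> zeta (1 + w) = w^-1 + Z w.
Proof.
have r0 : 0 < 2^-1 :> R by [].
pose l m : R := - ln m%:R.
pose f (m : nat) (w : C) : C := (m.+2%:R^-1)%:C * cexp (w * (l m.+2)%:C) +
  (if w == 0 then (l m.+2)%:C ^+ 1 / 1`!%:R - (l m.+1)%:C ^+ 1 / 1`!%:R else
   (cexp (w * (l m.+2)%:C) - cexp (w * (l m.+1)%:C)) / w).
pose c (m j : nat) : C := (m.+2%:R^-1)%:C * ((l m.+2)%:C ^+ j / j`!%:R) +
  ((l m.+2)%:C ^+ j.+1 / j.+1`!%:R - (l m.+1)%:C ^+ j.+1 / j.+1`!%:R).
have pf m : pser 2^-1 (3 / 2 * (Num.sqrt m.+2%:R * (m.+2%:R * m.+1%:R)^-1)) (f m) (c m).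
  have p1 := pser_cexp (l m.+2) r0; have p2 := pser_cexp (l m.+1) r0.
  have p3 := pser_tail 1 (pserD p1 (pserZ (-1) p2)).
  have p4 := pserD (pserZ (m.+2%:R^-1)%:C p1) p3.
  (* This bound ignores the cancellation and grows with $m$; [pser_norm] replaces it below. *)
  have p5 : pser 2^-1 (cmod (m.+2%:R^-1)%:C * expR (`|l m.+2| * 2^-1)
     + (expR (`|l m.+2| * 2^-1) + cmod (-1 : C) * expR (`|l m.+1| * 2^-1)) / 2^-1 ^+ 1) (f m) (c m).
    have -> : c m = (fun j => (m.+2%:R^-1)%:C * ((l m.+2)%:C ^+ j / j`!%:R) +
       ((l m.+2)%:C ^+ (1 + j) / (1 + j)`!%:R + -1 * ((l m.+1)%:C ^+ (1 + j) / (1 + j)`!%:R))).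
      by apply/funext => j; rewrite /c mulN1r.
    apply: pser_ext p4 => w _; rewrite /f; congr (_ + _); case: eqP => // _.
      by rewrite mulN1r.
    by rewrite /psum big_nat1 !expr0 !mulN1r subrr mul0r subr0 expr1.
  apply: (pser_norm p5) => n.
  pose a : R := ln m.+2%:R; pose b : R := ln m.+1%:R.
  pose K : R := (m.+2%:R * m.+1%:R)^-1.
  have a0 : 0 <= a by rewrite ln_ge0// ler1n.
  have K0 : 0 <= K by rewrite invr_ge0.
  have nf j : j`!%:R != 0 :> R by rewrite pnatr_eq0 -lt0n fact_gt0.
  have nf0 j : 0 < j`!%:R :> R by rewrite ltr0n fact_gt0.
  have cE j : cmod (c m j) <= (j%:R * a ^+ j.-1 + a ^+ j) / j`!%:R * K.
    have -> : c m j = ((-1) ^+ j / j`!%:R * (a ^+ j / m.+2%:R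
                        - (a ^+ j.+1 - b ^+ j.+1) / j.+1%:R))%:C.
      have -> : c m j = (m.+2%:R^-1 * (l m.+2 ^+ j / j`!%:R) +
         (l m.+2 ^+ j.+1 / j.+1`!%:R - l m.+1 ^+ j.+1 / j.+1`!%:R))%:C.
        by rewrite /c !(rmorphD, rmorphN, rmorphM, rmorphXn, fmorphV, rmorph_nat).
      congr (_%:C); rewrite /l -/a -/b factS natrM -[- a]mulN1r -[- b]mulN1r !exprMn exprS.
      have n1 : j.+1%:R != 0 :> R by rewrite pnatr_eq0.
      have n2 : m.+2%:R != 0 :> R by rewrite pnatr_eq0.
      move: j`!%:R (nf j) j.+1%:R n1 m.+2%:R n2 (a ^+ j.+1) (b ^+ j.+1) => x x0 y y0 z z0 u v.
      by field; rewrite x0 y0 z0.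
    rewrite cmod_real normrM normrM normrX normrN1 expr1n mul1r normfV normr_nat.
    rewrite mulrC [in leRHS]mulrAC ler_wpM2r ?invr_ge0//.
    exact: euler_maclaurin_coef.
  have ex : expR (a * 2^-1) = Num.sqrt m.+2%:R.
    by rewrite -powR12_sqrt// /powR pnatr_eq0 /= mulrC.
  have nE := @nrm_le_exp _ (a%:C) _ r0.
  have nE' k : \sum_(0 <= j < k) a ^+ j / j`!%:R * 2^-1 ^+ j <= Num.sqrt m.+2%:R.
    have := nE k; rewrite cmod_real ger0_norm// ex; apply: le_trans.
    apply: ler_sum => j _; rewrite cmodM cmodX cmodV cmod_nat cmod_real ger0_norm//.
  apply: (@le_trans _ _ (\sum_(0 <= j < n)
      ((j%:R * a ^+ j.-1) / j`!%:R * 2^-1 ^+ j * K + a ^+ j / j`!%:R * 2^-1 ^+ j * K))).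
    apply: ler_sum => j _.
    apply: le_trans (ler_wpM2r _ (cE j)) _; first by rewrite exprn_ge0.
    by rewrite -mulrDl -mulrDl -mulrDl mulrAC.
  rewrite big_split /= -!mulr_suml.
  have h1 := nE' n.
  (* The weights $ja^{j-1}/j!$ are those of a shifted exponential series, whence the factor $1/2$;
     with [h1] this makes $3/2$. *)
  have h2 : \sum_(0 <= j < n) j%:R * a ^+ j.-1 / j`!%:R * 2^-1 ^+ j <= Num.sqrt m.+2%:R / 2.
    case: (n) => [|k]; first by rewrite big_geq// divr_ge0 ?sqrtr_ge0.
    rewrite big_nat_recl//= !mul0r add0r.
    apply: le_trans (ler_wpM2r _ (nE' k)); last by rewrite invr_ge0.
    rewrite mulr_suml; apply: ler_sum => j _; rewrite factS natrM exprS.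
    rewrite le_eqVlt; apply/orP; left; apply/eqP.
    have n1 : j.+1%:R != 0 :> R by rewrite pnatr_eq0.
    move: j`!%:R (nf j) j.+1%:R n1 => x x0 y y0.
    by field; rewrite x0 y0.
  rewrite -mulrDl -/K mulrA ler_wpM2r//; lra.
have hM n : \sum_(0 <= m < n) 3 / 2 * (Num.sqrt m.+2%:R * (m.+2%:R * m.+1%:R)^-1) <= 6 :> R.
  by rewrite -mulr_sumr; have := sum_inv_sqrt_bound R n; lra.
have [g [b [pg cg]]] := pser_series r0 pf hM.
exists (cmod (1 : C) + 6), (fun w => 1 + g w), (fun j => (if j == 0%N then 1 else 0) + b j).
split; first exact: pserD (pser_cst 1 r0) pg.
move=> w /andP[w0 wr]; rewrite cmod_gt0 in w0.
apply: cto_lim; have := ctoD (cto_cst (w^-1 + 1)) (cg w wr); rewrite -addrA => h e /h[n0 hn0].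
exists n0.+1 => -[//|n]; rewrite ltnS => /hn0; congr (cmod (_ - _) < _).
(* The partial sum of [zeta] at index $n+1$ is exactly $1/w+1$ plus the first $n$ functions
   $f_m$. *)
elim: n {hn0} => [|n ih].
  rewrite big_geq// big_nat1 addr0 /cpow ln1 !mulr0 opprD addrA subrr add0r.
  rewrite /cexp /= expR0 cos0 sin0.
  have -> : (1%:C * (1 +i* 0)) = 1 :> C by rewrite mulr1.
  by rewrite div1r invrN opprK addrC.
rewrite big_nat_recr//= addrA ih [in RHS]big_nat_recr//= /f (negbTE w0).
have e1 m : cpow m.+1%:R (1 - (1 + w)) = cexp (w * (l m.+1)%:C).
  by rewrite opprD addrA subrr add0r /cpow /l rmorphN /= mulrN mulNr.
rewrite !e1 cpowN1w//.
have -> : 1 - (1 + w) = - w by ring.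
by rewrite /l invrN !mulrN !opprK; ring.
Qed.

End ZetaNearOne.

(** * Divisor functions and the totient up to small powers *)

Section DivisorBounds.
Variable R : realType.

Definition tau (n : nat) : nat := size (divisors n).

(** A divisor $d$ of $mn$ is the product of $\gcd(d,m)$ and a divisor of $n$. *)
Lemma tauM m n : (0 < m)%N -> (0 < n)%N -> (tau (m * n) <= tau m * tau n)%N.
Proof.
move=> m0 n0; rewrite /tau -(size_allpairs muln).
apply: uniq_leq_size; first exact: divisors_uniq.
move=> d; rewrite -dvdn_divisors ?muln_gt0 ?m0// => dmn.
have g0 : (0 < gcdn d m)%N by rewrite gcdn_gt0 m0 orbT.
apply/allpairsP; exists (gcdn d m, d %/ gcdn d m)%N; split => /=.
- by rewrite -dvdn_divisors// dvdn_gcdr.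
- rewrite -dvdn_divisors// -(dvdn_pmul2l g0).
  rewrite [(gcdn d m * (_ %/ _))%N]mulnC divnK ?dvdn_gcdl//.
  by rewrite muln_gcdl dvdn_gcd dvdn_mulr// dmn.
- by rewrite mulnC divnK ?dvdn_gcdl.
Qed.

Lemma tau1 : tau 1 = 1%N. Proof. by []. Qed.

Lemma tau_pfactor p e : prime p -> (tau (p ^ e) <= e.+1)%N.
Proof.
move=> pp; rewrite /tau -[leqRHS](size_iota 0 e.+1) -[leqRHS](size_map (expn p)).
apply: uniq_leq_size; first exact: divisors_uniq.
move=> d; rewrite -dvdn_divisors ?expn_gt0 ?prime_gt0// => /dvdn_pfactor[]// m me ->.
by apply: map_f; rewrite mem_iota.
Qed.

Lemma tau_le_prod n : (0 < n)%N -> (tau n <= \prod_(p <- primes n) (logn p n).+1)%N.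
Proof.
move=> n0; rewrite {1}(prod_prime_decomp n0) prime_decompE big_map /=.
suff : forall s, all prime s ->
    (tau (\prod_(p <- s) p ^ logn p n) <= \prod_(p <- s) (logn p n).+1)%N
    && (0 < \prod_(p <- s) p ^ logn p n)%N.
  have ap : all prime (primes n) by apply/allP => p; rewrite mem_primes => /andP[].
  by move=> /(_ _ ap)/andP[].
elim=> [|p s ih] /=; first by rewrite !big_nil tau1.
move=> /andP[pp /ih /andP[h1 h2]]; rewrite !big_cons.
have p0 : (0 < p ^ logn p n)%N by rewrite expn_gt0 prime_gt0.
apply/andP; split; last by rewrite muln_gt0 p0.
apply: leq_trans (tauM p0 h2) _.
by apply: leq_mul => //; exact: tau_pfactor.
Qed.

(** Every factor in a factorization of $n$ divides $n$, so the tuples counted by [divk] are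
    functions from ['I_k] into the set [D] of divisors. *)
Lemma divk_le_tau k n : (0 < n)%N -> (divk k n <= tau n ^ k)%N.
Proof.
move=> n0; pose D : {pred 'I_n.+1} := [pred d : 'I_n.+1 | dvdn d n].
have DE : (#|D| <= tau n)%N.
  rewrite cardE -(size_map val); apply: uniq_leq_size.
    by rewrite map_inj_uniq ?enum_uniq//; exact: val_inj.
  by move=> d /mapP[x]; rewrite mem_enum inE => dx ->; rewrite -dvdn_divisors.
have DE' : (#|D| ^ k <= tau n ^ k)%N by case: (k) => // k'; rewrite leq_exp2r.
apply: leq_trans DE'; rewrite /divk.
have := card_ffun_on 'I_k D; rewrite card_ord => <-.
apply: subset_leq_card; apply/fintype.subsetP => t; rewrite inE => /eqP tn.
apply/ffun_onP => i; rewrite inE.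
have : dvdn (t i) (\prod_(j < k) t j) by rewrite (bigD1 i)//= dvdn_mulr.
by rewrite tn.
Qed.

(** The Taylor term of order $A+1$ of $e^{c(e+1)}$ dominates $(e+1)^A$; the factor [expR c] in [K]
    shifts $e+1$ back to $e$. *)
Lemma exp_dominates (A : nat) (c : R) : 0 < c ->
  exists2 K : R, 1 <= K & forall e : nat, e.+1%:R ^+ A <= K * expR (c * e%:R).
Proof.
move=> c0; pose K := A.+1`!%:R / c ^+ A.+1 * expR c.
have cA : 0 < c ^+ A.+1 by rewrite exprn_gt0.
exists (Num.max 1 K); first by rewrite le_max lexx.
move=> e; apply: (@le_trans _ _ (K * expR (c * e%:R))); last first.
  by rewrite ler_wpM2r ?expR_ge0// le_max lexx orbT.
apply: (@le_trans _ _ (e.+1%:R ^+ A.+1)).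
  by rewrite exprS ler_peMl ?exprn_ge0// ler1n.
have ce0 : 0 <= c * e.+1%:R by rewrite mulr_ge0 ?ltW.
have h := expR_ge1Dxn A ce0.
have {}h : (c * e.+1%:R) ^+ A.+1 / A.+1`!%:R <= expR (c * e.+1%:R).
  by apply: le_trans h; rewrite lerDr ler01.
have f0 : 0 < A.+1`!%:R :> R by rewrite ltr0n fact_gt0.
rewrite /K -mulrA -expRD.
have -> : c + c * e%:R = c * e.+1%:R by rewrite -[e.+1%:R]nat1r mulrDr mulr1.
apply: le_trans (ler_wpM2l _ h); last by rewrite divr_ge0 ?(ltW cA) ?(ltW f0).
rewrite exprMn.
move: A.+1`!%:R f0 (c ^+ A.+1) cA => x x0 y y0.
move: (e.+1%:R ^+ A.+1) => z.
rewrite (_ : x / y * (y * z / x) = z)//.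
by field; rewrite !gt_eqF.
Qed.

Lemma powR_prod (s : seq nat) (F : nat -> nat) (x : R) :
  ((\prod_(p <- s) F p)%N%:R) `^ x = \prod_(p <- s) ((F p)%:R `^ x).
Proof.
elim: s => [|p s ih]; first by rewrite !big_nil powR1.
by rewrite !big_cons natrM powRM// ih.
Qed.

(** Half of $\varepsilon$ dominates the power of the exponent, at the cost of a constant $K$ per
    prime; the other half absorbs $K$ as soon as $p\ge K^{2/\varepsilon}$. Only primes below [P0]
    keep it, and there are at most [P0] of them. The statement serves [tau], the totient and the
    local factors alike. *)
Lemma prod_primes_bound (A : nat) (B eps : R) : 0 < eps -> 1 <= B ->
  exists2 K : R, 1 <= K & forall n : nat, (0 < n)%N ->
    \prod_(p <- primes n) (B * (logn p n).+1%:R ^+ A) <= K * n%:R `^ eps.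
Proof.
move=> e0 B1; have l2 : 0 < ln 2 :> R by rewrite ln_gt0// ltr1n.
pose h := eps / 2; have h0 : 0 < h by rewrite divr_gt0.
have [K1 K11 hK1] := exp_dominates A (mulr_gt0 h0 l2).
pose K := B * K1; have K_1 : 1 <= K by rewrite -[1]mulr1 ler_pM.
have K0 : 0 < K := lt_le_trans ltr01 K_1.
pose P0 := (Num.truncn (K `^ h^-1)).+1.
exists (K ^+ P0); first by rewrite exprn_ege1.
move=> n n0.
have -> : n%:R `^ eps = \prod_(p <- primes n) ((p ^ logn p n)%:R `^ eps) :> R.
  by rewrite -powR_prod; congr (_%:R `^ _); rewrite {1}(prod_prime_decomp n0) prime_decompE big_map.
have cnt : \prod_(p <- primes n) (if (p < P0)%N then K else 1) <= K ^+ P0.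
  rewrite -big_mkcond /= -big_filter big_const_seq count_predT iter_mulr_1.
  rewrite ler_weXn2l//.
  have : (size [seq i <- primes n | (i < P0)%N] <= size (iota 0 P0))%N.
    apply: uniq_leq_size; first by rewrite filter_uniq ?primes_uniq.
    by move=> p; rewrite mem_filter mem_iota => /andP[].
  by rewrite size_iota.
apply: (@le_trans _ _ (\prod_(p <- primes n)
    ((if (p < P0)%N then K else 1) * (p ^ logn p n)%:R `^ eps))); last first.
  rewrite big_split /= ler_wpM2r//.
  by rewrite big_seq prodr_ge0// => p _; rewrite powR_ge0.
rewrite !big_seq; apply: ler_prod => p; rewrite mem_primes => /and3P[pp _ pn].
have e1 : (0 < logn p n)%N by rewrite logn_gt0 mem_primes pp n0.
have p2 := prime_gt1 pp.
move: (logn p n) e1 => e e1.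
have p0 : 0 < p%:R :> R by rewrite ltr0n prime_gt0.
apply/andP; split; first by rewrite mulr_ge0 ?(le_trans ler01 B1)// exprn_ge0.
have pw : (p ^ e)%:R `^ eps = (p%:R `^ h) ^+ e * (p%:R `^ h) ^+ e.
  rewrite natrX -powR_mulrn ?ler0n// -powRrM mulrC.
  rewrite -!powR_mulrn ?powR_ge0// -!powRrM -powRD; last first.
    by apply/implyP => _; rewrite gt_eqF.
  by congr (_ `^ _); rewrite /h; field.
have q1 : 1 <= p%:R `^ h.
  by rewrite -[leLHS](powRr0 p%:R) ler_powR ?(ltW h0)// ler1n prime_gt0.
have step : B * e.+1%:R ^+ A <= K * (p%:R `^ h) ^+ e.
  apply: le_trans (ler_wpM2l (le_trans ler01 B1) (hK1 e)) _.
  rewrite mulrA -/K ler_wpM2l ?(ltW K0)//.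
  rewrite -powR_mulrn ?powR_ge0// -powRrM /powR gt_eqF// ler_expR.
  have l2p : ln 2 <= ln p%:R :> R by rewrite ler_ln ?posrE// ler_nat.
  by rewrite mulrAC ler_wpM2l// mulr_ge0 ?(ltW h0).
apply: (le_trans step); rewrite pw.
case: ltnP => pP.
  rewrite ler_wpM2l ?(ltW K0)// ler_peMl ?exprn_ge0 ?powR_ge0// exprn_ege1//.
rewrite mul1r ler_wpM2r ?exprn_ge0 ?powR_ge0//.
apply: (@le_trans _ _ (p%:R `^ h)); last first.
  by rewrite -{1}[p%:R `^ h]expr1 ler_weXn2l.
have Kp : K `^ h^-1 <= p%:R.
  apply: ltW; apply: lt_le_trans (truncnS_gt _) _; by rewrite ler_nat.
have KE : K = (K `^ h^-1) `^ h by rewrite -powRrM mulVf ?lt0r_neq0// powRr1 ?(ltW K0).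
rewrite [leLHS]KE.
by rewrite ge0_ler_powR ?nnegrE ?powR_ge0 ?(ltW h0) ?(ltW p0).
Qed.

Lemma tau_bound (eps : R) : 0 < eps -> exists2 K : R, 1 <= K &
  forall n : nat, (0 < n)%N -> (tau n)%:R <= K * n%:R `^ eps.
Proof.
move=> e0; have [K K1 hK] := prod_primes_bound 1 e0 (lexx 1).
exists K => // n n0; apply: le_trans (hK n n0).
under eq_bigr do rewrite mul1r expr1.
by rewrite -natr_prod ler_nat tau_le_prod.
Qed.

Lemma divk_bound (k : nat) (eps : R) : 0 < eps -> exists2 K : R, 1 <= K &
  forall n : nat, (0 < n)%N -> (divk k n)%:R <= K * n%:R `^ eps.
Proof.
move=> e0; have k0 : 0 < k.+1%:R :> R by [].
have [K K1 hK] := tau_bound (divr_gt0 e0 k0).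
(* The exponent [k.+1] instead of [k] avoids a division by 0; since $\tau(n)\ge1$ it only enlarges
   the bound. *)
exists (K ^+ k.+1) => [|n n0]; first by rewrite exprn_ege1.
apply: (@le_trans _ _ ((tau n)%:R ^+ k.+1)).
  rewrite -natrX ler_nat; apply: leq_trans (divk_le_tau k n0) _.
  rewrite leq_pexp2l//; apply: (leq_trans (leqnn 1)).
  by rewrite /tau; have := divisors_id n0; case: divisors.
rewrite (_ : n%:R `^ eps = (n%:R `^ (eps / k.+1%:R)) ^+ k.+1); last first.
  by rewrite -powR_mulrn ?powR_ge0// -powRrM divfK// gt_eqF.
rewrite -exprMn lerXn2r ?nnegrE ?ler0n ?mulr_ge0 ?powR_ge0 ?(le_trans ler01 K1)//.
exact: hK.
Qed.

(** For each prime factor, $p^e\le2(p-1)p^{e-1}$. *)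
Lemma totient_lower n : (0 < n)%N -> (n <= totient n * \prod_(p <- primes n) 2)%N.
Proof.
move=> n0; rewrite totientE// -big_split /= {1}(prod_prime_decomp n0) prime_decompE big_map /=.
rewrite !big_seq; elim/big_ind2: _ => // [a b c d|p]; first exact: leq_mul.
rewrite mem_primes => /and3P[pp _ pn].
have : (0 < logn p n)%N by rewrite logn_gt0 mem_primes pp n0.
case: (logn p n) => // e _ /=; rewrite expnS mulnAC leq_mul2r; apply/orP; right.
by have := prime_gt1 pp; case: p {pp pn} => // -[] //= p _; lia.
Qed.

Lemma totient_bound (eps : R) : 0 < eps -> exists2 K : R, 1 <= K &
  forall n : nat, (0 < n)%N -> n%:R / (totient n)%:R <= K * n%:R `^ eps.
Proof.
move=> e0; have [//|K K1 hK] := @prod_primes_bound 0 2 _ e0; first by rewrite ler1n.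
exists K => // n n0; apply: le_trans (hK n n0).
under eq_bigr do rewrite expr0 mulr1.
rewrite ler_pdivrMr ?ltr0n ?totient_gt0// mulrC -natr_prod -natrM ler_nat.
exact: totient_lower.
Qed.

End DivisorBounds.

(** * Sums of the Möbius function over divisors *)

Section Mobius.

Lemma mobius_sqr p d : prime p -> (0 < d)%N -> (p ^ 2 %| d)%N -> mobius d = 0.
Proof.
move=> pp d0 pd; rewrite /mobius; case: ifP => // /allP /(_ p).
have p1 : (p %| d)%N by apply: dvdn_trans pd; rewrite expnS dvdn_mulr.
rewrite mem_primes pp d0 p1 => /(_ isT)/eqP h.
by move: pd; rewrite pfactor_dvdn// h.
Qed.

Lemma mobius_mul_prime p d : prime p -> (0 < d)%N -> ~~ (p %| d)%N ->
  mobius (p * d) = - mobius d.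
Proof.
move=> pp d0 pd; have p0 := prime_gt0 pp.
have pm : perm_eq (primes (p * d)) (p :: primes d).
  apply: uniq_perm; rewrite /= ?primes_uniq ?andbT//.
    by rewrite mem_primes (negbTE pd) !andbF.
  by move=> q; rewrite primesM// primes_prime// !inE.
rewrite /mobius (perm_all _ pm) (perm_size pm) /= lognM// logn_prime// eqxx.
have -> : logn p d = 0%N by apply/eqP; rewrite -leqn0 leqNgt logn_gt0 mem_primes (negbTE pd) !andbF.
rewrite (@eq_in_all _ _ (fun q => logn q d == 1%N)) /=.
  by case: ifP => _; rewrite ?oppr0// exprS mulN1r.
move=> q; rewrite mem_primes => /and3P[pq _ qd]; rewrite lognM// logn_prime//.
by have -> : (q == p) = false by apply/negbTE; apply: contra pd => /eqP <-.
Qed.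

(** For the least prime $p$ dividing $n$, divisors divisible by $p^2$ contribute 0, and $pd$ cancels
    $d$ when $p\nmid d$. *)
Lemma sum_mobius n : (1 < n)%N -> \sum_(d <- divisors n) mobius d = 0.
Proof.
move=> n1; have n0 := ltnW n1; pose p := pdiv n.
have pp : prime p by rewrite pdiv_prime.
have pn : (p %| n)%N by rewrite pdiv_dvd.
have p0 := prime_gt0 pp.
rewrite (bigID (fun d => (p %| d)%N)) /= (bigID (fun d => (p ^ 2 %| d)%N)) /=.
rewrite big1_seq ?add0r; last first.
  move=> d /andP[/andP[_ h]]; rewrite -dvdn_divisors// => dn.
  by apply: (mobius_sqr pp) => //; exact: dvdn_gt0 dn.
set s1 := [seq d <- divisors n | ~~ (p %| d)%N].
have pm : perm_eq [seq d <- divisors n | (p %| d)%N && ~~ (p ^ 2 %| d)%N] [seq (p * d)%N | d <- s1].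
  apply: uniq_perm; first by rewrite filter_uniq ?divisors_uniq.
    rewrite map_inj_uniq ?filter_uniq ?divisors_uniq//.
    by move=> a b /eqP; rewrite eqn_pmul2l// => /eqP.
  move=> d; rewrite mem_filter -dvdn_divisors//; apply/idP/mapP.
    move=> /andP[/andP[/dvdnP[e ->] h] dn]; exists e; last by rewrite mulnC.
    rewrite mem_filter -dvdn_divisors// (dvdn_trans _ dn) ?dvdn_mulr// andbT.
    by apply: contra h => pe; rewrite expnS expn1 dvdn_mul.
  move=> [e]; rewrite mem_filter -dvdn_divisors// => /andP[pe en] ->.
  rewrite dvdn_mulr//= expnS expn1 dvdn_pmul2l// pe /=.
  by rewrite Gauss_dvd ?pn// prime_coprime.
rewrite -big_filter (perm_big _ pm) big_map /= -[X in _ + X = _]big_filter -/s1.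
rewrite (eq_big_seq (fun d => - mobius d)); first by rewrite sumrN addNr.
move=> d; rewrite mem_filter -dvdn_divisors// => /andP[pd dn].
by apply: mobius_mul_prime => //; exact: dvdn_gt0 dn.
Qed.

Lemma sum_mobius_compl q : (1 < q)%N -> \sum_(d <- divisors q) mobius (q %/ d) = 0.
Proof.
move=> q1; have q0 := ltnW q1; rewrite -[RHS](sum_mobius q1).
transitivity (\sum_(d <- [seq (q %/ d)%N | d <- divisors q]) mobius d); first by rewrite big_map.
have f x : (x %| q)%N -> (q %/ (q %/ x) = x)%N by move=> xq; rewrite divnA// mulKn.
apply: perm_big; apply: uniq_perm; rewrite ?divisors_uniq//.
  rewrite map_inj_in_uniq ?divisors_uniq// => a b.
  by rewrite -!dvdn_divisors// => aq bq h; rewrite -(f _ aq) h f.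
move=> d; rewrite -dvdn_divisors//; apply/mapP/idP.
  by move=> [e]; rewrite -dvdn_divisors// => eq ->; rewrite dvdn_div.
by move=> dq; exists (q %/ d)%N; rewrite ?f// -dvdn_divisors// dvdn_div.
Qed.

Lemma normr_mobius d : `|mobius d| <= 1.
Proof.
rewrite /mobius; case: ifP => _; last by rewrite normr0.
by rewrite normrX normrN1 expr1n.
Qed.

End Mobius.

(** * Expansions of the local factors, of powers of zeta and of $Q_k$ *)

Section LocalFactors.
Variable R : realType.
Local Notation C := (Cx R).

(** Cauchy's inequality, read off the norm instead of a contour integral. *)
Lemma pser_coef r M (f : C -> C) a j : pser r M f a -> cmod (a j) <= M / r ^+ j.
Proof.
move=> [r0 h _]; rewrite ler_pdivlMr ?exprn_gt0//; apply: le_trans (h j.+1).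
rewrite big_nat_recr//= lerDr sumr_ge0// => i _.
by rewrite mulr_ge0 ?cmod_ge0 ?exprn_ge0 ?(ltW r0).
Qed.

Lemma pser_sum (I : eqType) (s : seq I) r (M : I -> R) (f : I -> C -> C) (a : I -> nat -> C) :
  0 < r -> (forall i, i \in s -> pser r (M i) (f i) (a i)) ->
  pser r (\sum_(i <- s) M i) (fun w => \sum_(i <- s) f i w) (fun j => \sum_(i <- s) a i j).
Proof.
move=> r0; elim: s => [|i s ih] h.
  rewrite big_nil -(@cmod0 R).
  have -> : (fun j : nat => \sum_(i <- [::]) a i j) = (fun j => if j == 0%N then 0 else 0).
    by apply/funext => j; rewrite big_nil if_same.
  by apply: pser_ext (pser_cst 0 r0) => w _; rewrite big_nil.
rewrite big_cons.
have -> : (fun j => \sum_(i <- i :: s) a i j) = (fun j => a i j + \sum_(i <- s) a i j).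
  by apply/funext => j; rewrite big_cons.
apply: pser_ext (pserD (h i _) (ih _)); rewrite ?mem_head//.
  by move=> w _; rewrite big_cons.
by move=> j js; apply: h; rewrite in_cons js orbT.
Qed.

Lemma cpow_natM (x : R) n (s : C) : cpow x (n%:R * s) = cpow x s ^+ n.
Proof.
elim: n => [|n ih]; first by rewrite mul0r cpow0 expr0.
by rewrite -natr1 mulrDl mul1r cpowD ih exprSr.
Qed.

Lemma sum_geom_le (u : R) n : 0 <= u -> u < 1 -> \sum_(0 <= v < n) u ^+ v <= (1 - u)^-1.
Proof.
move=> u0 u1; have d0 : 0 < 1 - u by rewrite subr_gt0.
rewrite -[leRHS]mul1r ler_pdivlMr//.
have -> : (\sum_(0 <= v < n) u ^+ v) * (1 - u) = 1 - u ^+ n.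
  elim: n => [|n ih]; first by rewrite big_geq// expr0 mul0r subrr.
  by rewrite big_nat_recr//= mulrDl ih exprS; ring.
by rewrite lerBlDr lerDl exprn_ge0.
Qed.

(** The factor at $p$ of the product in [Psi], with [a] standing for $\nu_p(eq/d)$. *)
Definition local_factor (k p a : nat) (s : C) : C :=
  (1 - cpow p%:R (- s)) ^+ k
  * limn (fun n : nat => \sum_(0 <= v < n) (divk k (p ^ (v + a)))%:R / cpow p%:R (v%:R * s)).

(** Uniformity in [p] is the point: at radius $r\le1/2$ the function $p^{-1-w}$ has norm at most
    $p^{-1/2}\le2^{-1/2}$. The dependence on [a] comes from
    $d_k(p^{v+a})\le(v+a+1)^k\le(v+1)^k(a+1)^k$. *)
Lemma local_factor_pser (k : nat) (r : R) : 0 < r -> r <= 2^-1 ->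
  exists2 B : R, 1 <= B & forall p a, prime p ->
    exists c, pser r (B * a.+1%:R ^+ k) (fun w => local_factor k p a (1 + w)) c.
Proof.
move=> r0 r2; have l2 : 0 < ln 2 :> R by rewrite ln_gt0// ltr1n.
(* Below, [t] is $2^{-1/2}$ and [u] is $2^{-1/4}$: half of the decay $t^v=u^{2v}$ is spent on
   $(v+1)^k$, and the geometric sum of $u^v$ remains. *)
pose c : R := ln 2 / 4; have c0 : 0 < c by rewrite divr_gt0.
have [K K1 hK] := exp_dominates k c0.
pose t := expR (- (c *+ 2)); pose u := expR (- c).
have t0 : 0 <= t by exact: expR_ge0.
have t1 : t <= 1 by rewrite -expR0 ler_expR oppr_le0 mulrn_wge0 ?(ltW c0).
have u0 : 0 <= u by exact: expR_ge0.
have u1 : u < 1 by rewrite -expR0 ltr_expR oppr_lt0.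
have v0 : 0 < 1 - u by rewrite subr_gt0.
pose B := 2 ^+ k * (K / (1 - u)).
exists B.
  rewrite -[1]mulr1 ler_pM// ?exprn_ege1 ?ler1n//.
  by rewrite ler_pdivlMr// mul1r; apply: le_trans K1; rewrite lerBlDr lerDl.
move=> p a pp; have p0 : 0 < p%:R :> R by rewrite ltr0n prime_gt0.
have lp : ln 2 <= ln p%:R :> R by rewrite ler_ln ?posrE// ler_nat prime_gt1.
pose y w : C := cpow p%:R (- (1 + w)).
have [cy py] : exists cy, pser r t y cy.
  exists (fun j => (p%:R^-1)%:C * ((- ln p%:R)%:C ^+ j / j`!%:R)).
  have q := pserZ (p%:R^-1)%:C (pser_cexp (- ln p%:R) r0).
  have {}q := pser_ext (g := y) (fun w _ => esym (cpowN1w w p0)) q.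
  apply: pser_le q; rewrite cmod_real gtr0_norm ?invr_gt0// normrN ger0_norm; last first.
    by rewrite ln_ge0// ler1n prime_gt0.
  rewrite -{1}[p%:R](lnK p0) -expRN -expRD ler_expR.
  have : ln p%:R * r <= ln p%:R / 2 by rewrite ler_wpM2l// ln_ge0// ler1n prime_gt0.
  rewrite /c; lra.
have p1 := pserD (pser_cst 1 r0) (pserZ (-1) py).
have {}p1 : exists b, pser r (2 ^+ k) (fun w => (1 - y w) ^+ k) b.
  have [b pb] := pserX k p1; exists b.
  have {}pb := pser_ext (g := fun w => (1 - y w) ^+ k) _ pb.
  apply: pser_le (pb _); last by move=> w _; rewrite mulN1r.
  rewrite lerXn2r ?nnegrE// ?addr_ge0 ?mulr_ge0 ?cmod_ge0//.
  by rewrite cmodN cmod1 mul1r; move: t1; lra.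
have [b pb] := p1.
have /choice[cv pv] v : exists cc, pser r (v.+1%:R ^+ k * a.+1%:R ^+ k * t ^+ v)
    (fun w => (divk k (p ^ (v + a)))%:R / cpow p%:R (v%:R * (1 + w))) cc.
  have [b' pb'] := pserX v py.
  exists (fun j => (divk k (p ^ (v + a)))%:R * b' j).
  have q := pserZ (divk k (p ^ (v + a)))%:R pb'.
  apply: pser_ext (pser_le _ q).
    by move=> w _; rewrite cpow_natM -exprVn /y cpowN.
  rewrite ler_wpM2r ?exprn_ge0// cmod_nat -exprMn -natrM -natrX ler_nat.
  apply: leq_trans (divk_le_tau _ _) _; first by rewrite expn_gt0 prime_gt0.
  have : (tau (p ^ (v + a)) <= v.+1 * a.+1)%N.
    by apply: leq_trans (tau_pfactor _ pp) _; clear; lia.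
  by case: (k) => // k'; rewrite leq_exp2r.
have hM n : \sum_(0 <= v < n) v.+1%:R ^+ k * a.+1%:R ^+ k * t ^+ v
    <= K / (1 - u) * a.+1%:R ^+ k.
  apply: (@le_trans _ _ (\sum_(0 <= v < n) u ^+ v * (K * a.+1%:R ^+ k))).
    apply: ler_sum => v _; rewrite mulrAC mulrA ler_wpM2r ?exprn_ge0//.
    apply: le_trans (ler_wpM2r _ (hK v)) _; first by rewrite exprn_ge0.
    rewrite mulrC [leRHS]mulrC mulrCA ler_wpM2l ?(le_trans ler01 K1)//.
    rewrite /t /u -!expRM_natr -expRD ler_expR; lra.
  rewrite -mulr_suml mulrC mulrAC ler_wpM2r ?exprn_ge0//.
  by rewrite ler_wpM2l ?(le_trans ler01 K1)// sum_geom_le.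
have [g [cg [pg tg]]] := pser_series r0 pv hM.
exists (conv b cg); rewrite /B -mulrA.
apply: pser_ext (pserM pb pg) => w wr; rewrite /local_factor; congr (_ * _).
by apply/esym/cto_lim; exact: tg.
Qed.

Lemma local_prod_pser (k : nat) (r : R) : 0 < r -> r <= 2^-1 ->
  exists2 B : R, 1 <= B & forall m, exists c,
    pser r (\prod_(p <- primes m) (B * (logn p m).+1%:R ^+ k))
      (fun w => \prod_(p <- primes m) local_factor k p (logn p m) (1 + w)) c.
Proof.
move=> r0 r2; have [B B1 hB] := local_factor_pser k r0 r2; exists B => // m.
have : all prime (primes m) by apply/allP => p; rewrite mem_primes => /andP[].
elim: (primes m) => [_|p s ih /= /andP[pp /ih[c pc]]].
  exists (fun j => if j == 0%N then 1 else 0); rewrite big_nil -cmod1.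
  by apply: pser_ext (pser_cst 1 r0) => w _; rewrite big_nil.
have [c' pc'] := hB p (logn p m) pp; exists (conv c' c); rewrite big_cons.
by apply: pser_ext (pserM pc' pc) => w _; rewrite big_cons.
Qed.

Lemma Psi_pser (k : nat) (r : R) : 0 < r -> r <= 2^-1 ->
  exists2 B : R, 1 <= B & exists P : nat -> nat -> nat -> nat -> C, forall d e q,
    pser r (cmod (d%:R * (mobius d)%:~R * (mobius e)%:~R / ((totient d)%:R * e%:R) : C) *
       \prod_(p <- primes (e * q %/ d)) (B * (logn p (e * q %/ d)).+1%:R ^+ k))
      (fun w => Psi d e (1 + w) q k) (P d e q).
Proof.
move=> r0 r2; have [B B1 /choice[P hP]] := local_prod_pser k r0 r2; exists B => //.
exists (fun d e q j => d%:R * (mobius d)%:~R * (mobius e)%:~R / ((totient d)%:R * e%:R)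
   * P (e * q %/ d)%N j) => d e q.
exact: pserZ (hP _).
Qed.

(** Taylor coefficients of $e^{wL}$ at $w=0$; with $L=\log y$ this is the expansion of $y^w$. *)
Definition expc (L : R) j : C := L%:C ^+ j / j`!%:R.

(** The function $w\zeta(1+w)=1+wZ(w)$ is regular at 0, so the pole of $\zeta^k$ becomes the
    explicit factor $w^{-k}$. *)
Lemma zetak_pser k : exists (M : R) (g : C -> C) (a : nat -> C),
  pser 2^-1 M g a /\ forall w, 0 < cmod w < 2^-1 -> zeta (1 + w) ^+ k = g w / w ^+ k.
Proof.
have [M [Z [a [pZ hZ]]]] := zeta_pser R; have [r0 _ _] := pZ.
have p1 := pserD (pser_cst 1 r0) (pserM (pser_var r0) pZ).
have [b pb] := pserX k p1.
do 3 eexists; split; first exact: pb.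
move=> w w0; rewrite hZ// -expr_div_n; congr (_ ^+ _).
have wn : w != 0 by move: w0 => /andP[]; rewrite cmod_gt0.
by rewrite mulrDl div1r mulrAC divff// mul1r.
Qed.

(** The pole has order $k+1$, so the residue is the coefficient of index $k$. The radius [r] stays
    free because the bound contains $e^{r|\log(ex/dq)|}$, a small power when [r] is small. The
    coefficients [c] are exposed so that measurability in [x] can be read off them. *)
Lemma Qk_formula k M g a r MP P (x : R) q : 0 < r -> r <= 2^-1 ->
  pser 2^-1 M g a ->
  (forall w, 0 < cmod w < 2^-1 -> zeta (1 + w) ^+ k.+1 = g w / w ^+ k.+1) ->
  (forall d e q, pser r (MP d e q) (fun w => Psi d e (1 + w) q k.+1) (P d e q)) ->
  exists2 c : nat -> C,
   (c = fun j => \sum_(d <- divisors q) \sum_(e <- divisors d)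
     conv (P d e q) (expc (ln (e%:R * x / (d%:R * q%:R)))) j) &
  Qk k.+1 x q = complex.Re (conv a c k) /\
  cmod (conv a c k) <= M * (\sum_(d <- divisors q) \sum_(e <- divisors d)
      (MP d e q * expR (`|ln (e%:R * x / (d%:R * q%:R))| * r))) / r ^+ k.
Proof.
move=> r0 r2 pg hz hP; eexists; first by [].
set c := (fun j => _).
have pg' := pser_radius r0 r2 pg.
have pc := @pser_sum _ (divisors q) r _ _ _ r0 (fun d _ =>
  @pser_sum _ (divisors d) r _ _ _ r0 (fun e _ =>
   pserM (hP d e q) (pser_cexp (ln (e%:R * x / (d%:R * q%:R))) r0))).
have pp := pserM pg' pc.
split; last exact: pser_coef pp.
rewrite /Qk; congr complex.Re; apply: (Res_pser pp) => z /andP[z0 zr].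
have -> : zeta z ^+ k.+1 = g (z - 1) / (z - 1) ^+ k.+1.
  by rewrite -hz ?z0 ?(lt_le_trans zr r2)// addrC subrK.
rewrite [RHS]mulrAC; congr (_ * _); apply: eq_bigr => d _; apply: eq_bigr => e _.
by rewrite /cpow [1 + _]addrC subrK.
Qed.

End LocalFactors.

(** * Size and explicit form of the main terms *)

Section MainTerms.
Variable R : realType.
Local Notation C := (Cx R).

Lemma tau_mono d q : (0 < q)%N -> (d %| q)%N -> (tau d <= tau q)%N.
Proof.
move=> q0 dq; apply: uniq_leq_size; first exact: divisors_uniq.
have d0 := dvdn_gt0 q0 dq.
by move=> e; rewrite -!dvdn_divisors// => ed; exact: dvdn_trans ed dq.
Qed.

Lemma ler_sum_size (I : eqType) (s : seq I) (F : I -> R) (B : R) :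
  (forall i, i \in s -> F i <= B) -> \sum_(i <- s) F i <= (size s)%:R * B.
Proof.
elim: s => [|i s ih] h; first by rewrite big_nil mul0r.
rewrite big_cons /= -nat1r mulrDl mul1r lerD ?h ?mem_head//.
by apply: ih => j js; apply: h; rewrite in_cons js orbT.
Qed.

Lemma cmod_mobius n : cmod ((mobius n)%:~R : C) <= 1.
Proof.
rewrite /mobius; case: ifP => _; last by rewrite mulr0z cmod0.
by rewrite rmorphXn /= cmodX rmorphN1 cmodN cmod1 expr1n.
Qed.

Lemma Qk_bound (k : nat) (eps : R) : 0 < eps -> exists2 K : R, 1 <= K &
  forall (x : R) (q : nat), 1 <= x -> (0 < q)%N -> `|Qk k.+1 x q| <= K * (q%:R * x) `^ eps.
Proof.
(* The exponent of $q$ adds up to four times [eta], from $\tau(q)^2$, $d/\varphi(d)$ and the local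
   factors, plus $2r$: at most $\varepsilon/2+\varepsilon/2$. *)
move=> e0; pose eta := eps / 8; have eta0 : 0 < eta by rewrite divr_gt0.
pose r := Num.min 2^-1 (eps / 4).
have r0 : 0 < r by rewrite lt_min divr_gt0// andbT invr_gt0.
have r2 : r <= 2^-1 by rewrite ge_min lexx.
have re : r <= eps / 4 by rewrite ge_min lexx orbT.
have [M [g [a [pg hz]]]] := zetak_pser R k.+1.
have [B B1 [P hP]] := Psi_pser k.+1 r0 r2.
have [K1 K11 hK1] := prod_primes_bound k.+1 eta0 B1.
have [K2 K21 hK2] := totient_bound eta0.
have [K3 K31 hK3] := tau_bound eta0.
have M0 := pser_ge0 pg.
pose K := M * (K3 * K3 * (K2 * K1)) / r ^+ k.
exists (Num.max 1 K); first by rewrite le_max lexx.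
move=> x q x1 q0; have x0 : 0 < x := lt_le_trans ltr01 x1.
have q1 : 1 <= q%:R :> R by rewrite ler1n.
have qp : 0 < q%:R :> R := lt_le_trans ltr01 q1.
apply: (@le_trans _ _ (K * (q%:R * x) `^ eps)); last first.
  by rewrite ler_wpM2r ?powR_ge0// le_max lexx orbT.
have [c _ [-> hc]] := Qk_formula x q r0 r2 pg hz hP.
apply: le_trans (ler_Re_cmod _) _; apply: (le_trans hc).
rewrite /K; set Q := (q%:R * x) `^ eps.
rewrite [leRHS]mulrAC ler_wpM2r ?invr_ge0 ?exprn_ge0 ?(ltW r0)// -[leRHS]mulrA ler_wpM2l//.
(* [T] bounds the contribution of one pair $(d,e)$; its last factor comes from
   $|\log(ex/dq)|\le2\log q+\log x$. *)
pose T := K2 * q%:R `^ eta * (K1 * q%:R `^ eta) * (q%:R `^ (2 * r) * x `^ r).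
have T0 : 0 <= T by rewrite !mulr_ge0 ?powR_ge0// (le_trans ler01).
apply: (@le_trans _ _ ((tau q)%:R * ((tau q)%:R * T))).
  apply: ler_sum_size => d; rewrite -dvdn_divisors// => dq.
  have d0 := dvdn_gt0 q0 dq.
  apply: (@le_trans _ _ ((tau d)%:R * T)); last first.
    by rewrite ler_wpM2r// ler_nat tau_mono.
  apply: ler_sum_size => e; rewrite -dvdn_divisors// => ed.
  have ep := dvdn_gt0 d0 ed.
  have dR : 0 < d%:R :> R by rewrite ltr0n.
  have eR : 0 < e%:R :> R by rewrite ltr0n.
  have led : e%:R <= d%:R :> R by rewrite ler_nat dvdn_leq.
  have ldq : d%:R <= q%:R :> R by rewrite ler_nat dvdn_leq.
  have e1 : 1 <= e%:R :> R by rewrite ler1n.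
  have m0 : (0 < e * q %/ d)%N.
    by rewrite divn_gt0// (leq_trans (dvdn_leq q0 dq))// leq_pmull.
  have mq : (e * q %/ d <= q)%N.
    rewrite -[leqRHS](mulKn q d0) leq_div2r// leq_mul2r dvdn_leq ?orbT//.
  rewrite /T; apply: ler_pM => //.
  - by rewrite !mulr_ge0 ?cmod_ge0// prodr_ge0// => p _; rewrite mulr_ge0 ?exprn_ge0 ?(le_trans ler01 B1).
  - apply: ler_pM; rewrite ?cmod_ge0//.
    + by rewrite prodr_ge0// => p _; rewrite mulr_ge0 ?exprn_ge0 ?(le_trans ler01 B1).
    + apply: (@le_trans _ _ (d%:R / (totient d)%:R)).
        rewrite !cmodM cmodV cmodM !cmod_nat invfM.
        rewrite -[leRHS]mulr1 -!mulrA ler_wpM2l ?(ltW dR)//.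
        rewrite (_ : cmod _ * (_ * _) = (totient d)%:R^-1 *
            (cmod ((mobius d)%:~R : C) * cmod ((mobius e)%:~R : C) / e%:R)); last by ring.
        rewrite ler_wpM2l ?invr_ge0//; apply: mulr_ile1; rewrite ?mulr_ge0 ?cmod_ge0 ?invr_ge0//.
          by apply: mulr_ile1; rewrite ?cmod_ge0 ?cmod_mobius.
        by rewrite invf_le1.
      apply: le_trans (hK2 d d0) _; rewrite ler_wpM2l ?(le_trans ler01 K21)//.
      by rewrite ge0_ler_powR ?nnegrE ?(ltW eta0) ?(ltW dR) ?(ltW qp).
    + apply: le_trans (hK1 _ m0) _; rewrite ler_wpM2l ?(le_trans ler01 K11)//.
      by rewrite ge0_ler_powR ?nnegrE ?(ltW eta0) ?ler0n// ler_nat.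
  - have lnX : ln (e%:R * x / (d%:R * q%:R)) = ln e%:R + ln x - (ln d%:R + ln q%:R) :> R.
      by rewrite ln_div ?posrE ?mulr_gt0// !lnM ?posrE.
    rewrite lnX /powR !gt_eqF// -expRD ler_expR.
    have le0 : 0 <= ln e%:R :> R by rewrite ln_ge0.
    have lx0 : 0 <= ln x by rewrite ln_ge0.
    have led' : ln e%:R <= ln d%:R :> R by rewrite ler_ln ?posrE.
    have ldq' : ln d%:R <= ln q%:R :> R by rewrite ler_ln ?posrE.
    have : `|ln e%:R + ln x - (ln d%:R + ln q%:R)| <= 2 * ln q%:R + ln x.
      by rewrite ler_norml; apply/andP; split; lra.
    by move=> /(ler_wpM2r (ltW r0)); lra.
have tq := hK3 q q0; rewrite mulrA.
apply: (@le_trans _ _ ((K3 * q%:R `^ eta) * (K3 * q%:R `^ eta) * T)).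
  by rewrite ler_wpM2r// ler_pM.
have pq y z : q%:R `^ (y + z) = q%:R `^ y * q%:R `^ z :> R.
  by rewrite powRD//; apply/implyP => _; rewrite gt_eqF.
have -> : K3 * q%:R `^ eta * (K3 * q%:R `^ eta) * T =
   K3 * K3 * (K2 * K1) * (q%:R `^ (eta + eta + (eta + eta) + 2 * r) * x `^ r).
  by rewrite !pq /T; ring.
rewrite ler_wpM2l ?mulr_ge0 ?(le_trans ler01)// /Q powRM ?(ltW qp) ?(ltW x0)//.
apply: ler_pM; rewrite ?powR_ge0//; apply: ler_powR => //; rewrite /eta; lra.
Qed.

(** [Qk_formula] is valid for every real [x], because [cpow] depends on [x] only through [ln]. Hence
    $Q_k(\cdot,q)$ is a finite combination of powers of logarithms on the whole line. *)
Lemma Qk_measurable (k q : nat) : measurable_fun (setT : set R) (fun x : R => Qk k.+1 x q).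
Proof.
have [M [g [a [pg hz]]]] := zetak_pser R k.+1.
have r0 : 0 < 2^-1 :> R by [].
have [B B1 [P hP]] := Psi_pser k.+1 r0 (lexx _).
pose c x := fun j => \sum_(d <- divisors q) \sum_(e <- divisors d)
     conv (P d e q) (expc (ln (e%:R * x / (d%:R * q%:R)))) j.
have E : (fun x : R => Qk k.+1 x q) = (fun x => complex.Re (conv a (c x) k)).
  by apply/funext => x; have [_ -> [-> _]] := Qk_formula x q r0 (lexx _) pg hz hP.
rewrite E /conv.
have -> : (fun x => complex.Re (\sum_(0 <= i < k.+1) a i * c x (k - i)%N)) = 
  (fun x => \sum_(0 <= i < k.+1) \sum_(d <- divisors q) \sum_(e <- divisors d)
    \sum_(0 <= l < (k - i).+1) complex.Re (a i * P d e q l) *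
      (ln (e%:R * x / (d%:R * q%:R)) ^+ (k - i - l) / (k - i - l)`!%:R)).
  apply/funext => x; rewrite raddf_sum; apply: eq_bigr => i _.
  rewrite /c mulr_sumr raddf_sum; apply: eq_bigr => d _.
  rewrite mulr_sumr raddf_sum; apply: eq_bigr => e _.
  rewrite /conv mulr_sumr raddf_sum; apply: eq_bigr => l _.
  rewrite mulrA /expc -rmorphXn -(rmorph_nat (real_complex R)) -fmorphV -rmorphM.
  by case: (a i * P d e q l) => u v /=; rewrite mulr0 subr0.
apply: measurable_sum => i; apply: measurable_sum => d; apply: measurable_sum => e.
apply: measurable_sum => l; apply: measurable_funM; first exact: measurable_cst.
apply: measurable_funM; last exact: measurable_cst.
apply: measurable_funX; apply: measurableT_comp; first exact: measurable_ln.
by apply: measurable_funM => //; apply: measurable_funM.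
Qed.

(** The geometric series for the factor $1/s$ at $s=1+w$ of the main term; its norm at radius $1/2$
    is at most $\sum2^{-j}=2$. *)
Lemma pser_inv1D : pser (2^-1 : R) 2 (fun w : C => (1 + w)^-1) (fun j => (-1) ^+ j).
Proof.
have r0 : 0 < 2^-1 :> R by [].
split=> // [n|w n wr].
  rewrite (eq_bigr (fun j => 2^-1 ^+ j)); last by move=> j _; rewrite cmodX cmodN cmod1 expr1n mul1r.
  have := @sum_geom_le R 2^-1 n (ltW r0); rewrite invf_lt1// ltr1n => /(_ isT).
  by rewrite (_ : (1 - 2^-1)^-1 = 2 :> R)//; field.
have w1 : 2^-1 <= cmod (1 + w).
  have := cmodD (1 + w) (- w); rewrite addrK cmod1 cmodN; lra.
have n0 : 1 + w != 0 by rewrite -cmod_gt0 (lt_le_trans r0).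
have -> : (1 + w)^-1 - psum (fun j => (-1) ^+ j) n w = (- w) ^+ n / (1 + w).
  rewrite /psum; elim: n => [|n ih]; first by rewrite big_geq// subr0 expr0 mul1r.
  rewrite big_nat_recr//= opprD addrA ih -exprMn mulN1r [in RHS]exprS.
  by move: ((- w) ^+ n) => y; field.
rewrite cmodM cmodX cmodN cmodV invrK exprMn ler_pdivrMr ?(lt_le_trans r0)//.
rewrite (_ : _ * cmod _ = cmod w ^+ n * (2 * (2 ^+ n * cmod (1 + w)))); last by ring.
rewrite ler_peMr ?exprn_ge0 ?cmod_ge0//.
have y1 : 1 <= 2 ^+ n :> R by rewrite exprn_ege1// ler1n.
have := ler_pM ler01 (ltW r0) y1 w1; lra.
Qed.

(** The coefficient of $w^n$ in $x^{1+w}/(1+w)$, which is an antiderivative of $\log^nx/n!$. *)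
Definition tpoly n (x : R) : R :=
  x * \sum_(0 <= l < n.+1) ln x ^+ l / l`!%:R * (-1) ^+ (n - l).

(** The same [A i], real parts of the coefficients of $(w\zeta(1+w))^{k+1}$, occur in both formulas.
    This makes $M'=Q_k(\cdot,1)$ a termwise statement. *)
Lemma main_formula (k : nat) : exists A : nat -> R, forall x : R, 0 < x ->
  complex.Re (Res (fun s : C => zeta s ^+ k.+1 * cpow x s / s) 1)
    = \sum_(0 <= i < k.+1) A i * tpoly (k - i) x /\
  Qk k.+1 x 1 = \sum_(0 <= i < k.+1) A i * (ln x ^+ (k - i) / (k - i)`!%:R).
Proof.
have [M [g [a [pg hz]]]] := zetak_pser R k.+1; have [r0 _ _] := pg.
exists (fun i => complex.Re (a i)) => x x0.
have ReZ (z : C) (y : R) : complex.Re (z * y%:C) = complex.Re z * y.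
  by case: z => u v /=; rewrite mulr0 subr0.
have expcE L j : expc L j = (L ^+ j / j`!%:R)%:C :> C.
  by rewrite /expc -rmorphXn -(rmorph_nat (real_complex R)) -fmorphV -rmorphM.
have N1 n : (-1) ^+ n = ((-1) ^+ n)%:C :> C by rewrite rmorphXn rmorphN1.
split.
- have pe := pserZ x%:C (pser_cexp (ln x) r0).
  have pp := pserM pg (pserM pe pser_inv1D).
  rewrite (Res_pser pp (k := k)).
    rewrite /conv raddf_sum; apply: eq_bigr => i _.
    rewrite -ReZ; congr (complex.Re (_ * _)); rewrite /tpoly rmorphM rmorph_sum mulr_sumr.
    apply: eq_bigr => l _; rewrite -/(expc _ _) expcE N1 -mulrA.
    by rewrite !rmorphM.
  move=> z /andP[z0 zr].
  have zE : z = 1 + (z - 1) by rewrite addrC subrK.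
  have -> : zeta z ^+ k.+1 = g (z - 1) / (z - 1) ^+ k.+1 by rewrite {1}zE hz ?z0.
  have -> : cpow x z = x%:C * cexp ((z - 1) * (ln x)%:C).
    rewrite {1}zE cpowD; congr (_ * _).
    by rewrite -[1]/(1%:C) cpow_real// powRr1// ltW.
  by rewrite -zE; ring.
- have pp := pserM pg (pser_cexp (ln x) r0).
  rewrite /Qk (Res_pser pp (k := k)).
    by rewrite /conv raddf_sum; apply: eq_bigr => i _; rewrite -ReZ -expcE.
  move=> z /andP[z0 zr].
  have zE : z = 1 + (z - 1) by rewrite addrC subrK.
  have -> : zeta z ^+ k.+1 = g (z - 1) / (z - 1) ^+ k.+1 by rewrite {1}zE hz ?z0.
  (* For $q=1$ only $d=e=1$ occurs, and [Psi] is the constant 1. *)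
  rewrite (_ : divisors 1 = [:: 1%N])// !big_seq1.
  rewrite /Psi (_ : primes (1 * 1 %/ 1) = [::])// big_nil.
  rewrite (_ : mobius 1 = 1)// (_ : totient 1 = 1%N)// mul1r !mulr1 divr1 mul1r /cpow.
  by rewrite mul1r divr1 mulrAC.
Qed.

End MainTerms.

(* [lia] preprocesses every hypothesis; dropping the non-arithmetic ones first
   keeps it fast. *)
Ltac nat_lia :=
  repeat match goal with
  | h : ?P |- _ =>
      lazymatch P with
      | is_true (leq _ _) => fail
      | is_true (andb (leq _ _) (leq _ _)) => fail
      | nat => fail
      | _ => clear h
      end
  end; lia.

(** * The correlation sum over integers, for an abstract arithmetic function *)

Section DiscreteArgument.
Variable R : realType.
Variables (d : nat -> R) (M Q : R -> R) (B : R) (n0 n1 H : nat).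
Let D (n : nat) : R := \sum_(1 <= i < n.+1) d i.
Let Dl (n : nat) : R := D n - M n%:R.
(** Arguments reach $n+H\le3n_0+n_0$, whence the range up to $4n_0$. *)
Let W : R := \sum_(1 <= n < (4 * n0).+1) `|Dl n|.

Hypothesis B1 : 1 <= B.
Hypothesis n0_gt0 : (0 < n0)%N.
Hypothesis n01 : (n0 <= n1)%N.
Hypothesis n1_le : (n1 <= 3 * n0)%N.
Hypothesis H_le : (H <= n0)%N.
Hypothesis d_bd : forall n, (0 < n <= 4 * n0)%N -> 0 <= d n <= B.
Hypothesis Q_bd : forall n, (0 < n <= 4 * n0)%N -> `|Q n%:R| <= B.
Hypothesis Q_lip : forall n, (0 < n < 4 * n0)%N -> `|Q n.+1%:R - Q n%:R| <= B / n%:R.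
Hypothesis M_tay : forall n h, (0 < n)%N -> (n + h <= 4 * n0)%N ->
  `|M (n + h)%:R - M n%:R - h%:R * Q n%:R| <= B * h%:R ^+ 2 / n%:R.

Let B0 : 0 <= B. Proof. exact: le_trans ler01 B1. Qed.
Let n0R : 0 < n0%:R :> R. Proof. by rewrite ltr0n. Qed.

Lemma W_ge_range (m n : nat) : (0 < m)%N -> (n <= (4 * n0).+1)%N ->
  \sum_(m <= i < n) `|Dl i| <= W.
Proof.
move=> m0 nn; have [mn|nm] := leqP m n; last by rewrite big_geq ?sumr_ge0 ?(ltnW nm).
rewrite /W (big_cat_nat m0 (leq_trans mn nn))//= (big_cat_nat mn nn)//= addrA addrAC.
by rewrite lerDr addr_ge0 ?sumr_ge0.
Qed.

(** One step changes $D$ by a single value of $d$, at most $B$, and $M$ by at most $2B$, namely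
    $Q(n)$ and the Taylor error. *)
Lemma Dl_lip n : (0 < n < 4 * n0)%N -> `|Dl n.+1 - Dl n| <= 3 * B.
Proof.
move=> nn; have /andP[np nl] := nn.
have := M_tay (h := 1) np; rewrite addn1 => /(_ nl); rewrite expr1n mulr1 mul1r => h1.
have n1R : 1 <= n%:R :> R by rewrite ler1n.
have h2 : B / n%:R <= B by rewrite ler_pdivrMr ?ler_peMr// (lt_le_trans ltr01).
have /andP[h3 h4] := d_bd (n := n.+1) nl.
have /ler_normlP[h5 h6] := Q_bd (n := n) (introT andP (conj np (ltnW nl))).
have -> : Dl n.+1 - Dl n = d n.+1 - (M n.+1%:R - M n%:R).
  by rewrite /Dl /D big_nat_recr//=; ring.
move: h1; rewrite !ler_norml => /andP[h7 h8]; lra.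
Qed.

(** By [Dl_lip], $|\Delta(m)|\le|\Delta(m+j)|+3BH$ for $j<H$; adding these $H$ inequalities replaces
    a pointwise value, for which no good bound is at hand, by part of [W]. *)
Lemma endpoint_bound m : (0 < m)%N -> (m <= 3 * n0)%N ->
  H%:R * `|Dl m| <= W + 3 * B * H%:R ^+ 2.
Proof.
move=> m0 ml.
have lip j : (j < H)%N -> `|Dl m| <= `|Dl (m + j)%N| + 3 * B * H%:R.
  move=> jH; apply: (@le_trans _ _ (`|Dl (m + j)%N| + 3 * B * j%:R)); last first.
    by rewrite lerD2l ler_wpM2l ?mulr_ge0// ler_nat ltnW.
  elim: j jH => [|j ih] jH; first by rewrite addn0 mulr0 addr0.
  apply: le_trans (ih (ltnW jH)) _.
  have := @Dl_lip (m + j) _; rewrite addnS => /(_ _)h.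
  have {}h : `|Dl (m + j).+1 - Dl (m + j)%N| <= 3 * B by apply: h; nat_lia.
  rewrite -[j.+1%:R]natr1 mulrDr mulr1 addrA addrAC lerD2r.
  have := ler_normB (Dl (m + j).+1) (Dl (m + j).+1 - Dl (m + j)%N).
  rewrite subKr; lra.
apply: (@le_trans _ _ (\sum_(m <= i < m + H) `|Dl i| + 3 * B * H%:R ^+ 2)); last first.
  by rewrite lerD2r W_ge_range//; nat_lia.
have -> : \sum_(m <= i < m + H) `|Dl i| = \sum_(0 <= i < H) `|Dl (m + i)%N|.
  by rewrite -{1}[m]add0n big_addn addnC addnK; apply: eq_bigr => i _; rewrite addnC.
have -> : H%:R * `|Dl m| = \sum_(0 <= i < H) `|Dl m|.
  by rewrite sumr_const_nat subn0 mulr_natl.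
apply: (@le_trans _ _ (\sum_(0 <= i < H) (`|Dl (m + i)%N| + 3 * B * H%:R))).
  rewrite big_nat_cond [leRHS]big_nat_cond; apply: ler_sum => i /andP[/andP[_ iH] _].
  exact: lip.
by rewrite big_split /= sumr_const_nat subn0 lerD2l -[leLHS]mulr_natr expr2 mulrA.
Qed.

(** The main term arises from $D(n+H)-D(n)=HQ(n)+\dots$ for the inner sum and
    $d(n)=D(n)-D(n-1)=Q(n)+\dots$ for the outer factor. The errors add up to at most
    $9B^2W+12B^2H^2$; the constant 20 leaves room. *)
Lemma discrete_correlation :
  `| \sum_(n0.+1 <= n < n1.+1) \sum_(1 <= h < H.+1) d n * d (n + h)%N
     - H%:R * \sum_(n0.+1 <= n < n1.+1) Q n%:R ^+ 2 |
  <= 20 * B ^+ 2 * (H%:R ^+ 2 + W).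
Proof.
have W0 : 0 <= W by apply: sumr_ge0.
have cnt : (n1.+1 - n0.+1)%:R <= 2 * n0%:R :> R.
  by rewrite -natrM ler_nat; nat_lia.
have sumc (x : R) : 0 <= x -> \sum_(n0.+1 <= n < n1.+1) x / n0%:R <= 2 * x.
  move=> x0; rewrite sumr_const_nat -[leLHS]mulr_natr.
  have xn : 0 <= x / n0%:R by rewrite divr_ge0.
  by apply: le_trans (ler_wpM2l xn cnt) _; rewrite mulrCA divfK ?gt_eqF.
have hB x y : 0 <= x -> x <= y -> B * x <= B ^+ 2 * y.
  move=> x0 xy; rewrite expr2 -mulrA ler_wpM2l//; apply: (le_trans xy).
  by rewrite ler_peMl// (le_trans x0).
have sE n : \sum_(1 <= h < H.+1) d n * d (n + h)%N = d n * (D (n + H) - D n).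
  rewrite -mulr_sumr; congr (_ * _).
  have nH : (n.+1 <= (n + H).+1)%N by rewrite ltnS leq_addr.
  rewrite /D [X in _ = X - _](big_cat_nat (ltn0Sn n) nH)//=.
  rewrite addrAC subrr add0r -[n.+1]add1n -addSn big_addn.
  by rewrite (_ : (1 + n + H - n = H.+1)%N); [apply: eq_bigr => i _; rewrite addnC|nat_lia].
rewrite (eq_bigr _ (fun n _ => sE n)).
(* [E1] and [E2] are the oscillating error and the Taylor error of $D(n+H)-D(n)$; [E4] and [E3] are
   those of $d(n)$ against $Q(n)$. *)
pose E1 n := d n * (Dl (n + H) - Dl n).
pose E2 n := d n * (M (n + H)%:R - M n%:R - H%:R * Q n%:R).
pose E3 n := (M n%:R - M n.-1%:R - Q n%:R) * Q n%:R.
pose E4 n := (Dl n - Dl n.-1) * Q n%:R.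
have split n : (n0.+1 <= n)%N ->
   d n * (D (n + H) - D n) - H%:R * Q n%:R ^+ 2 = E1 n + E2 n + H%:R * (E3 n + E4 n).
  case: n => // n _; rewrite /E1 /E2 /E3 /E4 /=.
  have dE : d n.+1 = D n.+1 - D n by rewrite /D [X in X - _]big_nat_recr//=; ring.
  by rewrite /Dl dE; ring.
rewrite mulr_sumr -sumrB (eq_big_nat _ _ (F2 := fun n => E1 n + E2 n + H%:R * (E3 n + E4 n))); last first.
  by move=> n /andP[h _]; exact: split.
rewrite !big_split /= -mulr_sumr big_split /= mulrDr.
have rng n : (n0.+1 <= n < n1.+1)%N -> (0 < n <= 4 * n0)%N by nat_lia.
have b1 : `|\sum_(n0.+1 <= n < n1.+1) E1 n| <= 2 * (B ^+ 2 * W).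
  apply: le_trans (ler_norm_sum _ _ _) _.
  apply: (@le_trans _ _ (\sum_(n0.+1 <= n < n1.+1) (B * `|Dl (n + H)%N| + B * `|Dl n|))).
    rewrite big_nat_cond [leRHS]big_nat_cond; apply: ler_sum => n /andP[/rng nn _].
    have /andP[dn0 dnB] := d_bd nn.
    rewrite /E1 normrM ger0_norm// -mulrDr; apply: ler_pM => //; exact: ler_normB.
  rewrite big_split /= -!mulr_sumr mulrDl !mul1r.
  have sH : \sum_(n0.+1 <= n < n1.+1) `|Dl (n + H)%N| <= W.
    apply: le_trans (W_ge_range (m := n0.+1 + H) (n := n1.+1 + H) _ _); [|nat_lia|nat_lia].
    by rewrite [leRHS]big_addn !addnK.
  have s0 : \sum_(n0.+1 <= n < n1.+1) `|Dl n| <= W by apply: W_ge_range => //; nat_lia.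
  by apply: lerD; apply: hB; rewrite ?sumr_ge0.
have b2 : `|\sum_(n0.+1 <= n < n1.+1) E2 n| <= 2 * (B ^+ 2 * H%:R ^+ 2).
  apply: le_trans (ler_norm_sum _ _ _) _.
  apply: (@le_trans _ _ (\sum_(n0.+1 <= n < n1.+1) B ^+ 2 * H%:R ^+ 2 / n0%:R)).
    rewrite big_nat_cond [leRHS]big_nat_cond; apply: ler_sum => n /andP[nn' _].
    have nn := rng _ nn'; have /andP[dn0 dnB] := d_bd nn.
    rewrite /E2 normrM ger0_norm// (_ : B ^+ 2 * _ / _ = B * (B * H%:R ^+ 2 / n0%:R)); last by ring.
    apply: ler_pM => //.
    apply: le_trans (M_tay _ _) _; [nat_lia|nat_lia|].
    by rewrite ler_wpM2l ?mulr_ge0 ?exprn_ge0// lef_pV2 ?posrE ?ltr0n ?ler_nat; nat_lia.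
  by apply: sumc; rewrite mulr_ge0 ?exprn_ge0.
have b3 : `|H%:R * \sum_(n0.+1 <= n < n1.+1) E3 n| <= 4 * (B ^+ 2 * H%:R ^+ 2).
  rewrite normrM normr_nat.
  apply: (@le_trans _ _ (H%:R * (4 * B ^+ 2))); last first.
    rewrite mulrC -mulrA ler_wpM2l// ler_wpM2l ?exprn_ge0// -natrX ler_nat.
    by case: (H) => // h; rewrite expnS expn1 leq_pmulr.
  rewrite ler_wpM2l//; apply: le_trans (ler_norm_sum _ _ _) _.
  apply: (@le_trans _ _ (\sum_(n0.+1 <= n < n1.+1) 2 * B ^+ 2 / n0%:R)).
    rewrite big_nat_cond [leRHS]big_nat_cond; apply: ler_sum => n /andP[nn' _].
    have nn := rng _ nn'; rewrite /E3 normrM (_ : 2 * _ / _ = 2 * (B / n0%:R) * B); last by ring.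
    apply: ler_pM => //; last exact: Q_bd.
    case: n nn nn' => // n nn nn' /=.
    have np : (0 < n)%N by nat_lia.
    have h1 := M_tay (h := 1) np; rewrite addn1 in h1; have {}h1 := h1 ltac:(nat_lia).
    have h2 := Q_lip (n := n) ltac:(nat_lia).
    have h3 : B / n%:R <= B / n0%:R.
      by rewrite ler_wpM2l// lef_pV2 ?posrE ?ltr0n// ler_nat; nat_lia.
    rewrite expr1n mulr1 mul1r in h1.
    move: h1 h2; rewrite !ler_norml => /andP[h4 h5] /andP[h6 h7].
    by apply/andP; split; lra.
  by apply: le_trans (sumc _ _) _; [rewrite mulr_ge0 ?exprn_ge0|lra].
have b4 : `|H%:R * \sum_(n0.+1 <= n < n1.+1) E4 n| <= 7 * (B ^+ 2 * W) + 6 * (B ^+ 2 * H%:R ^+ 2).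
  (* Summation by parts moves the difference from $\Delta$ to $Q$, which varies by only $B/n$ per
     step; the factor [H] is then paid by $H\le n_0$. *)
  have abel : \sum_(n0.+1 <= n < n1.+1) E4 n = Dl n1 * Q n1%:R - Dl n0 * Q n0%:R
      - \sum_(n0 <= n < n1) Dl n * (Q n.+1%:R - Q n%:R).
    rewrite (big_add1 _ _ n0 n1.+1) /=.
    rewrite -(telescope_sumr (fun n => Dl n * Q n%:R) n01) -sumrB.
    by apply: eq_bigr => n _; rewrite /E4 /=; ring.
  have hQ1 := Q_bd (n := n1) ltac:(nat_lia); have hQ0 := Q_bd (n := n0) ltac:(nat_lia).
  have e1 := @endpoint_bound n1 ltac:(nat_lia) n1_le.
  have e0 := @endpoint_bound n0 n0_gt0 ltac:(nat_lia).
  have t1 : H%:R * `|Dl n1 * Q n1%:R| <= B * (W + 3 * B * H%:R ^+ 2).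
    rewrite normrM mulrA mulrC; apply: ler_pM => //; by rewrite mulr_ge0.
  have t0 : H%:R * `|Dl n0 * Q n0%:R| <= B * (W + 3 * B * H%:R ^+ 2).
    rewrite normrM mulrA mulrC; apply: ler_pM => //; by rewrite mulr_ge0.
  have t2 : H%:R * `|\sum_(n0 <= n < n1) Dl n * (Q n.+1%:R - Q n%:R)| <= B * W.
    apply: (@le_trans _ _ (n0%:R * (B / n0%:R * W))); last first.
      by rewrite mulrA [n0%:R * _]mulrC divfK ?gt_eqF.
    apply: ler_pM => //; first by rewrite ler_nat.
    apply: le_trans (ler_norm_sum _ _ _) _.
    apply: (@le_trans _ _ (\sum_(n0 <= n < n1) (B / n0%:R) * `|Dl n|)).
      rewrite big_nat_cond [leRHS]big_nat_cond; apply: ler_sum => n /andP[nn _].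
      rewrite normrM mulrC; apply: ler_pM => //.
      apply: le_trans (Q_lip _) _; first nat_lia.
      by rewrite ler_wpM2l// lef_pV2 ?posrE ?ltr0n// ?ler_nat; nat_lia.
    rewrite -mulr_sumr ler_wpM2l ?divr_ge0//; apply: W_ge_range => //; nat_lia.
  rewrite abel normrM normr_nat.
  apply: (@le_trans _ _ (H%:R * (`|Dl n1 * Q n1%:R| + `|Dl n0 * Q n0%:R|
     + `|\sum_(n0 <= n < n1) Dl n * (Q n.+1%:R - Q n%:R)|))).
    rewrite ler_wpM2l//; apply: le_trans (ler_normB _ _) _; rewrite lerD2r.
    exact: ler_normB.
  rewrite !mulrDr.
  have BW := hB W W W0 (lexx _).
  have BW2 : 0 <= B ^+ 2 * W by rewrite mulr_ge0 ?exprn_ge0.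
  have BW3 : B * (W + 3 * B * H%:R ^+ 2) = B * W + 3 * (B ^+ 2 * H%:R ^+ 2) by ring.
  rewrite BW3 in t1 t0; lra.
apply: le_trans (ler_normD _ _) _.
apply: le_trans (lerD (ler_normD _ _) (ler_normD _ _)) _.
have BW2 : 0 <= B ^+ 2 * W by rewrite mulr_ge0 ?exprn_ge0.
have BH2 : 0 <= B ^+ 2 * H%:R ^+ 2 by rewrite mulr_ge0 ?exprn_ge0.
rewrite -mulrA mulrDr; lra.
Qed.

End DiscreteArgument.

(** * Derivative and Taylor estimates for the main term *)

Section MainTermEstimates.
Variable R : realType.
Local Notation C := (Cx R).

(** The $m$-th term of the exponential series at $\varepsilon\log y$ is at most $y^\varepsilon$. *)
Lemma pow_ln_bound (m : nat) (eps : R) : 0 < eps -> exists2 K : R, 0 <= K &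
  forall y : R, 1 <= y -> ln y ^+ m <= K * y `^ eps.
Proof.
move=> e0; exists (m`!%:R / eps ^+ m).
  by rewrite divr_ge0 ?exprn_ge0 ?(ltW e0).
move=> y y1; have y0 : 0 < y := lt_le_trans ltr01 y1.
have l0 : 0 <= ln y by rewrite ln_ge0.
have f0 : 0 < m`!%:R :> R by rewrite ltr0n fact_gt0.
have em : 0 < eps ^+ m by rewrite exprn_gt0.
have : (eps * ln y) ^+ m / m`!%:R <= expR (eps * ln y).
  case: (m) => [|n]; first by rewrite expr0 divr1 -expR0 ler_expR mulr_ge0 ?(ltW e0).
  have := @expR_ge1Dxn _ (eps * ln y) n (mulr_ge0 (ltW e0) l0).
  by apply: le_trans; rewrite lerDr ler01.
rewrite /powR gt_eqF// ler_pdivrMr// exprMn => h.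
by rewrite mulrAC ler_pdivlMr// mulrC [leRHS]mulrC.
Qed.

Lemma tpolyS n (x : R) : tpoly n.+1 x = x * (ln x ^+ n.+1 / n.+1`!%:R) - tpoly n x.
Proof.
rewrite /tpoly big_nat_recr//= subnn expr0 mulr1 mulrDr addrC; congr (_ + _).
rewrite -mulrN -sumrN; congr (_ * _); rewrite !big_nat; apply: eq_bigr => l /andP[_ ln].
by rewrite -mulrN subSn// exprS mulN1r.
Qed.

(** The derivative of $x\log^{n+1}x/(n+1)!$ has a second term $\log^nx/n!$, which the summand
    [- tpoly n] in [tpolyS] cancels. *)
Lemma is_derive_tpoly n (x : R) : 0 < x -> is_derive x 1 (tpoly n) (ln x ^+ n / n`!%:R).
Proof.
move=> x0; elim: n => [|n ih].
  have -> : tpoly 0 = @id R.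
    by apply/funext => y; rewrite /tpoly big_nat1 !expr0 !mulr1 divr1 mulr1.
  by rewrite expr0 divr1; exact: is_derive_id.
have dl := is_derive1_ln x0.
have f0 : n`!%:R != 0 :> R by rewrite pnatr_eq0 -lt0n fact_gt0.
have n0 : n.+1%:R != 0 :> R by rewrite pnatr_eq0.
have -> : tpoly n.+1 = (@id R * (n.+1`!%:R^-1 *: (@ln R) ^+ n.+1)) - tpoly n.
  apply/funext => y; rewrite tpolyS !fctE [_ / _]mulrC; congr (_ * _ - _).
have d1 := is_deriveZ n.+1`!%:R^-1 (is_deriveX n.+1 dl).
have d2 := is_deriveB (is_deriveM (is_derive_id x 1) d1) ih.
apply: (is_derive_eq d2); rewrite /= factS natrM.
rewrite !fctE exprS.
move: n.+1%:R n0 n`!%:R f0 => u u0 v v0.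
have x0' : x != 0 by rewrite gt_eqF.
by rewrite /GRing.scale /=; field; rewrite u0 v0 x0'.
Qed.

Lemma is_derive_lincomb (A : nat -> R) (f : nat -> R -> R) (df : nat -> R) (x : R) n :
  (forall i, is_derive x 1 (f i) (df i)) ->
  is_derive x 1 (fun y => \sum_(0 <= i < n) A i * f i y) (\sum_(0 <= i < n) A i * df i).
Proof.
move=> h; elim: n => [|n ih].
  rewrite big_geq//; under [X in is_derive _ _ X _]eq_fun do rewrite big_geq//.
  exact: is_derive_cst.
rewrite big_nat_recr//=.
have -> : (fun y => \sum_(0 <= i < n.+1) A i * f i y)
        = (fun y => \sum_(0 <= i < n) A i * f i y) + A n *: f n.
  by apply/funext => y; rewrite big_nat_recr.
exact: is_deriveD ih (is_deriveZ _ (h n)).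
Qed.

Definition Mterm (k : nat) (x : R) : R :=
  complex.Re (Res (fun s : C => zeta s ^+ k * cpow x s / s) 1).

(** The Lipschitz bound comes from that of powers of the logarithm and $\log y-\log x\le(y-x)/x$.
    The Taylor bound is the mean value theorem for $M$, followed by the Lipschitz bound for $Q=M'$
    in place of a second derivative. *)
Lemma Mterm_estimates (k : nat) (eps : R) : 0 < eps -> exists2 K : R, 1 <= K &
  [/\ forall x, 1 <= x -> `|Qk k.+1 x 1| <= K * x `^ eps,
      forall x y, 1 <= x -> x <= y ->
        `|Qk k.+1 y 1 - Qk k.+1 x 1| <= K * y `^ eps * (y - x) / x &
      forall x y, 1 <= x -> x <= y ->
        `|Mterm k.+1 y - Mterm k.+1 x - (y - x) * Qk k.+1 x 1|
          <= K * y `^ eps * (y - x) ^+ 2 / x].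
Proof.
move=> e0; have [A hA] := main_formula R k.
have [K1 K11 hK1] := Qk_bound k e0.
have /choice[Kl hKl] m : exists K : R, 0 <= K /\ forall y : R, 1 <= y -> ln y ^+ m <= K * y `^ eps.
  by have [K K0 hK] := pow_ln_bound m e0; exists K.
pose K2 := \sum_(0 <= i < k.+1) `|A i| * ((k - i)%:R * Kl (k - i).-1 / (k - i)`!%:R).
have K20 : 0 <= K2.
  apply: sumr_ge0 => i _; have [h _] := hKl (k - i).-1.
  by rewrite !mulr_ge0// invr_ge0.
pose K := K1 + K2; have K0 : 0 <= K by rewrite addr_ge0// (le_trans ler01).
have lip (x y : R) : 1 <= x -> x <= y -> `|Qk k.+1 y 1 - Qk k.+1 x 1| <= K * y `^ eps * (y - x) / x.
  move=> x1 xy; have y1 := le_trans x1 xy.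
  have x0 : 0 < x := lt_le_trans ltr01 x1; have y0 : 0 < y := lt_le_trans ltr01 y1.
  have lx0 : 0 <= ln x by rewrite ln_ge0.
  have lxy : ln x <= ln y by rewrite ler_ln ?posrE.
  have lyx : ln y - ln x <= (y - x) / x.
    rewrite -ln_div ?posrE//; apply: le_trans (ln_le_subr1 _) _; first by rewrite divr_gt0.
    by rewrite mulrBl divff ?gt_eqF.
  rewrite (hA y y0).2 (hA x x0).2 -sumrB; apply: le_trans (ler_norm_sum _ _ _) _.
  apply: (@le_trans _ _ (K2 * (y `^ eps * ((y - x) / x)))); last first.
    rewrite -!mulrA ler_wpM2r ?mulr_ge0 ?powR_ge0 ?subr_ge0 ?invr_ge0 ?(ltW x0)//.
    by rewrite lerDr (le_trans ler01).
  rewrite /K2 mulr_suml; apply: ler_sum => i _.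
  rewrite -mulrBr normrM -mulrA ler_wpM2l// -mulrBl normrM normfV normr_nat.
  rewrite mulrAC ler_wpM2r ?invr_ge0//.
  rewrite ger0_norm; last by rewrite subr_ge0 lerXn2r ?nnegrE ?(le_trans lx0).
  apply: le_trans (subrXX_le _ lx0 lxy) _.
  rewrite -!mulrA ler_wpM2l// [leRHS]mulrA; apply: ler_pM => //.
  - by rewrite exprn_ge0 ?(le_trans lx0).
  - by rewrite subr_ge0.
  - by have [_] := hKl (k - i).-1; apply.
exists K; first by rewrite (le_trans K11)// lerDl.
split=> //.
- move=> x x1; have := hK1 x 1%N x1 isT; rewrite mul1r => /le_trans; apply.
  by rewrite ler_wpM2r ?powR_ge0// lerDl.
move=> x y x1; rewrite le_eqVlt => /orP[/eqP <-|xy].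
  by rewrite !subrr mul0r subrr normr0 expr0n /= mulr0 mul0r.
have x0 : 0 < x := lt_le_trans ltr01 x1.
have y0 : 0 < y := lt_trans x0 xy.
pose F x := \sum_(0 <= i < k.+1) A i * tpoly (k - i) x.
have dF (z : R) : 0 < z -> is_derive z 1 F (Qk k.+1 z 1).
  move=> z0; rewrite (hA z z0).2.
  by apply: is_derive_lincomb => i; exact: is_derive_tpoly.
have ME z : 0 < z -> Mterm k.+1 z = F z by move=> z0; rewrite /Mterm (hA z z0).1.
have [z||c] := @MVT _ F (fun z => Qk k.+1 z 1) x y xy.
- rewrite in_itv /= => /andP[xz _]; apply: dF; exact: lt_trans xz.
- apply: derivable_within_continuous => z; rewrite in_itv /= => /andP[xz _].
  have z0 : 0 < z by exact: lt_le_trans xz.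
  by have [] := dF z z0.
rewrite in_itv /= => /andP[xc cy] Fxy.
rewrite !ME// Fxy [X in X - _]mulrC -mulrBr normrM ger0_norm ?subr_ge0 ?(ltW xy)//.
have c1 : 1 <= c by exact: le_trans (ltW xc).
apply: le_trans (ler_wpM2l _ (lip x c x1 (ltW xc))) _; first by rewrite subr_ge0 ltW.
rewrite mulrA ler_wpM2r ?invr_ge0 ?(ltW x0)// mulrC expr2 mulrA ler_wpM2r ?subr_ge0 ?(ltW xy)//.
apply: ler_pM; rewrite ?mulr_ge0 ?powR_ge0 ?subr_ge0 ?(ltW xc)//.
  by rewrite ler_wpM2l// ge0_ler_powR ?nnegrE ?(ltW e0) ?(ltW cy)// ?(le_trans ler01 c1)// ltW.
by rewrite lerD2r ltW.
Qed.

Lemma Mterm_measurable (k : nat) : measurable_fun (`]0, +oo[%classic : set R) (Mterm k.+1).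
Proof.
have [A hA] := main_formula R k.
apply: (eq_measurable_fun (fun x => \sum_(0 <= i < k.+1) A i * tpoly (k - i) x)).
  by move=> x; rewrite inE /= in_itv /= andbT => x0; rewrite /Mterm (hA x x0).1.
apply: measurable_sum => i; apply: measurable_funM; first exact: measurable_cst.
apply: measurable_funM => //; apply: measurable_sum => l.
apply: measurable_funM => //; apply: measurable_funM => //.
by apply: measurable_funX; apply: measurable_funTS; exact: measurable_ln.
Qed.

(** Witnessed by $(n,1,\dots,1)$; it makes every jump of $D$ at least 1, as used in
    [beta_set_ge0]. *)
Lemma divk_gt0 k n : (0 < n)%N -> (0 < divk k.+1 n)%N.
Proof.
move=> n0; apply/card_gt0P.
have n1 : (1 < n.+1)%N by rewrite ltnS.
exists [ffun i : 'I_k.+1 => if i == ord0 then ord_max else Ordinal n1].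
rewrite !inE /=; apply/eqP; rewrite big_ord_recl ffunE eqxx /= big1 ?muln1// => i _.
by rewrite ffunE.
Qed.

End MainTermEstimates.

(** * Admissible exponents and moments of $\Delta_k$ at the integers *)

Section MeanSquare.
Variable R : realType.
Variable k : nat.
Local Notation mu := (@lebesgue_measure R).
Local Notation D n := (\sum_(1 <= i < n.+1) (divk k.+1 i)%:R : R).
Local Notation M := (@Mterm R k.+1).
Local Notation Dl := (@Delta R k.+1).

Lemma Delta_itv (n : nat) (x : R) : n%:R <= x < n.+1%:R -> Dl x = D n - M x.
Proof. by move=> h; rewrite /Delta (truncn_def h). Qed.

Lemma Delta_nat (n : nat) : Dl n%:R = D n - M n%:R.
Proof. by rewrite (@Delta_itv n)// lexx ltr_nat ltnSn. Qed.

Lemma Delta_measurable (E : set R) : measurable E -> E `<=` `]0, +oo[%classic ->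
  measurable_fun E Dl.
Proof.
move=> mE sE; apply: measurable_funB; last first.
  have := measurable_funS (measurable_itv _) sE (@Mterm_measurable R k).
  exact.
apply: nondecreasing_measurable => // x y xy.
have h : ((Num.truncn x).+1 <= (Num.truncn y).+1)%N by rewrite ltnS le_truncn.
by rewrite [leRHS](big_cat_nat (ltn0Sn _) h)//= lerDl sumr_ge0.
Qed.

Lemma sqDelta_measurable (E : set R) : measurable E -> E `<=` `]0, +oo[%classic ->
  measurable_fun E (fun x => (`|Dl x| ^+ 2)%:E).
Proof.
move=> mE sE; apply/measurable_EFinP; apply: measurable_funX.
by apply: measurableT_comp => //; exact: Delta_measurable.
Qed.

(** Half-open unit intervals are disjoint and $D$ is constant on each; a lower bound on a piece of
    one of them already bounds its share of the mean square. *)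
Lemma unit_integral_ge (n : nat) (a b c : R) : (0 < n)%N -> n%:R <= a -> a <= b ->
  b <= n.+1%:R -> 0 <= c -> (forall x, a < x < b -> c <= `|Dl x| ^+ 2) ->
  ((c * (b - a))%:E <= \int[mu]_(x in `[n%:R, n.+1%:R[) (`|Dl x| ^+ 2)%:E)%E.
Proof.
move=> n0 na ab bn c0 h; have n1 : 1 <= n%:R :> R by rewrite ler1n.
have sub : `]a, b[%classic `<=` `[n%:R, n.+1%:R[%classic.
  move=> x /=; rewrite !in_itv /= => /andP[ax xb].
  by rewrite (le_trans na (ltW ax)) (lt_le_trans xb bn).
have pos : (`[n%:R, n.+1%:R[%classic : set R) `<=` `]0, +oo[%classic.
  move=> x /=; rewrite !in_itv /= andbT => /andP[nx _].
  by rewrite (lt_le_trans ltr01)// (le_trans n1).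
apply: (@le_trans _ _ (\int[mu]_(x in `]a, b[) (`|Dl x| ^+ 2)%:E)%E); last first.
  by apply: ge0_subset_integral => //; exact: sqDelta_measurable.
apply: (@le_trans _ _ (\int[mu]_(x in `]a, b[) (cst c%:E x))%E).
  rewrite integral_cst//= lebesgue_measure_itv /= lte_fin; case: ltP => [_|ba].
    by rewrite -EFinB -EFinM.
  by rewrite mule0 lee_fin mulr_ge0_le0// subr_le0.
apply: ge0_le_integral => //.
by apply: sqDelta_measurable => //; exact: subset_trans pos.
Qed.

Lemma sum_le_sq_integral (v : nat -> R) (m : nat) :
  (forall n, (0 < n)%N ->
    ((v n)%:E <= \int[mu]_(x in `[n%:R, n.+1%:R[) (`|Dl x| ^+ 2)%:E)%E) ->
  ((\sum_(1 <= n < m.+1) v n)%:E <= \int[mu]_(x in `[1%R, m.+1%:R]) (`|Dl x| ^+ 2)%:E)%E.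
Proof.
move=> h; have F0 x : (0 <= (`|Dl x| ^+ 2)%:E)%E by rewrite lee_fin exprn_ge0.
apply: (@le_trans _ _ (\int[mu]_(x in `[1%R, m.+1%:R[) (`|Dl x| ^+ 2)%:E)%E); last first.
  apply: ge0_subset_integral => //.
  - apply: sqDelta_measurable => // x /=; rewrite !in_itv /= andbT => /andP[x1 _].
    exact: lt_le_trans x1.
  - by move=> x /=; rewrite !in_itv /= => /andP[-> /ltW].
elim: m => [|m ih]; first by rewrite big_geq// integral_ge0.
rewrite big_nat_recr//= EFinD.
have -> : `[1%R, m.+2%:R[%classic = `[1%R, m.+1%:R[ `|` `[m.+1%:R, m.+2%:R[ :> set R.
  rewrite -itv_bndbnd_setU// bnd_simp ?ler1n// ler_nat//.
rewrite ge0_integral_setU//=.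
- by apply: leeD => //; exact: h.
- apply: sqDelta_measurable; first exact: measurableU.
  move=> x /=; rewrite !in_itv /= andbT => -[/andP[x1 _]|/andP[x1 _]].
    exact: lt_le_trans x1.
  by apply: lt_le_trans x1; rewrite ltr0n.
- apply/disj_setPS => x /=; rewrite !in_itv /= => -[/andP[_ a] /andP[b _]].
  by move: (lt_le_trans a b); rewrite ltxx.
Qed.

Lemma Mterm_lip (eps : R) : 0 < eps -> exists2 K : R, 1 <= K &
  forall x y, 1 <= x -> x <= y -> y <= x + 1 -> `|M y - M x| <= K * y `^ eps * (y - x).
Proof.
move=> e0; have [K K1 [h1 _ h3]] := Mterm_estimates k e0.
have K0 := le_trans ler01 K1.
exists (2 * K) => [|x y x1 xy yx]; first by lra.
have x0 : 0 < x := lt_le_trans ltr01 x1.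
have yx0 : 0 <= y - x by rewrite subr_ge0.
have a1 := h3 x y x1 xy.
have a2 := h1 x x1.
have a3 : x `^ eps <= y `^ eps.
  by rewrite ge0_ler_powR ?nnegrE ?(ltW e0) ?(ltW x0)// (le_trans (ltW x0)).
have a4 : K * y `^ eps * (y - x) ^+ 2 / x <= K * y `^ eps * (y - x).
  rewrite ler_pdivrMr// -!mulrA ler_wpM2l// ler_wpM2l ?powR_ge0// expr2 ler_wpM2l//; lra.
have a5 : `|(y - x) * Qk k.+1 x 1| <= K * y `^ eps * (y - x).
  rewrite normrM (ger0_norm yx0) mulrC ler_wpM2r//.
  by apply: (le_trans a2); rewrite ler_wpM2l.
have := ler_normD (M y - M x - (y - x) * Qk k.+1 x 1) ((y - x) * Qk k.+1 x 1).
rewrite subrK; lra.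
Qed.

(** Convertible to membership in the set whose infimum is [beta], so that single exponents can be
    handled before the infimum. *)
Definition beta_set (b : R) : Prop := exists K : R, forall X : R, 1 <= X ->
    (\int[mu]_(x in `[1%R, X]) (`|Dl x| ^+ 2)%:E <= (K * X `^ (1 + 2 * b))%:E)%E.

Lemma beta_set_sum b (v : nat -> R) : beta_set b ->
  (forall n, (0 < n)%N ->
    ((v n)%:E <= \int[mu]_(x in `[n%:R, n.+1%:R[) (`|Dl x| ^+ 2)%:E)%E) ->
  exists2 K : R, 0 <= K & forall m : nat,
    \sum_(1 <= n < m.+1) v n <= K * m.+1%:R `^ (1 + 2 * b).
Proof.
move=> [K hK] hv; exists (Num.max 0 K); first by rewrite le_max lexx.
move=> m; have m1 : 1 <= m.+1%:R :> R by rewrite ler1n.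
have := le_trans (sum_le_sq_integral m hv) (hK _ m1); rewrite lee_fin => /le_trans; apply.
by rewrite ler_wpM2r ?powR_ge0// le_max lexx orbT.
Qed.

(** Suppose $b<0$. At each integer $D$ jumps by at least 1 while $M$ moves slowly, so
    $|\Delta|\ge1/4$ on a short interval on one side of it. These intervals have length of order
    $n^b$, and the mean square up to $m$ would be at least of order $m^{1+b}$, too large for
    $m^{1+2b}$. *)
Lemma beta_set_ge0 b : beta_set b -> 0 <= b.
Proof.
move=> hb; rewrite leNgt; apply/negP => b0.
have e0 : 0 < - b by rewrite oppr_gt0.
have [K K1 hK] := Mterm_lip e0; have K0 : 0 < K := lt_le_trans ltr01 K1.
pose L (n : nat) := K * n.+1%:R `^ (- b).
have pw (n : nat) : 1 <= n.+1%:R `^ (- b) :> R.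
  by rewrite -[leLHS](powRr0 n.+1%:R) ler_powR ?ler1n// ltW.
have L1 n : 1 <= L n by rewrite -[1]mulr1 ler_pM.
have L0 n : 0 < L n := lt_le_trans ltr01 (L1 n).
(* Over a distance [dl n] the main term moves by at most $1/4$. *)
pose dl n := (4 * L n)^-1.
have dl0 n : 0 < dl n by rewrite invr_gt0 mulr_gt0.
have dlL n : L n * dl n = 4^-1 by rewrite /dl invfM mulrCA divff ?mulr1 ?gt_eqF.
have dl1 n : dl n <= 1.
  by rewrite invf_le1 ?mulr_gt0//; have := L1 n; lra.
pose c : R := 4^-1 ^+ 2; have c0 : 0 < c by rewrite exprn_gt0.
(* [v n] stands for an interval to the right of $n$ where $\Delta\ge1/4$, [u n] for one to the left
   of $n+1$ where $\Delta\le-1/4$. The threshold $1/2$ splits a jump of height 1 evenly. *)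
pose v n := if 2^-1 <= Dl n%:R then c * dl n else 0.
pose u n := if Dl n.+1%:R < 2^-1 then c * dl n else 0.
have v0 n : 0 <= v n by rewrite /v; case: ifP => // _; rewrite mulr_ge0 ?(ltW c0) ?(ltW (dl0 n)).
have u0 n : 0 <= u n by rewrite /u; case: ifP => // _; rewrite mulr_ge0 ?(ltW c0) ?(ltW (dl0 n)).
have I0 (n : nat) : (0%:E <= \int[mu]_(x in `[n%:R, n.+1%:R[) (`|Dl x| ^+ 2)%:E)%E.
  by apply: integral_ge0 => x _; rewrite lee_fin exprn_ge0.
have S1 n : n.+1%:R = n%:R + 1 :> R by rewrite natr1.
have hv n : (0 < n)%N -> ((v n)%:E <= \int[mu]_(x in `[n%:R, n.+1%:R[) (`|Dl x| ^+ 2)%:E)%E.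
  move=> n0; rewrite /v; case: ifP => // Dn; have d1 := dl1 n; have d0 := dl0 n.
  have n1 : 1 <= n%:R :> R by rewrite ler1n.
  have -> : dl n = (n%:R + dl n) - n%:R by ring.
  apply: unit_integral_ge => //; rewrite ?(ltW c0)//  ?(S1 n); [lra|lra|] => x /andP[nx xd].
  have xn : n%:R <= x < n.+1%:R by rewrite (S1 n); apply/andP; split; lra.
  have lip := hK n%:R x n1 (ltW nx) ltac:(lra).
  have lip2 : K * x `^ (- b) * (x - n%:R) <= L n * dl n.
    apply: ler_pM; rewrite ?mulr_ge0 ?powR_ge0 ?(ltW K0)//; [lra| |lra].
    rewrite ler_wpM2l ?(ltW K0)// ge0_ler_powR ?nnegrE ?(ltW e0)//; [lra|rewrite (S1 n); lra].
  have Dx : 4^-1 <= Dl x.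
    move: Dn; rewrite Delta_nat (Delta_itv xn) => Dn.
    move: lip; rewrite dlL in lip2; rewrite ler_norml => /andP[_ ?]; lra.
  rewrite ger0_norm; last by lra.
  by rewrite lerXn2r ?nnegrE//; lra.
have hu n : (0 < n)%N -> ((u n)%:E <= \int[mu]_(x in `[n%:R, n.+1%:R[) (`|Dl x| ^+ 2)%:E)%E.
  move=> n0; rewrite /u; case: ifP => // Dn; have d1 := dl1 n; have d0 := dl0 n.
  have n1 : 1 <= n%:R :> R by rewrite ler1n.
  have -> : dl n = n.+1%:R - (n.+1%:R - dl n) by ring.
  apply: unit_integral_ge => //; rewrite ?(ltW c0)//  ?(S1 n); [lra|lra|] => x /andP[nx xd].
  have xn : n%:R <= x < n.+1%:R by rewrite (S1 n); apply/andP; split; lra.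
  have x1 : 1 <= x by lra.
  have lip := hK x n.+1%:R x1 ltac:(rewrite (S1 n); lra) ltac:(rewrite (S1 n); lra).
  have lip2 : K * n.+1%:R `^ (- b) * (n.+1%:R - x) <= L n * dl n.
    by rewrite ler_wpM2l ?(ltW (L0 n))// (S1 n); lra.
  have Dx : Dl x <= - 4^-1.
    move: Dn; rewrite Delta_nat (Delta_itv xn) big_nat_recr//= => Dn.
    have d1' : 1 <= (divk k.+1 n.+1)%:R :> R by rewrite ler1n divk_gt0.
    move: lip; rewrite dlL in lip2; rewrite ler_norml => /andP[? ?]; lra.
  rewrite ler0_norm; last by lra.
  by rewrite lerXn2r ?nnegrE//; lra.
have [A A0 hA] := beta_set_sum hb hv; have [B B0 hB] := beta_set_sum hb hu.
have dlM (n m : nat) : (n <= m)%N -> dl m <= dl n.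
  move=> nm; rewrite /dl lef_pV2 ?posrE ?mulr_gt0// ler_wpM2l// ler_wpM2l ?(ltW K0)//.
  by rewrite ge0_ler_powR ?nnegrE ?(ltW e0)// ler_nat.
(* At the integer $n+1$ exactly one of [v n.+1] and [u n] is nonzero. *)
have key m : (0 < m)%N -> m%:R * (c * dl m.+1) <= (A + B) * m.+2%:R `^ (1 + 2 * b).
  move=> m0; apply: (@le_trans _ _ (\sum_(1 <= n < m.+1) (v n.+1 + u n))).
    have -> : m%:R * (c * dl m.+1) = \sum_(1 <= n < m.+1) c * dl m.+1.
      by rewrite sumr_const_nat subSS subn0 mulr_natl.
    rewrite big_nat_cond [leRHS]big_nat_cond; apply: ler_sum => n /andP[/andP[_ nm] _].
    have d1 : c * dl m.+1 <= c * dl n.+1 by rewrite ler_wpM2l ?(ltW c0)// dlM.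
    have d2 : c * dl n.+1 <= c * dl n by rewrite ler_wpM2l ?(ltW c0)// dlM.
    apply: (le_trans d1); rewrite /v /u; case: leP => _; first by rewrite addr0.
    by rewrite add0r.
  rewrite big_split /= mulrDl; apply: lerD.
    apply: le_trans (hA m.+1); rewrite [leRHS]big_nat_recl//= lerDr//.
  apply: le_trans (hB m.+1); rewrite [leRHS]big_nat_recr//= lerDl//.
pose E := (A + B) * (4 * K / c).
have key2 m : (0 < m)%N -> m.+2%:R `^ (- b) <= 3 * E.
  move=> m0; have := key m m0; have m10 : 0 < m.+2%:R :> R by [].
  have P0 : 0 < m.+2%:R `^ (- b) :> R by rewrite powR_gt0.
  have -> : m.+2%:R `^ (1 + 2 * b) = m.+2%:R / (m.+2%:R `^ (- b)) ^+ 2 :> R.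
    rewrite powRD; last by apply/implyP => _; rewrite gt_eqF.
    rewrite powRr1// -powR_mulrn ?powR_ge0// -powRrM -powRN; congr (_ * _ `^ _).
    by ring.
  rewrite /dl /L => h.
  have m3 : m.+2%:R <= 3 * m%:R :> R by rewrite -natrM ler_nat; clear -m0; lia.
  have h2 : m%:R <= E * (m.+2%:R / m.+2%:R `^ (- b)).
    move: h; rewrite (_ : _ * (c * _) = m%:R / ((4 * K / c) * m.+2%:R `^ (- b))); last first.
      by field; rewrite !gt_eqF.
    rewrite ler_pdivrMr ?mulr_gt0 ?invr_gt0// => /le_trans; apply.
    move: (m.+2%:R `^ (- b)) P0 => P P0; move: m.+2%:R => M2.
    rewrite le_eqVlt; apply/orP; left; apply/eqP; rewrite /E; field.
    by rewrite !gt_eqF.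
  move: h2; rewrite mulrA ler_pdivlMr// => h2.
  rewrite -(ler_pM2l m10); apply: (@le_trans _ _ (3 * m%:R * m.+2%:R `^ (- b))).
    by rewrite ler_wpM2r ?(ltW P0).
  rewrite -mulrA [leRHS](_ : _ = 3 * (E * m.+2%:R)); last by ring.
  by rewrite ler_wpM2l.
have E0 : 0 <= E by rewrite mulr_ge0 ?addr_ge0 ?divr_ge0 ?mulr_ge0 ?(ltW K0) ?(ltW c0).
(* From [X] on the power with exponent $-b$ exceeds $3E$, against [key2]. *)
pose X := (3 * E + 1) `^ (- b)^-1.
have := key2 (Num.truncn X).+1 isT; apply/negP; rewrite -ltNge.
have XE : 3 * E + 1 = X `^ (- b).
  rewrite /X -powRrM mulVf ?gt_eqF// powRr1//.
  by move: E0; lra.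
apply: (@lt_le_trans _ _ (X `^ (- b))); first by rewrite -XE ltrDl.
rewrite ge0_ler_powR ?nnegrE ?(ltW e0) ?powR_ge0//.
apply: le_trans (ltW (truncnS_gt X)) _; rewrite ler_nat.
exact/leqW/leqW.
Qed.

(** For $n\le x<n+1$ the values $\Delta(n)$ and $\Delta(x)$ differ by $M(x)-M(n)$, at most $L_n$, so
    $\Delta(n)^2/2-L_n^2\le\Delta(x)^2$. The total of $L_n^2$ is $O(m^{1+\varepsilon})$, admissible
    because $b\ge0$. *)
Lemma mean_square_discrete (b eps : R) : beta_set b -> 0 < eps -> exists2 K : R, 0 <= K &
  forall m : nat, (0 < m)%N ->
    \sum_(1 <= n < m.+1) Dl n%:R ^+ 2 <= K * m%:R `^ (1 + 2 * b + eps).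
Proof.
move=> hb e0; have b0 := beta_set_ge0 hb.
have h0 : 0 < eps / 2 by rewrite divr_gt0.
have [K K1 hK] := Mterm_lip h0; have K0 : 0 < K := lt_le_trans ltr01 K1.
pose L (n : nat) := K * n.+1%:R `^ (eps / 2).
have L0 n : 0 <= L n by rewrite mulr_ge0 ?powR_ge0 ?(ltW K0).
have hv n : (0 < n)%N -> ((Dl n%:R ^+ 2 / 2 - L n ^+ 2)%:E
     <= \int[mu]_(x in `[n%:R, n.+1%:R[) (`|Dl x| ^+ 2)%:E)%E.
  move=> n0; set c := _ - _; have n1 : 1 <= n%:R :> R by rewrite ler1n.
  have [c0|c0] := leP c 0.
    apply: (@le_trans _ _ 0%E); first by rewrite lee_fin.
    by apply: integral_ge0 => x _; rewrite lee_fin exprn_ge0.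
  have -> : c = c * (n.+1%:R - n%:R) by rewrite -[n.+1%:R]natr1 addrAC subrr add0r mulr1.
  apply: unit_integral_ge => //; rewrite ?(ltW c0)//.
    by rewrite ler_nat.
  move=> x /andP[nx xn1].
  have xn : n%:R <= x < n.+1%:R by rewrite (ltW nx) xn1.
  have xn2 : x <= n%:R + 1 by rewrite natr1 ltW.
  have lip := hK n%:R x n1 (ltW nx) xn2.
  have lip2 : K * x `^ (eps / 2) * (x - n%:R) <= L n.
    rewrite -[leRHS]mulr1; apply: ler_pM; rewrite ?mulr_ge0 ?powR_ge0 ?(ltW K0) ?subr_ge0 ?(ltW nx)//.
      rewrite ler_wpM2l ?(ltW K0)// ge0_ler_powR ?nnegrE ?(ltW h0) ?(ltW xn1)//.
      by rewrite (le_trans ler01)// (le_trans n1)// ltW.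
    by rewrite lerBlDl.
  have := le_trans lip lip2; rewrite /c Delta_nat (Delta_itv xn).
  rewrite real_normK ?num_real//.
  move: (D n) (M x) (M n%:R) (L n) (L0 n) => p q r l l0 h.
  have h2 : (q - r) ^+ 2 <= l ^+ 2.
    by rewrite -[leLHS]real_normK ?num_real// lerXn2r ?nnegrE.
  (* This square encodes $(u+v)^2\le2u^2+2v^2$ with $u=\Delta(x)$ and $u+v=\Delta(n)$. *)
  have : 0 <= (2 * (p - q) - (p - r)) ^+ 2 by rewrite sqr_ge0.
  have -> : (2 * (p - q) - (p - r)) ^+ 2 = 2 * (p - q) ^+ 2 + 2 * (q - r) ^+ 2 - (p - r) ^+ 2 by ring.
  lra.
have [A A0 hA] := beta_set_sum hb hv.
pose c1 : R := 2 `^ (1 + 2 * b); pose c2 : R := (K * 2 `^ (eps / 2)) ^+ 2.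
have c10 : 0 <= c1 by rewrite powR_ge0.
have c20 : 0 <= c2 by rewrite exprn_ge0// mulr_ge0 ?powR_ge0 ?(ltW K0).
exists (2 * (A * c1) + 2 * c2); first by have := mulr_ge0 A0 c10; lra.
move=> m m0; have m1 : 1 <= m%:R :> R by rewrite ler1n.
have mp : 0 < m%:R :> R := lt_le_trans ltr01 m1.
have dbl (t : R) : 0 <= t -> m.+1%:R `^ t <= 2 `^ t * m%:R `^ t.
  move=> t0; rewrite -powRM// ?(ltW mp)// ge0_ler_powR ?nnegrE ?mulr_ge0 ?(ltW mp)//.
  by rewrite -natrM ler_nat; clear -m0; lia.
have := hA m; rewrite sumrB -mulr_suml => h.
have hL : \sum_(1 <= n < m.+1) L n ^+ 2 <= c2 * m%:R `^ (1 + eps).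
  apply: (@le_trans _ _ (\sum_(1 <= n < m.+1) c2 * m%:R `^ eps)).
    rewrite big_nat_cond [leRHS]big_nat_cond; apply: ler_sum => n /andP[/andP[_ nm] _].
    have -> : c2 * m%:R `^ eps = (K * (2 `^ (eps / 2) * m%:R `^ (eps / 2))) ^+ 2.
      rewrite mulrA exprMn -[X in _ = _ * X]powR_mulrn ?powR_ge0// -powRrM.
      by rewrite divfK.
    rewrite lerXn2r ?nnegrE ?mulr_ge0 ?powR_ge0 ?(ltW K0)//.
    rewrite ler_wpM2l ?(ltW K0)//; apply: le_trans (dbl _ (ltW h0)).
    by rewrite ge0_ler_powR ?nnegrE ?(ltW h0)// ler_nat.
  rewrite sumr_const_nat subSS subn0 -[leLHS]mulr_natl mulrCA ler_wpM2l//.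
  by rewrite powRD ?powRr1 ?(ltW mp)//; apply/implyP => _; rewrite gt_eqF.
have hP : m.+1%:R `^ (1 + 2 * b) <= c1 * m%:R `^ (1 + 2 * b + eps).
  have t0 : 0 <= 1 + 2 * b by lra.
  apply: le_trans (dbl _ t0) _; rewrite ler_wpM2l// ler_powR//; lra.
have hQ : m%:R `^ (1 + eps) <= m%:R `^ (1 + 2 * b + eps) :> R by rewrite ler_powR//; lra.
have hP' := ler_wpM2l A0 hP; have hQ' := ler_wpM2l c20 hQ.
move: (\sum_(1 <= n < m.+1) Dl n%:R ^+ 2) (\sum_(1 <= n < m.+1) L n ^+ 2) h hL => s1 s2 h hL.
move: (m%:R `^ (1 + 2 * b + eps)) (m.+1%:R `^ (1 + 2 * b)) (m%:R `^ (1 + eps)) h hL hP' hQ'.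
clearbody c1 c2 => p1 p2 p3 h hL hP' hQ'.
rewrite mulrDl -!mulrA; lra.
Qed.

(** Without an admissible exponent [inf] would return a default value. Crudely $|\Delta(x)|\le
    Ex^3$, and the square integrates to at most $E^2X^7$ with $7=1+2\cdot3$. *)
Lemma beta_set_nonempty : beta_set 3.
Proof.
have [K K1 [h1 _ h3]] := @Mterm_estimates R k 1 ltr01.
have [B B1 hB] := @divk_bound R k.+1 1 ltr01.
have K0 := le_trans ler01 K1; have B0 := le_trans ler01 B1.
pose E := B + `|M 1| + 2 * K.
have E0 : 0 <= E by rewrite !addr_ge0 ?mulr_ge0.
have Dx x : 1 <= x -> `|Dl x| <= E * x ^+ 3.
  move=> x1; have x0 := le_trans ler01 x1.
  have x13 : 1 <= x ^+ 3 by rewrite exprn_ege1.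
  have x23 : x ^+ 2 <= x ^+ 3 by rewrite ler_weXn2l.
  have x33 : x <= x ^+ 3 by rewrite -{1}[x]expr1 ler_weXn2l.
  have hD : `|\sum_(1 <= n < (Num.truncn x).+1) (divk k.+1 n)%:R : R| <= B * x ^+ 3.
    rewrite ger0_norm ?sumr_ge0//.
    have tx : (Num.truncn x)%:R <= x by rewrite truncn_le.
    apply: (@le_trans _ _ (\sum_(1 <= n < (Num.truncn x).+1) B * x)).
      rewrite big_nat_cond [leRHS]big_nat_cond; apply: ler_sum => n /andP[/andP[n0 nm] _].
      apply: le_trans (hB n n0) _; rewrite ler_wpM2l// powRr1//.
      by apply: le_trans tx; rewrite ler_nat.
    rewrite sumr_const_nat subSS subn0 -[leLHS]mulr_natl mulrCA ler_wpM2l//.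
    by apply: le_trans x23; rewrite expr2 ler_wpM2r.
  have hM : `|M x| <= (`|M 1| + 2 * K) * x ^+ 3.
    have a1 := h1 1 (lexx _); have a3 := h3 1 x (lexx _) x1.
    rewrite powR1 mulr1 in a1; rewrite powRr1// divr1 in a3.
    have a4 : `|(x - 1) * Qk k.+1 1 1| <= K * x ^+ 3.
      have xm : 0 <= x - 1 by rewrite subr_ge0.
      rewrite normrM (ger0_norm xm) mulrC; apply: ler_pM => //.
      by apply: le_trans x33; rewrite lerBlDr lerDl.
    have a5 : K * x * (x - 1) ^+ 2 <= K * x ^+ 3.
      rewrite -mulrA ler_wpM2l// [x ^+ 3]exprS ler_wpM2l// lerXn2r ?nnegrE ?subr_ge0//.
      by rewrite lerBlDr lerDl.
    have a6 : `|M 1| <= `|M 1| * x ^+ 3 by rewrite ler_peMr.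
    have := ler_normD (M x - M 1 - (x - 1) * Qk k.+1 1 1) (M 1 + (x - 1) * Qk k.+1 1 1).
    have := ler_normD (M 1) ((x - 1) * Qk k.+1 1 1).
    rewrite (_ : _ - _ + (_ + _) = M x); last by ring.
    by move=> b1 b2; rewrite [leRHS]mulrDl -[2 * K * _]mulrA; lra.
  apply: le_trans (ler_normB _ _) _; rewrite -/(Mterm _ _) /E -addrA mulrDl.
  exact: lerD.
exists (E ^+ 2) => X X1; have X0 := le_trans ler01 X1.
apply: (@le_trans _ _ (\int[mu]_(x in `[1%R, X]) (cst ((E * X ^+ 3) ^+ 2)%:E x))%E).
  apply: ge0_le_integral => //.
  - apply: sqDelta_measurable => // x /=; rewrite !in_itv /= andbT => /andP[x1 _].
    exact: lt_le_trans x1.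
  - move=> x /=; rewrite in_itv /= => /andP[x1 xX]; rewrite lee_fin.
    rewrite lerXn2r ?nnegrE ?mulr_ge0 ?exprn_ge0//; apply: le_trans (Dx x x1) _.
    by rewrite ler_wpM2l// lerXn2r ?nnegrE// (le_trans ler01).
rewrite integral_cst//= lebesgue_measure_itv /= lte_fin.
have -> : X `^ (1 + 2 * 3) = X * (X ^+ 3) ^+ 2.
  by rewrite (_ : 1 + 2 * 3 = 7%:R :> R); [rewrite powR_mulrn//; ring|ring].
case: ltP => h.
  rewrite -EFinB -EFinM lee_fin exprMn -mulrA ler_wpM2l ?exprn_ge0// mulrC.
  by rewrite ler_wpM2r ?exprn_ge0// lerBlDr lerDl.
by rewrite mule0 lee_fin mulr_ge0 ?exprn_ge0// mulr_ge0 ?exprn_ge0.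
Qed.

Lemma beta_ge0 : 0 <= beta R k.+1.
Proof.
apply: lb_le_inf; first by exists 3; exact: beta_set_nonempty.
by move=> b; exact: beta_set_ge0.
Qed.

(** The infimum need not be attained, so an admissible $b<\beta+\varepsilon/2$ is used.
    Cauchy-Schwarz takes the form $|\Delta|\le s+\Delta^2/s$ with $s=m^{b+\varepsilon/2}$. *)
Lemma first_moment_discrete (eps : R) : 0 < eps -> exists2 K : R, 1 <= K &
  forall m : nat, (0 < m)%N ->
    \sum_(1 <= n < m.+1) `|Dl n%:R| <= K * m%:R `^ (1 + beta R k.+1 + eps).
Proof.
move=> e0; have h0 : 0 < eps / 2 by rewrite divr_gt0.
have hinf : has_inf [set b | beta_set b].
  split; first by exists 3; exact: beta_set_nonempty.
  by exists 0 => b; exact: beta_set_ge0.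
have [b hb bb] := inf_adherent h0 hinf.
have b0 := beta_set_ge0 hb.
have [K K0 hK] := mean_square_discrete hb h0.
exists (1 + K) => [|m m0]; first by rewrite lerDl.
have m1 : 1 <= m%:R :> R by rewrite ler1n.
have mp : 0 < m%:R :> R := lt_le_trans ltr01 m1.
pose s := m%:R `^ (b + eps / 2) : R; have s0 : 0 < s by rewrite powR_gt0.
apply: (@le_trans _ _ (\sum_(1 <= n < m.+1) (s + Dl n%:R ^+ 2 / s))).
  apply: ler_sum => n _; move: (Dl n%:R) => x.
  rewrite -(ler_pM2r s0) mulrDl divfK ?gt_eqF// -[x ^+ 2]real_normK ?num_real//.
  have : 0 <= (s - `|x|) ^+ 2 by rewrite sqr_ge0.
  have : 0 <= `|x| * s by rewrite mulr_ge0 ?(ltW s0).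
  rewrite sqrrB; lra.
rewrite big_split /= sumr_const_nat subSS subn0 -mulr_suml mulrDl; apply: lerD.
  rewrite mul1r -[leLHS]mulr_natl /s -{1}[m%:R](powRr1 (ltW mp)) -powRD; last first.
    by apply/implyP => _; rewrite gt_eqF.
  by rewrite ler_powR//; move: bb; rewrite -/(beta R k.+1); lra.
rewrite ler_pdivrMr//; apply: le_trans (hK m m0) _; rewrite -mulrA ler_wpM2l//.
rewrite /s -powRD; last by apply/implyP => _; rewrite gt_eqF.
by rewrite ler_powR//; move: bb; rewrite -/(beta R k.+1); lra.
Qed.

End MeanSquare.

(** * Ramanujan sums summed over h *)

Section RamanujanSums.

Lemma ramanujan_sumE q h : (0 < q)%N ->
  ramanujan_sum q h = \sum_(d <- divisors q | (d %| h)%N) d%:Z * mobius (q %/ d).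
Proof.
move=> q0; rewrite /ramanujan_sum -[RHS]big_filter; apply: perm_big.
apply: uniq_perm; rewrite ?filter_uniq ?divisors_uniq// => d.
have g0 : (0 < gcdn h q)%N by rewrite gcdn_gt0 q0 orbT.
by rewrite mem_filter -!dvdn_divisors// dvdn_gcd.
Qed.

Lemma sum_dvdn d H : (0 < d)%N -> (\sum_(1 <= h < H.+1) (d %| h) = H %/ d)%N.
Proof.
move=> d0; elim: H => [|H ih]; first by rewrite big_geq// div0n.
by rewrite big_nat_recr//= ih divnS// addnC.
Qed.

Lemma sum_ramanujan q H : (0 < q)%N -> \sum_(1 <= h < H.+1) ramanujan_sum q h
  = \sum_(d <- divisors q) ((H %/ d) * d)%N%:Z * mobius (q %/ d).
Proof.
move=> q0; under eq_bigr do rewrite ramanujan_sumE// big_mkcond /=.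
rewrite exchange_big /= !big_seq; apply: eq_bigr => d; rewrite -dvdn_divisors// => dq.
have d0 := dvdn_gt0 q0 dq.
rewrite -(sum_dvdn H d0) PoszM -mulrA [RHS]mulrC.
rewrite [in RHS](_ : Posz (\sum_(1 <= h < H.+1) _) = \sum_(1 <= h < H.+1) (d %| h)%N%:Z); last first.
  by rewrite (big_morph Posz PoszD (erefl _)).
rewrite mulr_sumr; apply: eq_bigr => h _.
by case: (d %| h)%N; rewrite ?mulr1 ?mulr0.
Qed.

(** Write $\lfloor H/d\rfloor d=H-(H\bmod d)$. The part with $H$ vanishes since $\sum_{d\mid
    q}\mu(q/d)=0$ for $q>1$, and each remainder is below $d\le q$. *)
Lemma sum_ramanujan_le q H : (1 < q)%N ->
  `|\sum_(1 <= h < H.+1) ramanujan_sum q h| <= (q * tau q)%N%:Z.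
Proof.
move=> q1; have q0 := ltnW q1; rewrite sum_ramanujan//.
have -> : \sum_(d <- divisors q) (H %/ d * d)%N%:Z * mobius (q %/ d)
        = - \sum_(d <- divisors q) (H %% d)%N%:Z * mobius (q %/ d).
  apply/eqP; rewrite -subr_eq0 opprK -big_split /=; apply/eqP.
  rewrite (eq_bigr (fun d => H%:Z * mobius (q %/ d))).
    by rewrite -mulr_sumr sum_mobius_compl// mulr0.
  by move=> d _; rewrite -mulrDl -PoszD -divn_eq.
rewrite normrN; apply: le_trans (ler_norm_sum _ _ _) _.
apply: (@le_trans _ _ (\sum_(d <- divisors q) q%:Z)).
  rewrite !big_seq; apply: ler_sum => d; rewrite -dvdn_divisors// => dq.
  have d0 := dvdn_gt0 q0 dq.
  rewrite normrM -[leRHS]mulr1; apply: ler_pM => //; last exact: normr_mobius.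
  rewrite ger0_norm// lez_nat; apply: leq_trans (dvdn_leq q0 dq).
  exact/ltnW/ltn_pmod.
by rewrite big_const_seq count_predT /tau iter_addr_0 -mulr_natl natz -PoszM mulnC.
Qed.

Lemma tau_le_self n : (0 < n)%N -> (tau n <= n)%N.
Proof.
move=> n0; rewrite -[leqRHS](size_iota 1 n); apply: uniq_leq_size; first exact: divisors_uniq.
move=> d; rewrite -dvdn_divisors// mem_iota => dn.
by rewrite (dvdn_gt0 n0 dn) add1n ltnS dvdn_leq.
Qed.

(** A bound free of $q$: the divisors involved divide $h$, so there are at most $h$ of them, each at
    most $h$. It gives absolute convergence of the singular series for fixed $h$. *)
Lemma ramanujan_sum_le q h : (0 < q)%N -> (0 < h)%N -> `|ramanujan_sum q h| <= (h ^ 2)%N%:Z.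
Proof.
move=> q0 h0; rewrite /ramanujan_sum; have g0 : (0 < gcdn h q)%N by rewrite gcdn_gt0 h0.
apply: le_trans (ler_norm_sum _ _ _) _.
apply: (@le_trans _ _ (\sum_(d <- divisors (gcdn h q)) h%:Z)).
  rewrite !big_seq; apply: ler_sum => d; rewrite -dvdn_divisors// => dg.
  rewrite normrM -[leRHS]mulr1; apply: ler_pM => //; last exact: normr_mobius.
  rewrite ger0_norm// lez_nat dvdn_leq// (dvdn_trans dg) ?dvdn_gcdl//.
rewrite big_const_seq count_predT iter_addr_0 -mulr_natl natz -PoszM lez_nat.
rewrite expnS expn1 leq_mul2r; apply/orP; right.
apply: leq_trans (tau_mono h0 (dvdn_gcdl h q)) _; exact: tau_le_self.
Qed.

(** Crude in $H$ but free of $q$: the second input of the interpolation in [sterm_bound]. *)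
Lemma sum_ramanujan_le_cube q H : (0 < q)%N ->
  `|\sum_(1 <= h < H.+1) ramanujan_sum q h| <= (H ^ 3)%N%:Z.
Proof.
move=> q0; apply: le_trans (ler_norm_sum _ _ _) _.
apply: (@le_trans _ _ (\sum_(1 <= h < H.+1) (H ^ 2)%N%:Z)).
  rewrite big_nat_cond [leRHS]big_nat_cond; apply: ler_sum => h /andP[/andP[h0 hH] _].
  by apply: le_trans (ramanujan_sum_le q0 h0) _; rewrite lez_nat leq_sqr.
by rewrite sumr_const_nat subSS subn0 -mulr_natl natz -PoszM -expnS.
Qed.

End RamanujanSums.

(** * Convergence and average of the singular series *)

Section SingularSeries.
Variable R : realType.
Variable k : nat.
Local Notation mu := (@lebesgue_measure R).
Local Notation Q x := (@Qk R k.+1 x 1).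

Lemma normr_intr_le (z : int) (n : nat) : `|z| <= n%:Z -> `|z%:~R : R| <= n%:R.
Proof. by move=> h; rewrite -intr_norm (_ : n%:R = (n%:Z)%:~R :> R)// ler_int. Qed.

(** The sum telescopes against $q^{-e}/e$, by $e^t\ge1+t$ and $\log(n+2)-\log(n+1)\ge1/(n+2)$. *)
Lemma powR_sum_bound (e : R) : 0 < e -> exists2 Z : R, 0 <= Z &
  forall n, \sum_(1 <= q < n.+1) q%:R `^ (- (1 + e)) <= Z.
Proof.
move=> e0; exists (1 + e^-1); first by rewrite addr_ge0// invr_ge0 ltW.
move=> n; suff : \sum_(1 <= q < n.+2) q%:R `^ (- (1 + e)) <= 1 + e^-1 * (1 - n.+1%:R `^ (- e)) :> R.
  move=> h; apply: (@le_trans _ _ (\sum_(1 <= q < n.+2) q%:R `^ (- (1 + e)))).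
    by rewrite [leRHS]big_nat_recr//= lerDl powR_ge0.
  apply: (le_trans h); rewrite lerD2l ler_piMr ?invr_ge0 ?(ltW e0)//.
elim: n => [|n ih]; first by rewrite big_nat1 !powR1 subrr mulr0 addr0.
rewrite big_nat_recr//=; apply: le_trans (lerD ih (lexx _)) _.
have n10 : 0 < n.+1%:R :> R by []. have n20 : 0 < n.+2%:R :> R by [].
suff h : e * n.+2%:R `^ (- (1 + e)) <= n.+1%:R `^ (- e) - n.+2%:R `^ (- e) :> R.
  have := ler_wpM2l (_ : 0 <= e^-1) h; rewrite invr_ge0 (ltW e0) mulrA mulVf ?gt_eqF// mul1r => /(_ isT).
  lra.
have -> : n.+2%:R `^ (- (1 + e)) = n.+2%:R^-1 * n.+2%:R `^ (- e) :> R.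
  rewrite opprD powRD ?powR_inv1//; by apply/implyP => _; rewrite gt_eqF.
have -> : n.+1%:R `^ (- e) = n.+2%:R `^ (- e) * expR (e * (ln n.+2%:R - ln n.+1%:R)) :> R.
  by rewrite /powR !gt_eqF// -expRD; congr expR; ring.
rewrite -[X in _ - X]mulr1 -mulrBr mulrA mulrC ler_wpM2l ?powR_ge0//.
rewrite lerBrDl; apply: le_trans (expR_ge1Dx _); rewrite lerD2l ler_wpM2l ?(ltW e0)//.
exact: ln_succ_ge.
Qed.

Definition sterm (x : R) (h q : nat) : R :=
  (ramanujan_sum q h)%:~R / q%:R ^+ 2 * Qk k.+1 x q ^+ 2.

Lemma singular_seriesE x h :
  singular_series k.+1 x h = limn (fun n => \sum_(1 <= q < n.+1) sterm x h q).
Proof. by []. Qed.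

(** The second bound is the delicate one: with the estimate $q\,\tau(q)$ alone the exponent of $q$
    would be $-1+3e$, which is not summable. The condition $H\le x$ turns the competing bound $H^3$
    into a power of $x$. *)
Lemma sterm_bound (e : R) : 0 < e -> e <= 8^-1 -> exists2 K : R, 0 <= K &
  (forall (x : R) (h q : nat), 1 <= x -> (0 < h)%N -> (0 < q)%N ->
     `|sterm x h q| <= h%:R ^+ 2 * (K * x `^ (2 * e)) * q%:R `^ (- (1 + e))) /\
  (forall (x : R) (H q : nat), 1 <= x -> H%:R <= x -> (1 < q)%N ->
     `|\sum_(1 <= h < H.+1) sterm x h q| <= K * x `^ (14 * e) * q%:R `^ (- (1 + e))).
Proof.
move=> e0 e8; have [K1 K11 hK1] := Qk_bound k e0.
have [K2 K21 hK2] := tau_bound e0.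
have K10 := le_trans ler01 K11; have K20 := le_trans ler01 K21.
have hQ (x : R) (q : nat) : 1 <= x -> (0 < q)%N ->
    Qk k.+1 x q ^+ 2 <= K1 ^+ 2 * (q%:R `^ (2 * e) * x `^ (2 * e)).
  move=> x1 q0; rewrite -real_normK ?num_real// -powRM ?(le_trans ler01 x1)//.
  rewrite [2 * e]mulrC powRrM powR_mulrn ?powR_ge0// -exprMn lerXn2r ?nnegrE//.
    by rewrite mulr_ge0 ?powR_ge0.
  exact: hK1.
have qV (q : nat) : (0 < q)%N -> (q%:R ^+ 2)^-1 = q%:R `^ (- 2) :> R.
  by move=> q0; rewrite powRN powR_mulrn.
have pD (q : nat) (s t : R) : (0 < q)%N -> q%:R `^ s * q%:R `^ t = q%:R `^ (s + t).
  by move=> q0; rewrite powRD//; apply/implyP => _; rewrite pnatr_eq0 -lt0n.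
exists (K1 ^+ 2 * K2); first by rewrite mulr_ge0 ?exprn_ge0.
split=> [x h q x1 h0 q0|x H q x1 Hx q1].
  have q1 : 1 <= q%:R :> R by rewrite ler1n.
  rewrite /sterm normrM normrM normfV (ger0_norm (sqr_ge0 (q%:R : R))) (ger0_norm (sqr_ge0 (Qk _ _ _))).
  have c1 : `|(ramanujan_sum q h)%:~R : R| <= h%:R ^+ 2.
    by rewrite -natrX; apply: normr_intr_le; exact: ramanujan_sum_le.
  apply: (@le_trans _ _ (h%:R ^+ 2 / q%:R ^+ 2 * (K1 ^+ 2 * (q%:R `^ (2 * e) * x `^ (2 * e))))).
    apply: ler_pM; rewrite ?sqr_ge0 ?divr_ge0//; last exact: hQ.
    by rewrite ler_wpM2r ?invr_ge0 ?sqr_ge0.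
  rewrite qV// [leLHS](_ : _ = h%:R ^+ 2 * (K1 ^+ 2 * x `^ (2 * e)) * (q%:R `^ (- 2) * q%:R `^ (2 * e))); last by ring.
  rewrite pD//; apply: ler_pM; rewrite ?mulr_ge0 ?sqr_ge0 ?powR_ge0//.
    rewrite ler_wpM2l ?sqr_ge0// ler_wpM2r ?powR_ge0// ler_peMr ?sqr_ge0//.
  rewrite ler_powR//; lra.
have q0 := ltnW q1; have x0 := le_trans ler01 x1.
have xp : 0 < x := lt_le_trans ltr01 x1.
have q1R : 1 <= q%:R :> R by rewrite ler1n.
have qp : 0 < q%:R :> R by rewrite ltr0n.
pose c : R := (\sum_(1 <= h < H.+1) ramanujan_sum q h)%:~R.
have -> : \sum_(1 <= h < H.+1) sterm x h q = c / q%:R ^+ 2 * Qk k.+1 x q ^+ 2.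
  by rewrite /c rmorph_sum /= !mulr_suml.
have c1 : `|c| <= K2 * q%:R `^ (1 + e).
  apply: (@le_trans _ _ ((q * tau q)%:R)).
    by apply: normr_intr_le; exact: sum_ramanujan_le.
  rewrite natrM -pD// powRr1 ?(ltW qp)// mulrCA ler_wpM2l//; exact: hK2.
have c2 : `|c| <= x ^+ 3.
  apply: (@le_trans _ _ ((H ^ 3)%:R)).
    by apply: normr_intr_le; exact: sum_ramanujan_le_cube.
  by rewrite natrX lerXn2r ?nnegrE.
(* With this value the exponent of $q$ becomes $(1+e)(1-4e)-2+2e=-1-e-4e^2$, below $-(1+e)$. The
   price is $(x^3)^{4e}=x^{12e}$. *)
pose eta := 4 * e.
have eta0 : 0 < eta by rewrite mulr_gt0.
(* The two bounds for the sum over h are interpolated: |c| <= a^(1-eta) b^eta. *)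
have c3 : `|c| <= K2 * q%:R `^ ((1 + e) * (1 - eta)) * x `^ (12 * e).
  have [->|cn] := eqVneq `|c| 0; first by rewrite !mulr_ge0 ?powR_ge0.
  have cp : 0 < `|c| by rewrite lt_def cn normr_ge0.
  have -> : `|c| = `|c| `^ (1 - eta) * `|c| `^ eta.
    rewrite -powRD; last by apply/implyP.
    by rewrite subrK powRr1.
  have et1 : 0 <= 1 - eta by rewrite /eta; lra.
  apply: ler_pM; rewrite ?powR_ge0//.
    apply: (@le_trans _ _ ((K2 * q%:R `^ (1 + e)) `^ (1 - eta))).
      by rewrite ge0_ler_powR ?nnegrE ?mulr_ge0 ?powR_ge0.
    rewrite powRM ?powR_ge0// -powRrM ler_wpM2r ?powR_ge0//.
    rewrite -[leRHS](powRr1 K20) ler_powR// /eta; lra.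
  apply: (@le_trans _ _ ((x ^+ 3) `^ eta)).
    by rewrite ge0_ler_powR ?nnegrE ?exprn_ge0 ?(ltW eta0).
  by rewrite -powR_mulrn// -powRrM (_ : 3%:R * eta = 12 * e :> R)//; rewrite /eta; ring.
rewrite normrM normrM normfV (ger0_norm (sqr_ge0 (q%:R : R))) (ger0_norm (sqr_ge0 (Qk _ _ _))).
apply: (@le_trans _ _ (K2 * q%:R `^ ((1 + e) * (1 - eta)) * x `^ (12 * e) / q%:R ^+ 2
    * (K1 ^+ 2 * (q%:R `^ (2 * e) * x `^ (2 * e))))).
  apply: ler_pM; rewrite ?sqr_ge0 ?divr_ge0//; last exact: hQ.
  by rewrite ler_wpM2r ?invr_ge0 ?sqr_ge0.
rewrite qV// [leLHS](_ : _ = K1 ^+ 2 * K2 * (x `^ (12 * e) * x `^ (2 * e))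
   * (q%:R `^ ((1 + e) * (1 - eta)) * q%:R `^ (- 2) * q%:R `^ (2 * e))); last by ring.
rewrite !pD// -powRD; last by apply/implyP => _; rewrite gt_eqF.
rewrite (_ : 12 * e + 2 * e = 14 * e); last by ring.
rewrite ler_wpM2l ?mulr_ge0 ?exprn_ge0 ?powR_ge0// ler_powR//.
have : 0 <= e * eta by rewrite mulr_ge0 ?(ltW e0) ?(ltW eta0).
rewrite /eta; lra.
Qed.

(** [singular_series] is a [limn], meaningful only once convergence is known. The exponent $1/8$ is
    one admissible choice in [sterm_bound]. *)
Lemma sterm_cvg (x : R) (h : nat) : 1 <= x -> (0 < h)%N ->
  (fun n => \sum_(1 <= q < n.+1) sterm x h q) @ \oo --> singular_series k.+1 x h.
Proof.
move=> x1 h0; have e0 : 0 < 8^-1 :> R by [].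
have [K K0 [hK _]] := sterm_bound e0 (lexx _).
have [Z Z0 hZ] := powR_sum_bound e0.
rewrite singular_seriesE.
have -> : (fun n => \sum_(1 <= q < n.+1) sterm x h q) = series (fun q => sterm x h q.+1).
  by apply/funext => n; rewrite big_add1.
apply: normed_cvg; apply: nondecreasing_is_cvgn.
  move=> m n mn; rewrite -subr_ge0 sub_series_geq// sumr_ge0// => i _.
  by rewrite /= normr_ge0.
pose A := h%:R ^+ 2 * (K * x `^ (2 * 8^-1)).
have A0 : 0 <= A by rewrite !mulr_ge0 ?sqr_ge0 ?powR_ge0.
exists (A * Z) => _ [n _ <-].
apply: le_trans (ler_wpM2l A0 (hZ n)); rewrite mulr_sumr big_add1 /series /=.
by apply: ler_sum => i _; exact: hK.
Qed.

(** Since $c_1(h)=1$, the terms with $q=1$ add up to $HQ_k(x,1)^2$. The rest is bounded in every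
    partial sum over $q$, after exchanging the two finite sums, and the bound passes to the
    limit. *)
Lemma sum_singular_series (e : R) : 0 < e -> e <= 8^-1 -> exists2 K : R, 0 <= K &
  forall (x : R) (H : nat), 1 <= x -> H%:R <= x ->
    `|\sum_(1 <= h < H.+1) singular_series k.+1 x h - H%:R * Q x ^+ 2| <= K * x `^ (14 * e).
Proof.
move=> e0 e8; have [K K0 [_ hK]] := sterm_bound e0 e8.
have [Z Z0 hZ] := powR_sum_bound e0.
exists (K * Z); first exact: mulr_ge0.
move=> x H x1 Hx.
have cv : (fun n => \sum_(1 <= h < H.+1) \sum_(1 <= q < n.+1) sterm x h q - H%:R * Q x ^+ 2)
    @ \oo --> \sum_(1 <= h < H.+1) singular_series k.+1 x h - H%:R * Q x ^+ 2.
  apply: cvgB; last exact: cvg_cst.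
  elim: H {Hx} => [|H ih].
    rewrite big_geq//; under eq_cvg do rewrite big_geq//.
    exact: cvg_cst.
  rewrite big_nat_recr//=; under eq_cvg do rewrite big_nat_recr//=.
  by apply: cvgD => //; exact: sterm_cvg.
have bd n : `|\sum_(1 <= h < H.+1) \sum_(1 <= q < n.+2) sterm x h q - H%:R * Q x ^+ 2|
    <= K * Z * x `^ (14 * e).
  rewrite exchange_big /= big_ltn//.
  have -> : \sum_(1 <= h < H.+1) sterm x h 1 = H%:R * Q x ^+ 2.
    rewrite (eq_bigr (fun=> Q x ^+ 2)).
      by rewrite sumr_const_nat subSS subn0 mulr_natl.
    move=> h _; rewrite /sterm expr1n divr1 (_ : ramanujan_sum 1 h = 1) ?mul1r//.
    by rewrite /ramanujan_sum gcdn1 big_seq1.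
  rewrite addrAC subrr add0r; apply: le_trans (ler_norm_sum _ _ _) _.
  apply: (@le_trans _ _ (\sum_(1 <= q < n.+2) K * x `^ (14 * e) * q%:R `^ (- (1 + e)))).
    rewrite [leRHS]big_ltn//= -[leLHS]add0r; apply: lerD.
      by rewrite !mulr_ge0 ?powR_ge0.
    rewrite big_nat_cond [leRHS]big_nat_cond; apply: ler_sum => q /andP[/andP[q1 _] _].
    exact: hK.
  by rewrite -mulr_sumr [K * Z * _]mulrAC ler_wpM2l ?mulr_ge0 ?powR_ge0.
(* If the limit exceeded the bound, so would a late partial sum; the index [n0.+1] makes sure that
   it contains $q=1$. *)
rewrite leNgt; apply/negP => lt; set L := _ - _ in cv lt.
have d0 : 0 < `|L| - K * Z * x `^ (14 * e) by rewrite subr_gt0.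
have /cvgrPdist_lt/(_ _ d0)[n0 _ h] := cv.
have := h n0.+1 (leqnSn n0) => /=; have := bd n0.
set S := (X in `|X|); move=> b1 b2.
have := ler_normD (L - S) S; rewrite subrK; lra.
Qed.

Lemma singular_series_measurable (h : nat) (E : set R) : (0 < h)%N -> measurable E ->
  E `<=` `[1%R, +oo[%classic -> measurable_fun E (fun x => singular_series k.+1 x h).
Proof.
move=> h0 mE sE.
apply: (@measurable_fun_cvg _ _ _ _ (fun n x => \sum_(1 <= q < n.+1) sterm x h q)).
  move=> n; apply: measurable_sum => q; apply: measurable_funM => //.
  by apply: measurable_funX; apply: measurable_funTS; exact: Qk_measurable.
move=> x /sE /=; rewrite in_itv /= andbT => x1; exact: sterm_cvg.
Qed.

(** Supplies integrability over a bounded interval, for which a crude dependence on [h] is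
    harmless. *)
Lemma singular_series_bounded (h : nat) (N : R) : (0 < h)%N -> 1 <= N ->
  exists B : R, forall x, 1 <= x -> x <= N -> `|singular_series k.+1 x h| <= B.
Proof.
move=> h0 N1; have e0 : 0 < 8^-1 :> R by [].
have [K K0 [hK _]] := sterm_bound e0 (lexx _).
have [Z Z0 hZ] := powR_sum_bound e0.
pose A := h%:R ^+ 2 * (K * N `^ (2 * 8^-1)).
have A0 : 0 <= A by rewrite !mulr_ge0 ?sqr_ge0 ?powR_ge0.
exists (A * Z + 1) => x x1 xN; set L := singular_series _ _ _.
have /cvgrPdist_lt/(_ _ ltr01)[n0 _ hn] := sterm_cvg x1 h0.
have := hn n0 (leqnn _) => /=; rewrite -/L; set S := (X in `|_ - X|) => b1.
have b2 : `|S| <= A * Z.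
  apply: le_trans (ler_norm_sum _ _ _) _; apply: le_trans (ler_wpM2l A0 (hZ n0)).
  rewrite mulr_sumr big_nat_cond [leRHS]big_nat_cond.
  apply: ler_sum => q /andP[/andP[q0 _] _]; apply: le_trans (hK x h q x1 h0 q0) _.
  rewrite ler_wpM2r ?powR_ge0// ler_wpM2l ?sqr_ge0// ler_wpM2l//.
  have x0 := le_trans ler01 x1; have N0 := le_trans ler01 N1.
  by rewrite ge0_ler_powR ?nnegrE ?divr_ge0.
have := ler_normD (L - S) S; rewrite subrK; lra.
Qed.

End SingularSeries.

(** * Integrals over bounded intervals *)

Section IntervalIntegrals.
Variable R : realType.
Local Notation mu := (@lebesgue_measure R).
Implicit Types (f : R -> R) (a b c B : R).

Lemma bounded_itv_integrable f a b B : measurable_fun `[a, b] f ->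
  (forall x, a <= x <= b -> `|f x| <= B) -> mu.-integrable `[a, b] (EFin \o f).
Proof.
move=> mf hB; apply: measurable_bounded_integrable => //.
  by rewrite /= lebesgue_measure_itv /=; case: ifP => _; rewrite ?ltry// -EFinB ltry.
exists B; split; first exact: num_real.
move=> M BM x /=; rewrite in_itv /= => /hB h; exact: le_trans h (ltW BM).
Qed.

Lemma normr_Rintegral_itv_le f a b B : a <= b -> measurable_fun `[a, b] f ->
  (forall x, a <= x <= b -> `|f x| <= B) ->
  `|\int[mu]_(x in `[a, b]) f x| <= B * (b - a).
Proof.
move=> ab mf hB; have fi := bounded_itv_integrable mf hB.
apply: le_trans (le_normr_Rintegral _ fi) _ => //.
have ci : mu.-integrable `[a, b] (EFin \o cst B).
  by apply: (bounded_itv_integrable (B := `|B|)) => //; exact: measurable_cst.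
have ai : mu.-integrable `[a, b] (EFin \o (fun x => `|f x|)).
  apply: (bounded_itv_integrable (B := B)); first exact: measurableT_comp.
  by move=> x /hB; rewrite normr_id.
apply: le_trans (le_Rintegral _ ai ci _) _ => //.
rewrite Rintegral_cst//= lebesgue_measure_itv /= lte_fin; case: ltP => h /=.
  by [].
by rewrite mulr0 mulr_ge0 ?subr_ge0// (le_trans (normr_ge0 (f a)))// hB// lexx.
Qed.

Lemma Rintegral_itv_add f a b c : a <= b -> b <= c ->
  mu.-integrable `[a, c] (EFin \o f) ->
  \int[mu]_(x in `[a, c]) f x = \int[mu]_(x in `[a, b]) f x + \int[mu]_(x in `[b, c]) f x.
Proof.
move=> ab bc fi.
have E : `[a, c]%classic = `[a, b[ `|` `[b, c] :> set R.
  by rewrite -itv_bndbnd_setU// bnd_simp.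
have i1 : mu.-integrable `[a, b[ (EFin \o f).
  by apply: integrableS fi => //; rewrite E; exact: subsetUl.
rewrite E Rintegral_setU//; last 2 first.
- by rewrite -E.
- apply/disj_setPS => x /=; rewrite !in_itv /= => -[/andP[_ u] /andP[v _]].
  by move: (lt_le_trans u v); rewrite ltxx.
by rewrite Rintegral_itv_bndo_bndc.
Qed.

(** Comparison with the sum over right endpoints, adding one unit interval at a time; [e] is the
    deviation from the right endpoint allowed on each. *)
Lemma integral_sum_close f (n0 j : nat) (B e : R) :
  measurable_fun (`[n0%:R, (n0 + j)%:R]%classic : set R) f ->
  (forall x, n0%:R <= x <= (n0 + j)%:R -> `|f x| <= B) ->
  (forall n x, (n0 <= n < n0 + j)%N -> n%:R <= x <= n.+1%:R -> `|f x - f n.+1%:R| <= e) ->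
  `|\int[mu]_(x in `[n0%:R, (n0 + j)%:R]) f x - \sum_(n0.+1 <= n < (n0 + j).+1) f n%:R|
    <= j%:R * e.
Proof.
elim: j => [|j ih] mf hB he.
  rewrite big_geq ?addn0// subr0 mul0r set_itv1 Rintegral_set1 normr0//.
have fi := bounded_itv_integrable mf hB.
have le1 : n0%:R <= (n0 + j)%:R :> R by rewrite ler_nat leq_addr.
have le2 : (n0 + j)%:R <= (n0 + j.+1)%:R :> R by rewrite ler_nat leq_add2l.
have s1 : `[n0%:R, (n0 + j)%:R]%classic `<=` (`[n0%:R, (n0 + j.+1)%:R]%classic : set R).
  by apply: subset_itvl; rewrite bnd_simp.
have s2 : `[(n0 + j)%:R, (n0 + j.+1)%:R]%classic `<=` (`[n0%:R, (n0 + j.+1)%:R]%classic : set R).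
  by apply: subset_itvr; rewrite bnd_simp.
rewrite (Rintegral_itv_add le1 le2 fi) addnS big_nat_recr//=; last by rewrite ltnS leq_addr.
set m := (n0 + j)%N in le1 le2 s1 s2 ih *.
have ih' : `|\int[mu]_(x in `[n0%:R, m%:R]) f x - \sum_(n0.+1 <= n < m.+1) f n%:R| <= j%:R * e.
  apply: ih.
  - by apply: measurable_funS mf.
  - by move=> x /andP[x1 x2]; apply: hB; rewrite x1 (le_trans x2).
  - by move=> n x /andP[n1 n2]; apply: he; rewrite n1 addnS ltnS ltnW.
rewrite addnS -/m in le2 s2 mf hB he fi *.
have mf2 : measurable_fun (`[m%:R, m.+1%:R]%classic : set R) f by apply: measurable_funS mf.
have fi2 : mu.-integrable `[m%:R, m.+1%:R] (EFin \o f) by apply: integrableS fi.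
have hlast : `|\int[mu]_(x in `[m%:R, m.+1%:R]) f x - f m.+1%:R| <= e.
  have ci : mu.-integrable `[m%:R, m.+1%:R] (EFin \o cst (f m.+1%:R)).
    by apply: (bounded_itv_integrable (B := `|f m.+1%:R|)) => //; exact: measurable_cst.
  have -> : \int[mu]_(x in `[m%:R, m.+1%:R]) f x - f m.+1%:R
     = \int[mu]_(x in `[m%:R, m.+1%:R]) (f x - cst (f m.+1%:R) x).
    rewrite RintegralB// Rintegral_cst//= lebesgue_measure_itv /= lte_fin ltr_nat ltnSn /=.
    by rewrite -natr1 addrAC subrr add0r mulr1.
  have := @normr_Rintegral_itv_le (fun x => f x - f m.+1%:R) m%:R m.+1%:R e le2.
  rewrite -[X in e * (X - _)]natr1 addrAC subrr add0r mulr1; apply.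
    by apply: measurable_funB => //; exact: measurable_cst.
  by move=> x xm; apply: he => //; rewrite ltnSn andbT leq_addr.
rewrite -[j.+1%:R]natr1 mulrDl mul1r opprD addrACA.
by apply: le_trans (ler_normD _ _) _; apply: lerD.
Qed.

Lemma Rintegral_itv_sum (f : nat -> R -> R) a b (H : nat) :
  (forall h, (0 < h)%N -> mu.-integrable `[a, b] (EFin \o f h)) ->
  mu.-integrable `[a, b] (EFin \o (fun x => \sum_(1 <= h < H.+1) f h x)) /\
  \int[mu]_(x in `[a, b]) \sum_(1 <= h < H.+1) f h x
   = \sum_(1 <= h < H.+1) \int[mu]_(x in `[a, b]) f h x.
Proof.
move=> fi; elim: H => [|H [ih1 ih2]].
  rewrite big_geq//; have -> : (fun x => \sum_(1 <= h < 1) f h x) = cst 0.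
    by apply/funext => x; rewrite big_geq.
  split; last by rewrite Rintegral_cst// mul0r.
  by apply: (bounded_itv_integrable (B := 0)) => [|x _]; [exact: measurable_cst|rewrite /= normr0].
have E : (fun x => \sum_(1 <= h < H.+2) f h x) = (fun x => \sum_(1 <= h < H.+1) f h x + f H.+1 x).
  by apply/funext => x; rewrite big_nat_recr.
rewrite big_nat_recr//= -ih2; split.
  have /(_ (measurable_itv _)) h := integrableD _ ih1 (fi H.+1 isT).
  by rewrite E; apply: eq_integrable h => // x _.
transitivity (\int[mu]_(x in `[a, b]) (\sum_(1 <= h < H.+1) f h x + f H.+1 x)).
  by apply: eq_Rintegral => x _; rewrite big_nat_recr.
by rewrite RintegralD//; exact: fi.
Qed.

End IntervalIntegrals.

(** * Passage to real N and H, and the final estimate *)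

Section Assembly.
Variable R : realType.
Variable k : nat.
Local Notation mu := (@lebesgue_measure R).
Local Notation Q x := (@Qk R k.+1 x 1).

Lemma singular_integral (e : R) : 0 < e -> e <= 8^-1 -> exists2 K : R, 0 <= K &
  forall (N : R) (H : nat), 1 <= N -> H%:R <= N ->
    `|\sum_(1 <= h < H.+1) \int[mu]_(x in `[N, 2 * N]) singular_series k.+1 x h
      - H%:R * \int[mu]_(x in `[N, 2 * N]) Q x ^+ 2| <= K * N `^ (1 + 14 * e).
Proof.
move=> e0 e8; have [K K0 hK] := sum_singular_series k e0 e8.
exists (K * 2 `^ (14 * e)); first by rewrite mulr_ge0 ?powR_ge0.
move=> N H N1 HN; have N0 : 0 < N := lt_le_trans ltr01 N1.
have N2 : N <= 2 * N by lra.
have N21 : 1 <= 2 * N by lra.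
have sub : `[N, 2 * N]%classic `<=` (`[1%R, +oo[%classic : set R).
  by move=> x /=; rewrite !in_itv /= andbT => /andP[/(le_trans N1)].
have Si h : (0 < h)%N -> mu.-integrable `[N, 2 * N] (EFin \o (fun x => singular_series k.+1 x h)).
  move=> h0; have [B hB] := singular_series_bounded k h0 N21.
  apply: (bounded_itv_integrable (B := B)); first exact: singular_series_measurable.
  by move=> x /andP[x1 x2]; apply: hB => //; exact: le_trans x1.
have [sumi <-] := Rintegral_itv_sum H Si.
have [K1 K11 [hQ _ _]] := Mterm_estimates k e0.
have Qm (E : set R) : measurable_fun E (fun x => Q x ^+ 2).
  by apply: measurable_funX; apply: measurable_funTS; exact: Qk_measurable.
have Qb (x : R) : N <= x <= 2 * N -> `|Q x ^+ 2| <= (K1 * (2 * N) `^ e) ^+ 2.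
  move=> /andP[x1 x2]; have x11 := le_trans N1 x1; have x0 := le_trans ler01 x11.
  rewrite normrX lerXn2r ?nnegrE ?mulr_ge0 ?powR_ge0 ?(le_trans ler01 K11)//.
  apply: le_trans (hQ x x11) _; rewrite ler_wpM2l ?(le_trans ler01 K11)//.
  by rewrite ge0_ler_powR ?nnegrE ?(ltW e0) ?(le_trans x0).
have Qi : mu.-integrable `[N, 2 * N] (EFin \o (fun x => Q x ^+ 2)).
  exact: bounded_itv_integrable Qb.
have HQm : measurable_fun (`[N, 2 * N]%classic : set R) (fun x => H%:R * Q x ^+ 2).
  by apply: measurable_funM => //; exact: measurable_cst.
have HQi : mu.-integrable `[N, 2 * N] (EFin \o (fun x => H%:R * Q x ^+ 2)).
  apply: (bounded_itv_integrable (B := H%:R * (K1 * (2 * N) `^ e) ^+ 2)) => // x xN.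
  by rewrite normrM normr_nat ler_wpM2l// Qb.
rewrite -RintegralZl// -RintegralB//.
have -> : K * 2 `^ (14 * e) * N `^ (1 + 14 * e) = K * (2 * N) `^ (14 * e) * (2 * N - N).
  rewrite powRD ?powRr1 ?(ltW N0)//; last by apply/implyP => _; rewrite gt_eqF.
  by rewrite powRM ?(ltW N0)//; ring.
apply: normr_Rintegral_itv_le => //.
  apply: measurable_funB => //.
  by apply/measurable_EFinP; exact: (measurable_int mu sumi).
move=> x /andP[x1 x2]; have x11 := le_trans N1 x1.
apply: le_trans (hK x H x11 (le_trans HN x1)) _; rewrite ler_wpM2l//.
have x0 := le_trans ler01 x11; have e14 : 0 <= 14 * e by rewrite mulr_ge0 ?(ltW e0).
by rewrite ge0_ler_powR ?nnegrE ?(le_trans x0 x2).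
Qed.

(** The chain $\lfloor2N\rfloor\le2\lfloor N\rfloor+1\le3\lfloor N\rfloor$ uses $N\ge1$;
    [discrete_correlation] expects the range in this form. *)
Lemma floor_bounds (N : R) (n0 := Num.truncn N) (n1 := Num.truncn (2 * N)) : 1 <= N ->
  [/\ (0 < n0)%N, (n0 <= n1)%N, (n1 <= 3 * n0)%N,
      n0%:R <= N < n0.+1%:R & n1%:R <= 2 * N < n1.+1%:R].
Proof.
move=> N1; have N0 := le_trans ler01 N1; have NN : 0 <= 2 * N by lra.
have h0 := truncn_itv N0; have h1 := truncn_itv NN.
have n00 : (0 < n0)%N by rewrite truncn_gt0.
split=> //; first by rewrite le_truncn//; lra.
have : (n1 <= (2 * n0).+1)%N.
  rewrite truncn_le_nat (_ : (2 * n0).+2%:R = 2 * n0.+1%:R :> R).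
    by rewrite ltr_pM2l//; case/andP: h0.
  by rewrite -natrM mulnS add2n.
by move=> h; apply: (leq_trans h); clear -n00; lia.
Qed.

Lemma sum_above_floor (N : R) (m : nat) (F : nat -> R) : 0 <= N -> (Num.truncn N <= m)%N ->
  \sum_(1 <= n < m.+1 | N < n%:R) F n = \sum_((Num.truncn N).+1 <= n < m.+1) F n.
Proof.
move=> N0 nm; have nm' : ((Num.truncn N).+1 <= m.+1)%N by [].
rewrite (big_cat_nat (ltn0Sn _) nm')//= big_nat_cond big_pred0 ?add0r.
  rewrite big_nat_cond [RHS]big_nat_cond; apply: eq_bigl => n.
  apply: andb_id2l => /andP[h _]; rewrite (lt_le_trans (truncnS_gt N))//.
  by rewrite ler_nat.
move=> n; apply/negbTE/negP => /andP[/andP[_ h]]; apply/negP; rewrite -leNgt.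
by rewrite -truncn_ge_nat// -ltnS.
Qed.

(** Each of the at most $2n_0$ unit intervals costs $(B/n_0)(2B)$, in all $4B^2$; the incomplete
    pieces $[n_0,N]$ and $[n_1,2N]$ cost $B^2$ each. *)
Lemma Q_sq_sum_integral (B N : R) (n0 := Num.truncn N) (n1 := Num.truncn (2 * N)) :
  1 <= N -> 0 <= B ->
  (forall x : R, 1 <= x -> x <= 4 * N -> `|Q x| <= B) ->
  (forall x y : R, 1 <= x -> x <= y -> y <= 4 * N -> `|Q y - Q x| <= B * (y - x) / x) ->
  `|\sum_(n0.+1 <= n < n1.+1) Q n%:R ^+ 2 - \int[mu]_(x in `[N, 2 * N]) Q x ^+ 2|
    <= 6 * B ^+ 2.
Proof.
move=> N1 B0 hB hL; have [p0 n01 n13 /andP[a1 a2] /andP[b1 b2]] := floor_bounds N1.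
rewrite -/n0 -/n1 in p0 n01 n13 a1 a2 b1 b2.
have n0R : 1 <= n0%:R :> R by rewrite ler1n.
have n0P : 0 < n0%:R :> R := lt_le_trans ltr01 n0R.
have N0 : 0 < N := lt_le_trans ltr01 N1.
pose f x := Q x ^+ 2.
have fm (E : set R) : measurable_fun E f.
  by apply: measurable_funX; apply: measurable_funTS; exact: Qk_measurable.
have fB (x : R) : 1 <= x -> x <= 4 * N -> `|f x| <= B ^+ 2.
  by move=> x1 x2; rewrite /f normrX lerXn2r ?nnegrE// hB.
have n1R : n0%:R <= n1%:R :> R by rewrite ler_nat.
have fi : mu.-integrable `[n0%:R, 2 * N] (EFin \o f).
  apply: (bounded_itv_integrable (B := B ^+ 2)) => // x /andP[x1 x2].
  by apply: fB; clear -n0R N0 x1 x2; lra.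
have n0N2 : N <= 2 * N by lra.
have s1 := Rintegral_itv_add a1 n0N2 fi.
have s2 := Rintegral_itv_add n1R b1 fi.
have s3 : `|\int[mu]_(x in `[n0%:R, N]) f x| <= B ^+ 2.
  apply: le_trans (normr_Rintegral_itv_le (B := B ^+ 2) a1 _ _) _ => //.
    by move=> x /andP[x1 x2]; apply: fB; clear -n0R N0 n1R x1 x2; lra.
  rewrite ler_piMr ?exprn_ge0// lerBlDl natr1 ltW//.
have s4 : `|\int[mu]_(x in `[n1%:R, 2 * N]) f x| <= B ^+ 2.
  apply: le_trans (normr_Rintegral_itv_le (B := B ^+ 2) b1 _ _) _ => //.
    by move=> x /andP[x1 x2]; apply: fB; clear -n0R N0 n1R x1 x2; lra.
  rewrite ler_piMr ?exprn_ge0// lerBlDl natr1 ltW//.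
have s5 : `|\int[mu]_(x in `[n0%:R, n1%:R]) f x - \sum_(n0.+1 <= n < n1.+1) f n%:R| <= 4 * B ^+ 2.
  have nE : n1 = (n0 + (n1 - n0))%N by rewrite subnKC.
  rewrite nE; apply: le_trans (integral_sum_close (B := B ^+ 2) (e := 2 * B ^+ 2 / n0%:R) _ _ _) _.
  - exact: fm.
  - by move=> x /andP[x1]; rewrite -nE => x2; apply: fB; clear -n0R N0 b1 x1 x2; lra.
  - move=> n x /andP[m1]; rewrite -nE => m2 /andP[x1 x2].
    have nn0 : n0%:R <= n%:R :> R by rewrite ler_nat.
    have nn1 : n.+1%:R <= n1%:R :> R by rewrite ler_nat.
    have x11 : 1 <= x by clear -n0R nn0 x1; lra.
    have x4 : n.+1%:R <= 4 * N by clear -nn1 b1 N0; lra.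
    have c1 := hL x n.+1%:R x11 x2 x4.
    have c2 : B * (n.+1%:R - x) / x <= B / n0%:R.
      rewrite -mulrA ler_wpM2l//; apply: (@le_trans _ _ (1 / x)).
        rewrite ler_wpM2r ?invr_ge0 ?(le_trans ler01)// -natr1; clear -x1; lra.
      rewrite mul1r lef_pV2 ?posrE//; clear -x1 x11 nn0; lra.
    have c3 := hB x x11 (le_trans x2 x4).
    have c4 := hB n.+1%:R (le_trans x11 x2) x4.
    rewrite /f subr_sqr normrM distrC.
    rewrite (_ : 2 * B ^+ 2 / n0%:R = (B / n0%:R) * (2 * B)); last by ring.
    apply: ler_pM => //; first exact: le_trans c1 c2.
    apply: le_trans (ler_normD _ _) _; clear -c3 c4; lra.
  rewrite mulrA ler_pdivrMr//.
  have : (n1 - n0)%:R <= 2 * n0%:R :> R by rewrite -natrM ler_nat; clear -n13 n01; lia.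
  move: (n1 - n0)%:R => j hj; have := ler_wpM2r (_ : 0 <= 2 * B ^+ 2) hj.
  rewrite mulr_ge0 ?exprn_ge0// => /(_ isT); lra.
rewrite distrC.
move: s1 s2 s3 s4 s5; rewrite -/(f _); set i1 := \int[mu]_(x in `[n0%:R, 2 * N]) f x.
set i2 := \int[mu]_(x in `[n0%:R, N]) f x; set i3 := \int[mu]_(x in `[N, 2 * N]) f x.
set i4 := \int[mu]_(x in `[n0%:R, n1%:R]) f x; set i5 := \int[mu]_(x in `[n1%:R, 2 * N]) f x.
set S := \sum_(_ <= _ < _) _ => s1 s2; rewrite -/i3 !ler_norml.
move=> /andP[? ?] /andP[? ?] /andP[? ?]; apply/andP; split; lra.
Qed.

End Assembly.

Theorem theorem1 (R : realType) (k : nat) (hk : (3 <= k)%N)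
    (eps : R) (heps : 0 < eps) :
  exists C : R, 0 < C /\
    forall N H : R, 1 <= N -> 1 <= H -> H <= N ->
      `| \sum_(1 <= h < (Num.truncn H).+1) Delta_shift k N h |
        <= C * N `^ eps * (H ^+ 2 + N `^ (1 + beta R k)).
Proof.
case: k hk => // k _; set b := beta R k.+1; have b0 : 0 <= b := beta_ge0 R k.
(* The singular series requires $14e\le\varepsilon$, and $B^2W$ requires $3e\le\varepsilon$; the cap
   $1/8$ is the hypothesis of [sterm_bound]. *)
pose e := Num.min 8^-1 (eps / 16).
have e0 : 0 < e by rewrite lt_min divr_gt0// andbT invr_gt0.
have e8 : e <= 8^-1 by rewrite ge_min lexx.
have e16 : e <= eps / 16 by rewrite ge_min lexx orbT.
have [K1 K11 hd] := divk_bound k.+1 e0.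
have [K2 K21 [hQ hQl hM]] := Mterm_estimates k e0.
have [K3 K31 hW] := first_moment_discrete k e0.
have [K4 K40 hS] := singular_integral k e0 e8.
pose K := K1 + K2; have K_1 : 1 <= K by rewrite /K; lra.
have K0 : 0 <= K := le_trans ler01 K_1.
have K12 : K1 <= K /\ K2 <= K by rewrite /K; split; lra.
pose A := K * 4 `^ e; have A1 : 1 <= A.
  rewrite -[1]mulr1 ler_pM//; rewrite -[leLHS](powRr0 4) ler_powR ?ler1n ?(ltW e0)//.
have A0 : 0 <= A := le_trans ler01 A1.
pose G := K3 * 4 `^ (1 + b + e); have G0 : 0 <= G by rewrite mulr_ge0 ?powR_ge0 ?(le_trans ler01).
(* Here 26 is 20 from [discrete_correlation] plus 6 from [Q_sq_sum_integral]; [G] comes from the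
   first moment up to $4n_0$ and [K4] from the singular series. *)
pose C := 26 * A ^+ 2 + 20 * A ^+ 2 * G + K4 + 1.
have A20 : 0 <= A ^+ 2 by rewrite exprn_ge0.
have C0 : 0 < C by rewrite /C; have := mulr_ge0 A20 G0; lra.
exists C; split=> // N H N1 H1 HN.
have N0 : 0 < N := lt_le_trans ltr01 N1; have H0 := le_trans ler01 H1.
have [p0 n01 n13 /andP[a1 a2] /andP[b1 b2]] := floor_bounds N1.
set n0 := Num.truncn N in p0 n01 n13 a1 a2 *; set n1 := Num.truncn (2 * N) in n01 n13 b1 b2 *.
set h0 := Num.truncn H.
have h0H : h0%:R <= H by rewrite truncn_le.
have h0n : (h0 <= n0)%N by rewrite le_truncn.
have h0N : h0%:R <= N := le_trans h0H HN.
(* One constant for the values of $d_k$ and $Q$ and for the increments of $Q$ and $M$ on $[1,4N]$,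
   where all arguments lie. *)
pose B := K * (4 * N) `^ e.
have N4 : 1 <= 4 * N by lra.
have BE : B = A * N `^ e by rewrite /B powRM ?(ltW N0)// mulrA.
have Ne1 : 1 <= N `^ e by rewrite -[leLHS](powRr0 N) ler_powR ?(ltW e0).
have B1 : 1 <= B by rewrite BE -[1]mulr1 ler_pM.
have B0 : 0 <= B := le_trans ler01 B1.
have pw (x : R) : 1 <= x -> x <= 4 * N -> x `^ e <= (4 * N) `^ e.
  by move=> x1 x4; rewrite ge0_ler_powR ?nnegrE ?(ltW e0) ?(le_trans ler01).
have KB (c x : R) : 0 <= c -> c <= K -> 1 <= x -> x <= 4 * N -> c * x `^ e <= B.
  by move=> c0 cK x1 x4; apply: ler_pM; rewrite ?powR_ge0//; exact: pw.
have K10 := le_trans ler01 K11; have K20 := le_trans ler01 K21.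
have n4N (n : nat) : (n <= 4 * n0)%N -> n%:R <= 4 * N.
  move=> h; apply: (@le_trans _ _ (4 * n0)%:R); first by rewrite ler_nat.
  by rewrite natrM ler_wpM2l.
have QB (x : R) : 1 <= x -> x <= 4 * N -> `|Qk k.+1 x 1| <= B.
  move=> x1 x4; apply: le_trans (hQ x x1) _; apply: KB => //; exact: K12.2.
have QL (x y : R) : 1 <= x -> x <= y -> y <= 4 * N ->
    `|Qk k.+1 y 1 - Qk k.+1 x 1| <= B * (y - x) / x.
  move=> x1 xy y4; apply: le_trans (hQl x y x1 xy) _.
  rewrite ler_wpM2r ?invr_ge0 ?(le_trans ler01)// ler_wpM2r ?subr_ge0//.
  apply: KB => //; [exact: K12.2|exact: le_trans xy].
have c1 (n : nat) : (0 < n <= 4 * n0)%N -> 0 <= ((divk k.+1 n)%:R : R) <= B.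
  move=> /andP[np nl]; rewrite ler0n; apply: le_trans (hd n np) _.
  by apply: KB; rewrite ?ler1n ?n4N//; exact: K12.1.
have c2 (n : nat) : (0 < n <= 4 * n0)%N -> `|Qk k.+1 (n%:R : R) 1| <= B.
  by move=> /andP[np nl]; apply: QB; rewrite ?ler1n ?n4N.
have c3 (n : nat) : (0 < n < 4 * n0)%N ->
    `|Qk k.+1 (n.+1%:R : R) 1 - Qk k.+1 n%:R 1| <= B / n%:R.
  move=> /andP[np nl]; have := QL n%:R n.+1%:R; rewrite ler1n ler_nat leqnSn n4N//.
  by move=> /(_ np isT isT); rewrite -[X in B * (X - _)]natr1 addrAC subrr add0r mulr1.
have c4 (n h : nat) : (0 < n)%N -> (n + h <= 4 * n0)%N ->
    `|Mterm k.+1 ((n + h)%:R : R) - Mterm k.+1 n%:R - h%:R * Qk k.+1 n%:R 1|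
      <= B * h%:R ^+ 2 / n%:R.
  move=> np nl; have n1R : 1 <= n%:R :> R by rewrite ler1n.
  have nhR : n%:R <= (n + h)%:R :> R by rewrite ler_nat leq_addr.
  have := hM _ _ n1R nhR; rewrite (_ : (n + h)%:R - n%:R = h%:R); last by rewrite natrD addrAC subrr add0r.
  move=> /le_trans; apply; rewrite ler_wpM2r ?invr_ge0// ler_wpM2r ?exprn_ge0//.
  by apply: KB; rewrite ?n4N ?(le_trans n1R)//; exact: K12.2.
have corr := @discrete_correlation R (fun n => (divk k.+1 n)%:R) (@Mterm R k.+1)
  (fun x => Qk k.+1 x 1) B n0 n1 h0 B1 p0 n01 n13 h0n.
have {}corr := corr c1 c2 c3 c4.
have cI := Q_sq_sum_integral (k := k) N1 B0 QB QL.
have cS := hS N h0 N1 h0N.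
rewrite -/n0 -/n1 in cI.
set W := \sum_(1 <= n < (4 * n0).+1) _ in corr.
set DD := \sum_(n0.+1 <= n < n1.+1) \sum_(_ <= _ < _) _ in corr.
set S := \sum_(n0.+1 <= n < n1.+1) Qk k.+1 n%:R 1 ^+ 2 in corr cI.
set I := \int[lebesgue_measure]_(x in `[N, 2 * N]) (Qk k.+1 x 1 ^+ 2) in cI cS.
set SS := \sum_(1 <= h < h0.+1) \int[lebesgue_measure]_(x in `[N, 2 * N]) singular_series k.+1 x h in cS.
have -> : \sum_(1 <= h < h0.+1) Delta_shift k.+1 N h = DD - SS.
  rewrite /Delta_shift sumrB; congr (_ - _).
  under eq_bigr do rewrite sum_above_floor ?(ltW N0)//.
  by rewrite exchange_big.
have WE : W <= G * N `^ (1 + b + e).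
  have -> : W = \sum_(1 <= n < (4 * n0).+1) `|Delta k.+1 (n%:R : R)|.
    by apply: eq_bigr => n _; rewrite Delta_nat.
  have n40 : (0 < 4 * n0)%N by rewrite muln_gt0.
  apply: le_trans (hW _ n40) _; rewrite /G -mulrA ler_wpM2l ?(le_trans ler01)//.
  rewrite -powRM ?(ltW N0)// ge0_ler_powR ?nnegrE//; [by clear -b0 e0; lra|by clear -N1; lra|exact: n4N].
have W0 : 0 <= W by apply: sumr_ge0.
have pNe : N `^ e ^+ 2 <= N `^ eps.
  rewrite -powR_mulrn ?powR_ge0// -powRrM ler_powR//; clear -e0 e16 heps; lra.
have B2 : B ^+ 2 <= A ^+ 2 * N `^ eps by rewrite BE exprMn ler_wpM2l.
have B2W : B ^+ 2 * W <= A ^+ 2 * G * (N `^ eps * N `^ (1 + b)).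
  apply: (@le_trans _ _ (A ^+ 2 * N `^ e ^+ 2 * (G * N `^ (1 + b + e)))).
    by rewrite BE exprMn ler_wpM2l// mulr_ge0 ?exprn_ge0 ?powR_ge0.
  rewrite [leLHS](_ : _ = A ^+ 2 * G * (N `^ e ^+ 2 * N `^ (1 + b + e))); last by ring.
  have AG0 : 0 <= A ^+ 2 * G by rewrite mulr_ge0.
  apply: (ler_wpM2l AG0); rewrite -[N `^ e ^+ 2]powR_mulrn ?powR_ge0// -powRrM.
  have pD s t : N `^ s * N `^ t = N `^ (s + t).
    by rewrite powRD//; apply/implyP => _; rewrite gt_eqF.
  by rewrite !pD ler_powR//; clear -e0 e16 heps; lra.
have N14 : N `^ (1 + 14 * e) <= N `^ eps * N `^ (1 + b).
  rewrite -powRD; last by apply/implyP => _; rewrite gt_eqF.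
  by rewrite ler_powR//; clear -b0 e0 e16 heps; lra.
have P0 : 0 <= N `^ eps by exact: powR_ge0.
have Y0 : 0 <= N `^ (1 + b) by exact: powR_ge0.
(* This lets the error $h_0\cdot6B^2$ be absorbed into $B^2H^2$. *)
have hh : h0%:R <= h0%:R ^+ 2 :> R.
  by rewrite -natrX ler_nat; case: (h0) => // n; rewrite expnS expn1 leq_pmulr.
have hh2 : h0%:R ^+ 2 <= H ^+ 2 :> R by rewrite lerXn2r ?nnegrE.
have t2 : `|h0%:R * (S - I)| <= 6 * (B ^+ 2 * H ^+ 2).
  rewrite normrM normr_nat; apply: (@le_trans _ _ (H ^+ 2 * (6 * B ^+ 2))); last by rewrite mulrC mulrA.
  by apply: ler_pM => //; exact: le_trans hh hh2.
have t1 : `|DD - h0%:R * S| <= 20 * (B ^+ 2 * H ^+ 2) + 20 * (B ^+ 2 * W).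
  apply: (le_trans corr); rewrite -mulrA mulrDr mulrDr lerD2r ler_wpM2l//.
  by rewrite ler_wpM2l ?exprn_ge0.
have t3 : `|DD - SS| <= `|DD - h0%:R * S| + `|h0%:R * (S - I)| + `|SS - h0%:R * I|.
  rewrite [X in `|X| <= _](_ : _ = (DD - h0%:R * S) + h0%:R * (S - I) - (SS - h0%:R * I)); last by ring.
  apply: le_trans (ler_normB _ _) _; rewrite lerD2r; exact: ler_normD.
have t4 : B ^+ 2 * H ^+ 2 <= A ^+ 2 * (N `^ eps * H ^+ 2).
  by rewrite mulrA ler_wpM2r ?exprn_ge0.
have t5 : `|SS - h0%:R * I| <= K4 * (N `^ eps * N `^ (1 + b)).
  by apply: (le_trans cS); rewrite ler_wpM2l.
have PH0 : 0 <= N `^ eps * H ^+ 2 by rewrite mulr_ge0 ?exprn_ge0.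
have PY0 : 0 <= N `^ eps * N `^ (1 + b) by rewrite mulr_ge0.
have AG0 : 0 <= A ^+ 2 * G by rewrite mulr_ge0.
(* [C] multiplies both $H^2$ and $N^{1+b}$; [r1] and [r2] are the nonnegative parts left over. *)
have r1 : 0 <= (20 * (A ^+ 2 * G) + K4 + 1) * (N `^ eps * H ^+ 2).
  by rewrite mulr_ge0// addr_ge0// addr_ge0// mulr_ge0.
have r2 : 0 <= (26 * A ^+ 2 + 1) * (N `^ eps * N `^ (1 + b)).
  by rewrite mulr_ge0// addr_ge0// mulr_ge0.
rewrite [leRHS](_ : _ = 26 * (A ^+ 2 * (N `^ eps * H ^+ 2))
   + 20 * (A ^+ 2 * G * (N `^ eps * N `^ (1 + b))) + K4 * (N `^ eps * N `^ (1 + b))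
   + (20 * (A ^+ 2 * G) + K4 + 1) * (N `^ eps * H ^+ 2)
   + (26 * A ^+ 2 + 1) * (N `^ eps * N `^ (1 + b))); last by rewrite /C; ring.
clear -t1 t2 t3 t4 t5 B2W r1 r2; lra.
Qed.
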